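(* Let $n\ge 1$ be an integer, let $m_1,\dots,m_n$ be nonnegative integers with $|m|=m_1+\dots+m_n$, and let $z=(z_1,\dots,z_n)$ and $a,b,c,d,e,f,g$ be nonzero complex parameters satisfying $$a^3q^{|m|+2}=bcdefg,$$ such that no denominator in the identity below vanishes. Then $$\sum_{y_1,\dots,y_n=0}^{m_1,\dots,m_n} \frac{\Delta(zq^y)}{\Delta(z)}\prod_{k=1}^n \frac{\theta(az_kq^{y_k+|y|})}{\theta(az_k)} \prod_{j=1}^n\frac{(az_j)_{|y|}} {(q^{1+m_j}az_j)_{|y|}}\,\frac {(b,c,d)_{|y|}}{(aq/e,aq/f,aq/g)_{|y|}}\,q^{|y|}$$ $$\quad\times \prod_{j,k=1}^n\frac{(q^{-m_j}z_k/z_j)_{y_k}} {(qz_k/z_j)_{y_k}}\prod_{k=1}^n\frac{(ez_k,fz_k,gz_k)_{y_k}} {(aqz_k/b,aqz_k/c,aqz_k/d)_{y_k}}$$ $$=g^{|m|}q^{-\sum_{j<k}m_jm_k}\frac{(b,aq/cg,aq/dg)_{|m|}} {(aq/e,aq/f,aq/g)_{|m|}} \prod_{k=1}^n \frac{z_k^{m_k}(aqz_k,\;q^{1+|m|-m_k}a/z_keg,\;q^{1+|m|-m_k}a/z_kfg)_{m_k}} {(aqz_k/c,\;aqz_k/d,\;q^{|m|-m_k}b/gz_k)_{m_k}}$$ $$\quad\times\sum_{y_1,\dots,y_n=0}^{m_1,\dots,m_n} \frac{\Delta(zq^y)}{\Delta(z)}\prod_{k=1}^n \frac{\theta(gz_kq^{y_k+|y|-|m|}/b)}{\theta(gz_kq^{-|m|}/b)}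 \prod_{j=1}^n\frac{(gz_jq^{-|m|}/b)_{|y|}} {(gz_jq^{m_j+1-|m|}/b)_{|y|}}\,\frac {(q^{-|m|}g/a,aq/be,aq/bf)_{|y|}} {(q^{-|m|}cg/a,q^{-|m|}dg/a,q^{1-|m|}/b)_{|y|}}\,q^{|y|}$$ $$\quad\times \prod_{j,k=1}^n\frac{(q^{-m_j}z_k/z_j)_{y_k}} {(qz_k/z_j)_{y_k}}\prod_{k=1}^n\frac{(aqz_k/bc,aqz_k/bd,gz_k)_{y_k}} {(aqz_k/b,q^{-|m|}egz_k/a,q^{-|m|}fgz_k/a)_{y_k}}.$$ Here each sum is over all integer vectors $y=(y_1,\dots,y_n)$ with $0\le y_k\le m_k$ for every $k$.
   Context: Fix complex numbers $p$ with $|p|<1$ and $q\neq 0$. The theta function is $\theta(x)=\prod_{j=0}^\infty(1-p^jx)(1-p^{j+1}/x)$ for $x\neq 0$. The elliptic Pochhammer symbol is $(u)_k=\theta(u)\theta(uq)\cdots\theta(uq^{k-1})$ for integers $k\ge 0$, with $(u)_0=1$, and $(u_1,\dots,u_r)_k=(u_1)_k\cdots(u_r)_k$. For a vector $z=(z_1,\dots,z_n)$ put $\Delta(z)=\prod_{1\le j<k\le n}z_j\,\theta(z_k/z_j)$ (equal to $1$ if $n=1$), and for $y=(y_1,\dots,y_n)$ let $zq^y=(z_1q^{y_1},\dots,z_nq^{y_n})$ and $|y|=y_1+\dots+y_n$, so that $$\frac{\Delta(zq^y)}{\Delta(z)}=\prod_{1\le j<k\le n}q^{y_j}\frac{\theta(z_kq^{y_k}/z_jq^{y_j})}{\theta(z_k/z_j)}.$$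 In quotients written on one line, everything after the slash is in the denominator: e.g. $aq/cg=aq/(cg)$, $q^{1+|m|-m_k}a/z_keg=q^{1+|m|-m_k}a/(z_keg)$, $q^{|m|-m_k}b/gz_k=q^{|m|-m_k}b/(gz_k)$, $aqz_k/bc=aqz_k/(bc)$. The sum $\sum_{j<k}m_jm_k$ is over $1\le j<k\le n$. *)

(* Defs.v *)
From mathcomp Require Import all_boot all_order all_algebra.
From mathcomp Require Export complex.
From mathcomp Require Import boolp classical_sets reals topology normedtype.
Import GRing.Theory Num.Theory.
Import numFieldNormedType.Exports.

Set Implicit Arguments.
Unset Strict Implicit.
Unset Printing Implicit Defensive.

Local Open Scope ring_scope.
Local Open Scope classical_set_scope.

(* These definitions are over an arbitrary numFieldType C because such a C
   carries the topology of its norm, which the type R[i] itself is not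
   declared to have in the library; they are meant for C := R[i]. *)

(* Relevant only for `|p| < 1 and x != 0, where the partial products
   converge. *)
Definition theta (C : numFieldType) (p x : C) : C :=
  lim ((fun N : nat =>
    \prod_(j < N) ((1 - p ^+ j * x) * (1 - p ^+ j.+1 / x))) @ \oo).

(* (u_1, ..., u_r)_k with us = [:: u_1; ...; u_r] *)
Definition epoch (C : numFieldType) (p q : C) (us : seq C) (k : nat) : C :=
  \prod_(u <- us) \prod_(i < k) theta p (u * q ^+ i).

Definition Delta (C : numFieldType) (p : C) (n : nat) (z : 'I_n -> C) : C :=
  \prod_(j < n) \prod_(k < n | (j < k)%N) (z j * theta p (z k / z j)).

Definition wt (n : nat) (y : 'I_n -> nat) : nat := (\sum_(k < n) y k)%N.

Definition qshift (C : numFieldType) (q : C) (n : nat) (z : 'I_n -> C)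
    (y : 'I_n -> nat) : 'I_n -> C :=
  fun k => z k * q ^+ y k.

(* The sum of F y over all y with 0 <= y k <= m k for every k. The common
   bound wt m >= m k only serves to make the index type finite. *)
Definition boxsum (C : numFieldType) (n : nat) (m : 'I_n -> nat)
    (F : ('I_n -> nat) -> C) : C :=
  \sum_(y : {ffun 'I_n -> 'I_(wt m).+1} | [forall k, (y k <= m k)%N])
    F (fun k => y k : nat).

(* Main.v *)
Require Import Defs.
From mathcomp Require Import all_boot all_order all_algebra.
From mathcomp Require Import complex reals.
From mathcomp Require Import boolp classical_sets cardinality ereal.
From mathcomp Require Import topology normedtype sequences exp.
From mathcomp Require Import lebesgue_measure ring lra zify.

(** The transformation is a composite of two elliptic Bailey transformations
of type A_n, the first one from the base [a] to [lam = a^2 q / (b c e)], the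
second one from [lam] to [g q^-|m| / b].

The Bailey transformation itself is proved by induction on [|m|]. Fix the
product [f g]. After multiplication by [(aq/f, aq/g)_|m|] both sides are, as
functions of [f], combinations of products of [|m|] factors
[theta(x alpha) theta(k alpha / x)] with [k = f g], hence they agree as soon as
they agree at [|m| + 1] points in general position. At the [|m|] points
[f = q^-i / z_k] with [0 <= i < m_k] the parameters [q^-m_k / z_k] and [f]
play symmetric roles, and exchanging them replaces [m_k] by [i]: this is the
induction hypothesis. At the remaining point [g = a q^|m|] only the term [y = m]
survives on the left, and the right-hand side is a Jackson sum, which is itself
the special case [c e = a q] of the Bailey transformation.

These arguments only use [theta(1/x) = - theta(x)/x] and the addition formula.
The latter follows from the Jacobi triple product: up to a constant,
[theta(xy) theta(x/y) = x (O(x) E(y) - E(x) O(y))] where [E] and [O] are the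
series of [p^(k^2) x^(2k)] and [p^(k^2+k) x^(2k+1)], so that the addition
formula is a Pluecker relation.

The base [lam] introduces denominators that are absent from the statement and
may vanish. Multiplying [a], [g] and the other parameters by [t^4], [t^7] and
[t] preserves the balancing condition and makes every such denominator a theta
function of a nonconstant monomial in [t]; it is nonzero for all [t] outside a
countable set, and the identity follows by letting [t] tend to [1]. *)

(** One Bailey step leaves three parameters, [d], [f] and [g], unchanged. In the composite only [g]
    survives both steps, and [lam] disappears from the result. Vanishing denominators are the main
    obstacle. The induction moves parameters by powers of [q], so theta is required not to vanish
    along whole [q]-orbits: a finite list of monomials in the parameters then controls every
    denominator met on the way. The perturbation keeps [z], [p] and [q] fixed, hence the conditions
    on these alone have to be read off the denominators of the statement. The exponents of [t] fit
    because [3 * 4 = 5 * 1 + 7]. *)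

Local Open Scope ring_scope.
Local Open Scope complex_scope.

(* Lets [field] treat a power with a symbolic exponent as an atom. *)
Ltac abs t := let x := fresh "x" in set (x := t) in *; clearbody x.

(** * Theta functions on an abstract field and the Bailey transformation *)

Section EllipticSeries.

Set Implicit Arguments.
Unset Strict Implicit.
Import GRing.Theory.

Variables (K : fieldType) (th : K -> K) (q : K).
Hypothesis q0 : q != 0.
Hypothesis thV : forall x, x != 0 -> th x^-1 = - (th x / x).

(** Invariant under [x -> k / x], which exchanges [f] and [g] when [f g = k]. *)
Definition bctheta (k al x : K) := th (x * al) * th (k * al / x).

Hypothesis th_add : forall k al be x h, k != 0 -> al != 0 -> be != 0 ->
  x != 0 -> h != 0 ->
  bctheta k al x * bctheta k be h - bctheta k al h * bctheta k be x =
  - (be * h * (th (al * be * k) * th (al / be))) * bctheta k h^-1 x.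
Hypothesis th1 : th 1 = 0.

(** Sums of products of [D] functions [bctheta k al], with the scalars in degree 0. Each constructor
    accepts any function with the right values at nonzero [x], so membership depends neither on the
    value at 0 nor on the way a function is written. *)
Inductive bcspace (k : K) : nat -> (K -> K) -> Prop :=
| bcspace_cst c h : (forall x, x != 0 -> h x = c) -> bcspace k 0 h
| bcspace_mul al D g h : al != 0 -> bcspace k D g ->
    (forall x, x != 0 -> h x = bctheta k al x * g x) -> bcspace k D.+1 h
| bcspace_add D g1 g2 h : bcspace k D g1 -> bcspace k D g2 ->
    (forall x, x != 0 -> h x = g1 x + g2 x) -> bcspace k D h.

Lemma eq_bcspace k D g h :
  (forall x, x != 0 -> h x = g x) -> bcspace k D g -> bcspace k D h.
Proof.
move=> hg bg; elim: bg h hg => [c g' eg|al D' g1 g' al0 b1 _ eg|D' g1 g2 g' b1 _ b2 _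
  eg] h hg.
- by apply: (@bcspace_cst k c) => x x0; rewrite hg ?eg.
- by apply: (bcspace_mul al0 b1) => x x0; rewrite hg ?eg.
- by apply: (bcspace_add b1 b2) => x x0; rewrite hg ?eg.
Qed.

Lemma bcspaceZ k D c g : bcspace k D g -> bcspace k D (fun x => c * g x).
Proof.
move=> bg; elim: bg => [c' g' eg|al D' g1 g' al0 b1 IH eg|D' g1 g2 g' b1 IH1 b2 IH2 eg].
- by apply: (@bcspace_cst k (c * c')) => x x0; rewrite eg.
- by apply: (bcspace_mul al0 IH) => x x0; rewrite eg //; ring.
- by apply: (bcspace_add IH1 IH2) => x x0; rewrite eg //; ring.
Qed.

Lemma bcspaceM k D1 D2 g1 g2 : bcspace k D1 g1 -> bcspace k D2 g2 ->
  bcspace k (D1 + D2) (fun x => g1 x * g2 x).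
Proof.
move=> b1 b2; elim: b1 => [c g' eg|al D' g1' g' al0 b1 IH eg|D' g1' g2' g' b1 IH1 b2'
  IH2 eg].
- by apply: eq_bcspace (bcspaceZ c b2) => x x0; rewrite eg.
- by rewrite addSn; apply: (bcspace_mul al0 IH) => x x0; rewrite eg //; ring.
- by apply: (bcspace_add IH1 IH2) => x x0; rewrite eg //; ring.
Qed.

Lemma bcspace0 k D : bcspace k D (fun=> 0).
Proof.
elim: D => [|D IH]; first exact: (@bcspace_cst k 0).
by apply: (bcspace_mul (oner_neq0 K) IH) => x _; rewrite mulr0.
Qed.

Lemma bcspace_sum k D (I : Type) (r : seq I) (P : pred I) (F : I -> K -> K) :
  (forall i, P i -> bcspace k D (F i)) ->
  bcspace k D (fun x => \sum_(i <- r | P i) F i x).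
Proof.
move=> bF; elim: r => [|i r IH].
  by apply: eq_bcspace (bcspace0 k D) => x _; rewrite big_nil.
case Pi: (P i).
  by apply: (bcspace_add (bF i Pi) IH) => x _; rewrite big_cons Pi.
by apply: eq_bcspace IH => x _; rewrite big_cons Pi.
Qed.

Lemma bcspace_prod k (I : Type) (r : seq I) (D : I -> nat) (F : I -> K -> K) :
  (forall i, bcspace k (D i) (F i)) ->
  bcspace k (\sum_(i <- r) D i) (fun x => \prod_(i <- r) F i x).
Proof.
move=> bF; elim: r => [|i r IH].
  by rewrite big_nil; apply: (@bcspace_cst k 1) => x _; rewrite big_nil.
rewrite big_cons; apply: eq_bcspace (bcspaceM (bF i) IH) => x _.
by rewrite big_cons.
Qed.

Lemma th_eq0V x : x != 0 -> (th x^-1 == 0) = (th x == 0).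
Proof.
by move=> x0; rewrite thV // oppr_eq0 mulf_eq0 invr_eq0 (negbTE x0) orbF.
Qed.

Lemma bctheta_root k be : be != 0 -> bctheta k be^-1 be = 0.
Proof. by move=> be0; rewrite /bctheta divff // th1 mul0r. Qed.

Lemma bctheta_sym k be ga : k != 0 -> be != 0 -> ga != 0 ->
  (bctheta k be^-1 ga == 0) = (bctheta k ga^-1 be == 0).
Proof.
move=> k0 be0 ga0; rewrite /bctheta !mulf_eq0 -th_eq0V ?mulf_neq0 ?invr_neq0 //.
by rewrite invfM invrK [_^-1 * _]mulrC; congr (_ || (th _ == 0)); field; rewrite be0 ga0.
Qed.

(* By the addition formula the functions [bctheta k al] span a space of
   dimension two: every one of them is a combination of [bctheta k be^-1], which
   vanishes at [be], and of any [bctheta k ga] that does not. *)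
Lemma bcspace_factor k D h be ga : k != 0 -> be != 0 -> ga != 0 ->
  bctheta k ga be != 0 -> bcspace k D h ->
  exists g c, (if D is D'.+1 then bcspace k D' g else forall x, g x = 0) /\
    forall x, x != 0 -> h x = bctheta k be^-1 x * g x + c * bctheta k ga x ^+ D.
Proof.
move=> k0 be0 ga0 w0.
elim=> [c g' eg|al D' g1 g' al0 b1 [g [c [bg eg1]]] eg
       |D' g1 g2 g' _ [u1 [c1 [b1 e1]]] _ [u2 [c2 [b2 e2]]] eg].
- by exists (fun=> 0), c; split=> // x x0; rewrite eg // mulr0 add0r expr0 mulr1.
(* [A] and [B] come from the addition formula at the points [x] and [be], divided by
   [bctheta k ga be]. *)
- pose A := - (ga * be * (th (al * ga * k) * th (al / ga))) / bctheta k ga be.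
  pose B := bctheta k al be / bctheta k ga be.
  have eal x : x != 0 -> bctheta k al x = A * bctheta k be^-1 x + B * bctheta k ga x.
    move=> x0; apply: (mulIf w0).
    have := th_add k0 al0 ga0 x0 be0 => /eqP; rewrite subr_eq => /eqP ->.
    by rewrite /A /B; field.
  exists (fun x => A * g1 x + B * (bctheta k ga x * g x)), (B * c); split; last first.
    by move=> x x0; rewrite eg // eal // eg1 //= exprS; ring.
  case: D' b1 bg {eg1} => [|D'] b1 bg.
    by apply: eq_bcspace (bcspaceZ A b1) => x _; rewrite bg !mulr0 addr0.
  apply: (@bcspace_add k _ _ (fun x => B * (bctheta k ga x *
    g x)) _ (bcspaceZ A b1)) => //.
  exact/bcspaceZ/(bcspace_mul ga0 bg).
- exists (fun x => u1 x + u2 x), (c1 + c2); split.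
    by case: D' b1 b2 {e1 e2} => [b1 b2 x|D' b1 b2];
      [rewrite b1 b2 addr0|exact: (bcspace_add b1 b2)].
  by move=> x x0; rewrite eg // e1 // e2 //; ring.
Qed.

(** The counterpart of a nonzero polynomial of degree [D] having at most [D] roots. Dividing by the
    factor that vanishes at the first node lowers [D]; the pairwise condition keeps this factor
    nonzero at the other nodes. *)
Lemma bcspace_eq0 k D h (s : seq K) : k != 0 -> bcspace k D h ->
  size s = D.+1 -> all (fun be => be != 0) s ->
  pairwise (fun be be' => bctheta k be^-1 be' != 0) s ->
  (forall be, be \in s -> h be = 0) -> forall x, x != 0 -> h x = 0.
Proof.
move=> k0; elim: s D h => [//|be [|be1 s] IH] D h bh.
  case=> D0 /= /andP[be0 _] _ h0 x x0; move: bh; rewrite -D0 => bh.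
  have {}h0 : h be = 0 by apply: h0; rewrite inE.
  (* The degree is kept as an equation [D' = 0], because [bcspace_add] also builds elements of
     degree 0. *)
  have const D' g : bcspace k D' g -> D' = 0%N -> forall y y',
    y != 0 -> y' != 0 -> g y = g y'.
    elim=> [c g' eg _ y y' y0 y'0|//|D'' g1 g2 g' _ IH1 _ IH2 eg D'0 y y' y0 y'0].
      by rewrite !eg.
    by rewrite !eg // (IH1 _ y y') // (IH2 _ y y').
  by rewrite -h0; exact: (const 0%N).
case: D bh => [//|D] bh [sz] /= /and3P[be0 be10 s0] /andP[/andP[d1 dall] dp] h0 x x0.
(* [ga] is the inverse of the second node. By symmetry [bctheta k ga] does not vanish at [be], and
   evaluating the decomposition there gives [c = 0]. *)
have w0 : bctheta k be1^-1 be != 0 by rewrite bctheta_sym.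
have [g [c [bg eg]]] := bcspace_factor k0 be0 (invr_neq0 be10) w0 bh.
have c0 : c = 0.
  have := eg be be0; rewrite h0 ?mem_head // bctheta_root // mul0r add0r.
  by move/esym/eqP; rewrite mulf_eq0 expf_eq0 (negbTE w0) /= orbF => /eqP.
rewrite eg // c0 mul0r addr0 (IH D g) ?mulr0 //=; first by rewrite sz.
- by rewrite be10.
- move=> be' be's.
  have be'0 : be' != 0 by move: be's; rewrite inE => /orP[/eqP->//|]; exact: (allP s0).
  have : bctheta k be^-1 be' != 0.
    by move: be's; rewrite inE => /orP[/eqP->//|]; exact: (allP dall).
  move=> ne; apply: (mulfI ne); rewrite mulr0.
  have := eg be' be'0; rewrite c0 mul0r addr0 => <-; apply: h0.
  by rewrite inE be's orbT.
Qed.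

(** * Shifted factorials, and nonvanishing along orbits of [q] *)

Definition poch u k := \prod_(i < k) th (u * q ^+ i).

Lemma poch0 u : poch u 0 = 1.
Proof. exact: big_ord0. Qed.

Lemma poch1 u : poch u 1 = th u.
Proof. by rewrite /poch big_ord1 expr0 mulr1. Qed.

Lemma pochD u j k : poch u (j + k) = poch u j * poch (u * q ^+ j) k.
Proof.
rewrite /poch big_split_ord /=; congr (_ * _).
by apply: eq_bigr => i _; rewrite exprD mulrA.
Qed.

Lemma poch_eq0 u i k : (i < k)%N -> u * q ^+ i = 1 -> poch u k = 0.
Proof. by move=> ik ui; rewrite /poch (bigD1 (Ordinal ik)) //= ui th1 mul0r. Qed.

Lemma th_rev x y : x != 0 -> x * y = 1 -> th x = - x * th y.
Proof.
move=> x0 xy; have y0 : y != 0 by apply: contra_eq_neq xy => ->;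
  rewrite mulr0 eq_sym oner_neq0.
have -> : x = y^-1 by apply: (mulIf y0); rewrite xy mulVf.
by rewrite thV //; ring.
Qed.

(** Every factor is inverted and the order reversed, so [y] is [q^(1-M) / x]. The multiplicative
    form of the hypothesis avoids negative powers and lets each use choose the shape of [y]. *)
Lemma poch_rev x y M : x != 0 -> x * y * q ^+ M = q ->
  poch x M = (- x) ^+ M * q ^+ 'C(M, 2) * poch y M.
Proof.
move=> x0 xy; rewrite /poch [in RHS](reindex_inj rev_ord_inj) /=.
rewrite -bin2_sum big_mkord -prodrXr -[M in (- x) ^+ M]card_ord -prodr_const.
rewrite -!big_split /=; apply: eq_bigr => i _.
rewrite (@th_rev _ (y * q ^+ (M - i.+1))) ?mulf_neq0 ?expf_neq0 //; first by ring.
apply: (mulIf q0); rewrite mul1r -[RHS]xy -[in RHS](subnK (ltn_ord i)) exprD exprS.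
by ring.
Qed.

Lemma bcspace_poch k al m : al != 0 ->
  bcspace k m (fun x => poch (x * al) m * poch (k * al / x) m).
Proof.
move=> al0; have := @bcspace_prod k _ (index_enum 'I_m) (fun=> 1%N)
  (fun i x => bctheta k (al * q ^+ i) x).
rewrite sum1_card card_ord => H; apply: eq_bcspace (H _) => [x x0|i].
  rewrite /poch -big_split /=; apply: eq_bigr => i _.
  by rewrite /bctheta; congr (th _ * th _); field.
apply: (@bcspace_mul k (al * q ^+ i) 0 (fun=> 1)).
- by rewrite mulf_neq0 // expf_neq0.
- exact: (@bcspace_cst k 1).
- by move=> x _; rewrite mulr1.
Qed.

(** By inversion [th (u q^i / x)] is a multiple of [th (x / (u q^i))], so the factors that come from
    cleared denominators lie in the space as well, with [al = 1 / (u q^i)]. *)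
Lemma bcspace_pochV k u m : k != 0 -> u != 0 ->
  bcspace k m (fun x => poch (u / x) m * poch (u * x / k) m).
Proof.
move=> k0 u0; have := @bcspace_prod k _ (index_enum 'I_m) (fun=> 1%N)
  (fun i x => (u * q ^+ i) ^+ 2 / k * bctheta k (u * q ^+ i)^-1 x).
rewrite sum1_card card_ord => H; apply: eq_bcspace (H _) => [x x0|i].
  rewrite /poch -big_split /=; apply: eq_bigr => i _.
  have qi0 : q ^+ i != 0 by rewrite expf_neq0.
  rewrite (@th_rev (u / x * _) (x * (u * q ^+ i)^-1));
    [|by rewrite !mulf_neq0 ?invr_neq0|by field; rewrite x0 u0 qi0].
  rewrite (@th_rev (u * x / k * _) (k * (u * q ^+ i)^-1 / x));
    [|by rewrite !mulf_neq0 ?invr_neq0|by field; rewrite x0 u0 qi0].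
  by rewrite /bctheta; field; rewrite k0 x0.
apply: bcspaceZ; apply: (@bcspace_mul k (u * q ^+ i)^-1 0 (fun=> 1)).
- by rewrite invr_neq0 // mulf_neq0 // expf_neq0.
- exact: (@bcspace_cst k 1).
- by move=> x _; rewrite mulr1.
Qed.

Definition good x := forall s : int, th (x * q ^ s) != 0.

Lemma goodZ x (s : int) : good x -> good (x * q ^ s).
Proof. by move=> gx t; rewrite -mulrA -expfzDr. Qed.

Lemma goodX x (i : nat) : good x -> good (x * q ^+ i).
Proof. exact: (@goodZ x i%:Z). Qed.

Lemma goodXV x (i : nat) : good x -> good (x / q ^+ i).
Proof. by move=> gx; have := @goodZ x (- i%:Z) gx; rewrite -exprnN. Qed.

Lemma goodV x : x != 0 -> good x -> good x^-1.
Proof.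
move=> x0 gx s; have := gx (- s); rewrite -th_eq0V ?mulf_neq0 ?expfz_neq0 //.
by rewrite invfM -invr_expz invrK.
Qed.

Lemma good_poch x m : good x -> poch x m != 0.
Proof. by move=> gx; apply/prodf_neq0 => i _; exact: (gx i%:Z). Qed.

Lemma good_th x : good x -> th x != 0.
Proof. by move=> gx; have := gx 0; rewrite expr0z mulr1. Qed.

(** Groups [(j, k)] with [(k, j)], so that a product over all pairs combines with one over [j < k]
    such as [vdm]. The operation is general in order to treat the sums of exponents too. *)
Lemma big_pairs (T : Type) (idx : T) (op : Monoid.com_law idx) n
    (G : 'I_n -> 'I_n -> T) :
  \big[op/idx]_(j < n) \big[op/idx]_(k < n) G j k =
  op (\big[op/idx]_(j < n) G j j)
     (\big[op/idx]_(j < n) \big[op/idx]_(k < n | (j < k)%N) op (G j k) (G k j)).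
Proof.
transitivity (op (\big[op/idx]_(j < n) G j j)
   (op (\big[op/idx]_(j < n) \big[op/idx]_(k < n | (j < k)%N) G j k)
       (\big[op/idx]_(j < n) \big[op/idx]_(k < n | (k < j)%N) G j k))); last first.
  congr (op _ _).
  under [RHS]eq_bigr => j _ do rewrite big_split.
  rewrite big_split; congr (op _ _).
  rewrite (exchange_big_dep predT) //=.
rewrite -!big_split; apply: eq_bigr => j _ /=.
rewrite (bigD1 j) //=; congr (op _ _).
rewrite (bigID (fun k : 'I_n => (j < k)%N)) /=; congr (op _ _); apply: eq_bigl => k.
  by rewrite -(inj_eq val_inj) /=; lia.
by rewrite -(inj_eq val_inj) /=; lia.
Qed.

Lemma bin2SM x : ('C(x.+1, 2) * 2 = x * x + x)%N.
Proof.
by have := odd_double_half (x.+1 * x); rewrite oddM /= andNb bin2 /=; lia.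
Qed.

(** Half of the expansion of [|m|^2 + |m|]. The exponent [sum_{j<k} m_j m_k] of the theorem
    originates here. *)
Lemma bin2_sum_pairs n (m : 'I_n -> nat) :
  (\sum_(j < n) 'C((m j).+1, 2) + \sum_(j < n) \sum_(k < n | j < k) m j * m k
   = 'C((wt m).+1, 2))%N.
Proof.
have Ew : (wt m * wt m = \sum_(j < n) \sum_(k < n) m j * m k)%N.
  by rewrite /wt big_distrlr.
apply/double_inj; rewrite -!muln2 mulnDl bin2SM Ew big_pairs /= !big_distrl /=.
rewrite /wt addnAC -[X in _ = (X + _)%N]big_split /=.
congr (_ + _)%N; first by apply: eq_bigr => j _; rewrite bin2SM.
apply: eq_bigr => j _; rewrite big_distrl; apply: eq_bigr => k _.
by rewrite /= [X in _ = (_ + X)%N]mulnC; lia.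
Qed.

(** For [w = z_k / z_j], [a = m_j] and [b = m_k] this collects all that the pair [j < k] contributes
    to the summand at [y = m] apart from the parameters. *)
Lemma poch_pair w (a b : nat) : w != 0 -> th w != 0 ->
  poch (q * w) b != 0 -> poch (q / w) a != 0 ->
  (q ^+ a * th (w * q ^+ b / q ^+ a) / th w) *
  ((poch (w / q ^+ a) b / poch (q * w) b) *
   (poch (w^-1 / q ^+ b) a / poch (q / w) a)) = (q ^+ (a * b))^-1.
Proof.
move=> w0 tw0 p1 p2.
have [qa0 qb0] : q ^+ a != 0 /\ q ^+ b != 0 by rewrite !expf_neq0.
(* Two ways of cutting the same run of [a + b + 1] consecutive factors starting at [w / q^a]. *)
have E : th (w * q ^+ b / q ^+ a) * poch (w / q ^+ a) b * poch (w * q ^+ b.+1 / q ^+ a) a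
       = poch (w / q ^+ a) a * th w * poch (q * w) b.
  transitivity (poch (w / q ^+ a) (b + (1 + a))).
    rewrite !pochD poch1 expr1.
    have -> : w / q ^+ a * q ^+ b = w * q ^+ b / q ^+ a by ring.
    have -> : w * q ^+ b / q ^+ a * q = w * q ^+ b.+1 / q ^+ a by rewrite exprS; ring.
    by ring.
  have -> : (b + (1 + a) = a + (1 + b))%N by clear; lia.
  rewrite !pochD poch1 expr1 divfK // [w * q]mulrC; ring.
rewrite (@poch_rev (w^-1 / q ^+ b) (w * q ^+ b.+1 / q ^+ a)); last 2 first.
- by rewrite mulf_neq0 ?invr_neq0.
- by rewrite exprS; field; rewrite w0 qa0 qb0.
have R : poch (q / w) a = (- (q / w)) ^+ a * q ^+ 'C(a, 2) * poch (w / q ^+ a) a.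
  by apply: poch_rev; [rewrite mulf_neq0 ?invr_neq0|field; rewrite w0 qa0].
have p3 : poch (w / q ^+ a) a != 0 by move: p2; rewrite R mulf_eq0 negb_or => /andP[].
rewrite R.
have -> : (- (w^-1 / q ^+ b)) ^+ a = (- (q / w)) ^+ a / (q ^+ b.+1) ^+ a.
  by rewrite -expr_div_n; congr (_ ^+ a); rewrite exprS; field; rewrite w0 q0 qb0.
have -> : (q ^+ b.+1) ^+ a = q ^+ a * q ^+ (a * b).
  by rewrite -exprM -exprD; congr (_ ^+ _); clear; lia.
have hr : (- (q / w)) ^+ a != 0 by rewrite expf_neq0 // oppr_eq0 mulf_neq0 ?invr_neq0.
have qc0 : q ^+ 'C(a, 2) != 0 by rewrite expf_neq0.
have qab0 : q ^+ (a * b) != 0 by rewrite expf_neq0.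
transitivity ((th (w * q ^+ b / q ^+ a) * poch (w / q ^+ a) b * poch (w *
  q ^+ b.+1 / q ^+ a) a)
   / (poch (w / q ^+ a) a * th w * poch (q * w) b) / q ^+ (a * b)).
  clear E R; abs (q ^+ (a * b)); abs (q ^+ a); abs (q ^+ 'C(a, 2));
    abs ((- (q / w)) ^+ a).
  by field; repeat (apply/andP; split).
by rewrite E divff ?mul1r // !mulf_neq0.
Qed.

Lemma poch_diag a : poch q a != 0 ->
  poch (q ^+ a)^-1 a / poch q a = (-1) ^+ a * (q ^+ 'C(a.+1, 2))^-1.
Proof.
move=> p0; have qa0 : q ^+ a != 0 by rewrite expf_neq0.
rewrite (@poch_rev _ q) ?invr_neq0 //; last by field.
rewrite mulfK // -[X in X ^+ a]mulN1r exprMn -mulrA; congr (_ * _).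
have Ea : (a * a = 'C(a, 2) + 'C(a.+1, 2))%N by have := bin2SM a; rewrite binS bin1; lia.
rewrite exprVn -exprM Ea exprD; field; by rewrite !expf_neq0.
Qed.

(** * Box sums, and the exchange of a parameter with a summation bound *)

Section Box.

Variables (n : nat) (z : 'I_n -> K).
Hypothesis z0 : forall k, z k != 0.

Implicit Types (m y : 'I_n -> nat) (a b c d e f g lam u : K) (bs fs : seq K).

Definition vdm (w : 'I_n -> K) :=
  \prod_(j < n) \prod_(k < n | (j < k)%N) (w j * th (w k / w j)).

Definition core a y :=
  vdm (fun k => z k * q ^+ y k) / vdm z
  * (\prod_(k < n) (th (a * z k * q ^+ (y k + wt y)) / th (a * z k)))
  * (\prod_(j < n) poch (a * z j) (wt y)) * q ^+ wt y
  / \prod_(j < n) \prod_(k < n) poch (q * z k / z j) (y k).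

Definition bpart a b y := poch b (wt y) / \prod_(k < n) poch (a * q * z k / b) (y k).

Definition fpart a f y := (\prod_(k < n) poch (f * z k) (y k)) / poch (a * q / f) (wt y).

Definition node (j : 'I_n) (i : nat) := (q ^+ i)^-1 / z j.

(* The quotients involving [m_j] in the paper are the [fpart] of one more
   parameter [q^-m_j / z_j]; in this form the term is symmetric under exchanging
   that parameter with one of [fs]. *)
Definition term a bs m fs y :=
  core a y * (\prod_(b <- bs) bpart a b y)
  * (\prod_(j < n) fpart a (node j (m j)) y) * (\prod_(f <- fs) fpart a f y).

(** Unlike in [boxsum], the bound [N] is independent of [m]: the induction lowers [m] without
    changing the index type. *)
Definition bsum N m (F : ('I_n -> nat) -> K) :=
  \sum_(y : {ffun 'I_n -> 'I_N.+1} | [forall k, (y k <= m k)%N]) F (fun k => y k : nat).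

(** The denominators free of [a, ..., g]: those of [vdm] and of [(q z_k / z_j)_(y_k)]. For [j = k]
    the second condition says that [th (q^s)] is nonzero. *)
Definition zgood m :=
  (forall j k : 'I_n, (j < k)%N -> th (z k / z j) != 0) /\
  (forall (j k : 'I_n) s, (0 < s <= m k)%N -> th (q ^+ s * z k / z j) != 0).

(** The prefactors of the Bailey and Jackson identities are quotients of such functions, which have
    the same exchange symmetry as [term]. *)
Definition phi u m f := (\prod_(k < n) poch (u * z k) (m k)) / poch (u / f) (wt m).

Definition upd m (k : 'I_n) i j := if j == k then i else m j.

Lemma node_neq0 j i : node j i != 0.
Proof. by rewrite mulf_neq0 ?invr_neq0 ?expf_neq0. Qed.

Lemma leq_wt y m : (forall k, y k <= m k)%N -> (wt y <= wt m)%N.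
Proof. by move=> ym; apply: leq_sum. Qed.

Lemma eq_bsum N m F G : (forall y, (forall k, y k <= m k)%N -> F y = G y) ->
  bsum N m F = bsum N m G.
Proof. by move=> FG; apply: eq_bigr => y /forallP ym; exact: FG. Qed.

Lemma bsumZ N m x F : x * bsum N m F = bsum N m (fun y => x * F y).
Proof. exact: mulr_sumr. Qed.

Lemma bsum_shrink N m m' F : (forall k, m' k <= m k)%N ->
  (forall y k, (m' k < y k)%N -> F y = 0) -> bsum N m F = bsum N m' F.
Proof.
move=> m'm F0; rewrite /bsum big_mkcond [RHS]big_mkcond; apply: eq_bigr => y _.
case: ifPn => [/forallP ym|/forallPn[k ymk]].
  case: ifPn => // /forallPn[k]; rewrite -ltnNge => ym'.
  exact: (F0 _ k).
case: ifP => // /forallP ym'; case/negP: ymk; exact: leq_trans (ym' k) (m'm k).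
Qed.

Lemma wt_upd m k i : (wt (upd m k i) + m k = wt m + i)%N.
Proof.
rewrite /wt (bigD1 k) //= [in RHS](bigD1 k) //= /upd eqxx.
have -> : (\sum_(j < n | j != k) (if j == k then i else m j) = \sum_(j < n | j != k) m
  j)%N.
  by apply: eq_bigr => j /negbTE ->.
by rewrite addnC [(i + _)%N]addnC addnA.
Qed.

Lemma term_upd a bs m k i fs y :
  term a bs m (node k i :: fs) y = term a bs (upd m k i) (node k (m k) :: fs) y.
Proof.
rewrite /term !big_cons (bigD1 k) //= [in RHS](bigD1 k) //= /upd eqxx.
have -> : \prod_(j < n | j != k) fpart a (node j (if j == k then i else m j)) y =
    \prod_(j < n | j != k) fpart a (node j (m j)) y.
  by apply: eq_bigr => j /negbTE ->.
by ring.
Qed.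

(** Since [u / node k s = u z_k q^s], cross-multiplication leaves on both sides one factorial of
    [u z_k], of length [i + |m| = m_k + |upd m k i|]. *)
Lemma phi_upd u m k i : good (u * z k) ->
  phi u m (node k i) = phi u (upd m k i) (node k (m k)).
Proof.
move=> gu; have Ek : upd m k i k = i by rewrite /upd eqxx.
rewrite /phi (bigD1 k) //= [in RHS](bigD1 k) //= Ek.
have -> : \prod_(j < n | j != k) poch (u * z j) (upd m k i j) =
    \prod_(j < n | j != k) poch (u * z j) (m j).
  by apply: eq_bigr => j; rewrite /upd => /negbTE ->.
have E s : u / node k s = u * z k * q ^+ s.
  by rewrite /node; field; rewrite ?z0 ?oner_neq0 ?expf_neq0.
rewrite !E; have := pochD (u * z k) i (wt m).
have -> : (i + wt m = m k + wt (upd m k i))%N by have := wt_upd m k i; lia.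
rewrite pochD => Ew.
have p1 := good_poch (wt m) (goodX i gu).
have p2 := good_poch (wt (upd m k i)) (goodX (m k) gu).
apply/eqP; rewrite eqr_div //; apply/eqP.
transitivity (\prod_(j < n | j != k) poch (u * z j) (m j) *
  (poch (u * z k) (m k) * poch (u * z k * q ^+ m k) (wt (upd m k i)))); first by ring.
by rewrite Ew; ring.
Qed.

Lemma fpart_node_eq0 a k i y : (i < y k)%N -> fpart a (node k i) y = 0.
Proof.
move=> iy; rewrite /fpart (bigD1 k) //= (poch_eq0 iy) ?mul0r //.
by rewrite /node; field; rewrite ?z0 ?oner_neq0 ?expf_neq0.
Qed.

Lemma term_node_eq0 a bs m fs y k : (m k < y k)%N -> term a bs m fs y = 0.
Proof.
by move=> my; rewrite /term (bigD1 k) //= fpart_node_eq0 // !(mul0r, mulr0).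
Qed.

(** The parameter [node k i] kills all terms with [y_k > i], so the box may shrink along with the
    exchange. *)
Lemma bsum_upd N a bs m k i fs : (i <= m k)%N ->
  bsum N m (term a bs m (node k i :: fs)) =
  bsum N (upd m k i) (term a bs (upd m k i) (node k (m k) :: fs)).
Proof.
move=> im; rewrite (@bsum_shrink N m (upd m k i)).
- by apply: eq_bsum => y _; exact: term_upd.
- by move=> j; rewrite /upd; case: eqP => // ->.
- by move=> y j my; rewrite term_upd; exact: term_node_eq0 my.
Qed.

Lemma zgood_le m m' : (forall k, m' k <= m k)%N -> zgood m -> zgood m'.
Proof.
move=> m'm [h1 h2]; split=> // j k s /andP[s0 sm]; apply: h2; rewrite s0 /=.
exact: leq_trans sm (m'm k).
Qed.

Lemma goodMq u x : good (u / x) -> good (u * q / x).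
Proof. by move=> /(@goodX _ 1); rewrite expr1 mulrAC. Qed.

Lemma good_poch_prod u m : (forall k, good (u * z k)) ->
  \prod_(k < n) poch (u * z k) (m k) != 0.
Proof. by move=> gu; apply/prodf_neq0 => k _; exact/good_poch/gu. Qed.

(* [(f z, g z)_y (u q / f, u q / g)_|m| / (u q / f, u q / g)_|y|] for [f = x] and
   [g = k0 / x], without denominators. *)
Definition QQ k0 m u y x :=
  (\prod_(k < n) (poch (x * z k) (y k) * poch (k0 * z k / x) (y k))) *
  (poch (u * q ^+ (wt y).+1 / x) (wt m - wt y) *
   poch (u * q ^+ (wt y).+1 * x / k0) (wt m - wt y)).

Lemma bcspace_QQ k0 m u y : k0 != 0 -> u != 0 -> (wt y <= wt m)%N ->
  bcspace k0 (wt m) (QQ k0 m u y).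
Proof.
move=> k00 u0 yM; rewrite -(subnKC yM); apply: bcspaceM.
  by apply: bcspace_prod => k; exact: bcspace_poch.
by apply: bcspace_pochV => //; rewrite mulf_neq0 // expf_neq0.
Qed.

Lemma fpart_QQ k0 m u y x : k0 != 0 -> x != 0 -> good (u / x) -> good (u * x / k0) ->
  (wt y <= wt m)%N ->
  fpart u x y * fpart u (k0 / x) y =
  QQ k0 m u y x / (poch (u * q / x) (wt m) * poch (u * q * x / k0) (wt m)).
Proof.
move=> k00 x0 /goodMq g1 /goodMq g2 yM; rewrite /fpart /QQ.
have -> : u * q / (k0 / x) = u * q * x / k0 by field; rewrite k00 x0.
have g2' : good (u * q * x / k0) by rewrite [u * q * x]mulrAC.
have := good_poch (wt m) g1; have := good_poch (wt m) g2'.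
rewrite -(subnKC yM) !pochD.
have -> : u * q / x * q ^+ wt y = u * q ^+ (wt y).+1 / x by rewrite exprS; ring.
have -> : u * q * x / k0 * q ^+ wt y = u * q ^+ (wt y).+1 * x / k0 by rewrite exprS; ring.
rewrite (subnKC yM) !mulf_eq0 !negb_or => /andP[n1 n2] /andP[n3 n4].
rewrite big_split /=.
have -> : \prod_(k < n) poch (k0 / x * z k) (y k) = \prod_(k < n) poch (k0 *
  z k / x) (y k).
  by apply: eq_bigr => k _; rewrite mulrAC.
by field; rewrite n1 n2 n3 n4.
Qed.

(** Off-diagonal pairs give [q^-(m_j m_k)] by [poch_pair], diagonal ones a sign and a binomial
    exponent by [poch_diag]; [bin2_sum_pairs] adds the exponents. *)
Lemma vdm_diag m : zgood m ->
  vdm (fun k => z k * q ^+ m k) / vdm z *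
  (\prod_(j < n) \prod_(k < n) poch (node j (m j) * z k) (m k)) /
  (\prod_(j < n) \prod_(k < n) poch (q * z k / z j) (m k)) =
  (-1) ^+ wt m / q ^+ 'C((wt m).+1, 2).
Proof.
move=> [zg1 zg2].
have pz j k : poch (q * (z k / z j)) (m k) != 0.
  apply/prodf_neq0 => i _; have := zg2 j k i.+1; rewrite ltn_ord => /(_ isT).
  by apply: contra_neq => <-; congr th; rewrite exprS; ring.
rewrite -bin2_sum_pairs /vdm -mulrA -!prodf_div -big_split /= exprD.
transitivity ((\prod_(j < n) \prod_(k < n | (j < k)%N)
    (q ^+ m j * th (z k / z j * q ^+ m k / q ^+ m j) / th (z k / z j))) *
  \prod_(j < n) \prod_(k < n) (poch (z k / z j / q ^+ m j) (m k) / poch (q *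
    (z k / z j)) (m k))).
  rewrite -big_split; apply: eq_bigr => j _ /=; congr (_ * _).
    rewrite -prodf_div; apply: eq_bigr => k jk.
    have -> : z k * q ^+ m k / (z j * q ^+ m j) = z k / z j * q ^+ m k / q ^+ m j.
      by field; rewrite ?z0 ?expf_neq0.
    by field; rewrite ?z0 ?zg1.
  rewrite -prodf_div; apply: eq_bigr => k _.
  by congr (poch _ _ / poch _ _); rewrite /node; ring.
rewrite big_pairs mulrCA -big_split /= [(- 1) ^+ _]/= invfM mulrA; congr (_ * _).
  rewrite -prodrXr -prodrXr -prodfV -big_split; apply: eq_bigr => j _ /=.
  by rewrite divff // mul1r mulr1 poch_diag //; have := pz j j; rewrite divff // mulr1.
rewrite -prodrXr -prodfV; apply: eq_bigr => j _; rewrite -prodrXr -prodfV -big_split.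
apply: eq_bigr => k jk /=.
have Ew : z j / z k = (z k / z j)^-1 by rewrite invf_div.
rewrite Ew poch_pair ?zg1 ?mulf_neq0 ?invr_neq0 //.
by have := pz k j; rewrite Ew.
Qed.

(** The run of [i + M + 1] factors starting at [u] is cut into lengths [M, i, 1] or [1, i, M]. *)
Lemma poch_rot u (i M : nat) : good u ->
  th (u * q ^+ (i + M)) / th u * poch u M / poch (u * q ^+ i.+1) M * poch (u * q ^+ M) i
  = poch (u * q) i.
Proof.
move=> gu; have h1 := good_th gu; have h2 := good_poch M (goodX i.+1 gu).
have : poch u (M + (i + 1)) = poch u (1 + (i + M)) by congr poch; clear; lia.
rewrite !pochD !poch1 expr1 -!mulrA -!exprD -exprS [(M + i)%N]addnC => E.
transitivity (poch u M * (poch (u * q ^+ M) i * th (u * q ^+ (i + M))) / (th u *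
  poch (u * q ^+ i.+1) M)).
  by field; rewrite h1 h2.
by rewrite E; field; rewrite h1 h2.
Qed.

(** The factor [(a q^|m| z_k)_(m_k)] is supplied by the parameter [g = a q^|m|] at the extra
    interpolation point. *)
Lemma core_diag a m : zgood m -> (forall k, good (a * z k)) ->
  core a m * (\prod_(j < n) fpart a (node j (m j)) m) *
  \prod_(k < n) poch (a * q ^+ wt m * z k) (m k) =
  (-1) ^+ wt m / q ^+ 'C(wt m, 2) * \prod_(k < n) poch (a * q * z k) (m k).
Proof.
move=> zg ga; rewrite /core /fpart prodf_div.
have [qC0 qM0] : q ^+ 'C(wt m, 2) != 0 /\ q ^+ wt m != 0 by rewrite !expf_neq0.
have -> : (-1) ^+ wt m / q ^+ 'C(wt m, 2) = (-1) ^+ wt m / q ^+ 'C((wt m).+1, 2) *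
  q ^+ wt m.
  by rewrite binS bin1 exprD; field; rewrite qC0 qM0.
rewrite -(vdm_diag zg).
have -> : \prod_(k < n) poch (a * q * z k) (m k) =
  (\prod_(k < n) (th (a * z k * q ^+ (m k + wt m)) / th (a * z k))) *
  (\prod_(j < n) poch (a * z j) (wt m)) /
  (\prod_(j < n) poch (a * q / node j (m j)) (wt m)) *
  (\prod_(k < n) poch (a * q ^+ wt m * z k) (m k)).
  rewrite -prodfV -!big_split; apply: eq_bigr => k _ /=.
  have -> : a * q / node k (m k) = a * z k * q ^+ (m k).+1.
    by rewrite /node exprS; field; rewrite ?z0 ?oner_neq0 ?expf_neq0.
  by rewrite (mulrAC a q) (mulrAC a (q ^+ _)) poch_rot.
by rewrite !prodf_div; ring.
Qed.

Lemma bsum_top N m F : (forall k, m k <= N)%N ->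
  (forall y, (forall k, y k <= m k)%N -> (wt y < wt m)%N -> F y = 0) -> bsum N m F = F m.
Proof.
move=> mN F0; pose y0 : {ffun 'I_n -> 'I_N.+1} := [ffun k => inord (m k)].
have Ey : (fun k => y0 k : nat) = m by apply/funext => k; rewrite ffunE inordK // ltnS.
rewrite /bsum (bigD1 y0); last by apply/forallP => k;
  rewrite -[X in (X <= _)%N]/((fun k => y0 k : nat) k) Ey.
rewrite /= Ey big1 ?addr0 // => y /andP[/forallP ym yy0]; apply: F0 => //.
rewrite ltn_neqAle leq_wt // andbT; apply: contra yy0 => /eqP Ew.
apply/eqP/ffunP => k; apply/val_inj; rewrite -[RHS]/((fun k => y0 k : nat) k) Ey /=.
apply/eqP; rewrite eqn_leq ym /= leqNgt; apply/negP => yk.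
suff : (wt (fun k => y k : nat) < wt m)%N by rewrite Ew ltnn.
rewrite /wt (bigD1 k) //= [X in (_ < X)%N](bigD1 k) //= -addSn leq_add //.
by apply: leq_sum => j _.
Qed.

(** * Interpolation in [f] with the product [f g] fixed *)

Section Interpolation.

Variables (a b c d e lam : K) (N : nat).
Hypotheses (a0 : a != 0) (b0 : b != 0) (c0 : c != 0) (d0 : d != 0) (e0 : e != 0).
Hypothesis lamE : lam = a ^+ 2 * q / (b * c * e).
Hypotheses (ga : forall k, good (a * z k)) (gl : forall k, good (lam * z k)).
Hypotheses (gab : forall k, good (a / b * z k)) (gac : forall k, good (a / c * z k)).
Hypotheses (gad : forall k, good (a / d * z k)) (gld : forall k, good (lam / d * z k)).
Hypotheses (gae : good (a / e)) (gal : good (a / lam)).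
Hypothesis gK : forall j k, good (lam * a / d * z j * z k).

Let lam0 : lam != 0.
Proof. by rewrite lamE !(mulf_neq0, invr_neq0, expf_neq0). Qed.

Let K0 m := lam * a * q ^+ (wt m).+1 / d.

Let K0_neq0 m : K0 m != 0.
Proof. by rewrite !(mulf_neq0, invr_neq0, expf_neq0). Qed.

Definition bailey_factor m f :=
  phi (a * q) m f * phi (lam * q / d) m f /
  (phi (lam * q) m f * phi (a * q / d) m f).

Definition bailey_eq m f g :=
  bsum N m (term a [:: b; c; d] m [:: e; f; g]) =
  bailey_factor m f *
  bsum N m (term lam [:: lam * b / a; lam * c / a; d] m [:: lam * e / a; f; g]).

Let P u m := \prod_(k < n) poch (u * z k) (m k).

Let C0 m := P (a * q) m * P (lam * q / d) m / (P (lam * q) m * P (a * q / d) m)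
  * (a / lam) ^+ wt m.

Let lhs m x := bsum N m (fun y =>
  term a [:: b; c; d] m [:: e] y * QQ (K0 m) m a y x).

Let rhs m x := C0 m * bsum N m (fun y =>
  term lam [:: lam * b / a; lam * c / a; d] m [:: lam * e / a] y * QQ (K0 m) m lam y x).

(** As [f g = K0 m], reversal turns [(a q / (d f))_|m|] and [(lam q / (d f))_|m|] into multiples of
    [(lam q / g)_|m|] and [(a q / g)_|m|]. The dependence on [f] becomes symmetric in [f] and [g],
    and the two powers leave the factor [(a / lam)^|m|] of [C0]. *)
Lemma bailey_factorE m f g : f != 0 -> g != 0 -> f * g = K0 m ->
  good (a / f) -> good (a / g) -> good (lam / f) -> good (lam / g) ->
  bailey_factor m f = C0 m *
   (poch (lam * q / f) (wt m) * poch (lam * q / g) (wt m)) /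
   (poch (a * q / f) (wt m) * poch (a * q / g) (wt m)).
Proof.
move=> f0 g0 fg gaf gag glf glg; rewrite /bailey_factor /phi -/(P _ _) -/(P (lam *
  q / d) _) -/(P (lam * q) _) -/(P (a * q / d) _).
have qM0 : q ^+ wt m != 0 by rewrite expf_neq0.
have gE : g = lam * a * q ^+ (wt m).+1 / (d * f).
  by apply: (mulfI f0); rewrite fg /K0; field; rewrite f0 d0.
rewrite (@poch_rev (a * q / d / f) (lam * q / g)); last 2 first.
- by rewrite !(mulf_neq0, invr_neq0).
- by rewrite gE exprS; field; rewrite ?a0 ?lam0 ?f0 ?d0 ?q0 ?qM0.
rewrite (@poch_rev (lam * q / d / f) (a * q / g)); last 2 first.
- by rewrite !(mulf_neq0, invr_neq0).
- by rewrite gE exprS; field; rewrite ?a0 ?lam0 ?f0 ?d0 ?q0 ?qM0.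
have -> : (- (a * q / d / f)) ^+ wt m = (a / lam) ^+ wt m * (- (lam * q / d / f)) ^+ wt m.
  by rewrite -exprMn; congr (_ ^+ _); field; rewrite ?lam0 ?d0 ?f0.
rewrite /C0.
have n1 : (- (lam * q / d / f)) ^+ wt m != 0.
  by rewrite expf_neq0 // oppr_eq0 !(mulf_neq0, invr_neq0).
have n2 : q ^+ 'C(wt m, 2) != 0 by rewrite expf_neq0.
have n5 : (a / lam) ^+ wt m != 0 by rewrite expf_neq0 // !(mulf_neq0, invr_neq0).
have n3 : P (lam * q) m != 0.
  by apply: good_poch_prod => k; have := goodX 1 (gl k); rewrite expr1 mulrAC.
have n4 : P (a * q / d) m != 0.
  by apply: good_poch_prod => k; have := goodX 1 (gad k); rewrite expr1; congr good; ring.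
have := good_poch (wt m) (goodMq gaf); have := good_poch (wt m) (goodMq gag).
have := good_poch (wt m) (goodMq glf); have := good_poch (wt m) (goodMq glg).
clear gE; abs (q ^+ 'C(wt m, 2)); abs ((- (lam * q / d / f)) ^+ wt m);
  abs ((a / lam) ^+ wt m).
by move=> h1 h2 h3 h4; field; repeat (apply/andP; split).
Qed.

(** Used in both directions: the induction hypothesis at a node is a [bailey_eq] to be cleared of
    denominators, while the interpolated identity has to be divided again. *)
Lemma bailey_link m f g : f != 0 -> g != 0 -> f * g = K0 m ->
  good (a / f) -> good (a / g) -> good (lam / f) -> good (lam / g) ->
  bailey_eq m f g <-> lhs m f = rhs m f.
Proof.
move=> f0 g0 fg gaf gag glf glg.
have gE : g = K0 m / f by rewrite -fg mulrAC divff ?mul1r.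
have E u : u * q * f / K0 m = u * q / g by rewrite gE; field; rewrite f0 K0_neq0.
have Es u bs e' : good (u / f) -> good (u / g) ->
  bsum N m (term u bs m [:: e'; f; g]) =
  bsum N m (fun y => term u bs m [:: e'] y * QQ (K0 m) m u y f) /
  (poch (u * q / f) (wt m) * poch (u * q / g) (wt m)).
  move=> guf gug; rewrite /bsum mulr_suml; apply: eq_bigr => y /forallP ym.
  rewrite -E -mulrA -fpart_QQ ?K0_neq0 ?(leq_wt ym) //; last first.
    by have -> : u * f / K0 m = u / g by rewrite gE; field; rewrite f0 K0_neq0.
  by rewrite /term !big_cons !big_nil -gE; ring.
rewrite /bailey_eq !Es // (bailey_factorE f0 g0 fg) // -/(lhs m f) /rhs.
have h1 := good_poch (wt m) (goodMq gaf); have h2 := good_poch (wt m) (goodMq gag).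
have h3 := good_poch (wt m) (goodMq glf); have h4 := good_poch (wt m) (goodMq glg).
set S := bsum _ _ _.
split=> [H|->].
  apply: (mulIf (invr_neq0 (mulf_neq0 h1 h2))); rewrite H.
  by field; rewrite ?h1 ?h2 ?h3 ?h4.
by field; rewrite ?h1 ?h2 ?h3 ?h4.
Qed.

Lemma bailey_upd m k i g : (i <= m k)%N ->
  bailey_eq m (node k i) g <-> bailey_eq (upd m k i) (node k (m k)) g.
Proof.
move=> im.
have Es u bs e' : bsum N m (term u bs m [:: e'; node k i; g]) =
    bsum N (upd m k i) (term u bs (upd m k i) [:: e'; node k (m k); g]).
  have sw m' x : bsum N m' (term u bs m' [:: e'; x; g]) =
    bsum N m' (term u bs m' [:: x; e'; g]).
    by apply: eq_bsum => y _; rewrite /term !big_cons; ring.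
  by rewrite !sw bsum_upd.
rewrite /bailey_eq !Es /bailey_factor.
have pu u : (forall j, good (u * z j)) ->
    phi (u * q) m (node k i) = phi (u * q) (upd m k i) (node k (m k)).
  by move=> gu; apply: phi_upd; have := goodX 1 (gu k); rewrite expr1 mulrAC.
by rewrite (mulrAC lam q) (mulrAC a q) (pu _ ga) (pu _ gl) (pu _ gad) (pu _ gld).
Qed.

Let lhs_top m : zgood m -> (forall k, m k <= N)%N ->
  lhs m (lam * q / d) = (-1) ^+ wt m / q ^+ 'C(wt m, 2) * P (a * q) m *
   (poch b (wt m) / P (a * q / b) m) * (poch c (wt m) / P (a * q / c) m) *
   (poch d (wt m) / P (a * q / d) m) * (P e m / poch (a * q / e) (wt m)) * P (lam *
     q / d) m.
Proof.
move=> zg mN; have qM0 : q ^+ wt m != 0 by rewrite expf_neq0.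
rewrite /lhs bsum_top //; last first.
  move=> y ym yM; have lt : ((wt m - wt y).-1 < wt m - wt y)%N by move: yM; clear; lia.
  (* For [|y| < |m|] the last factor of the second factorial in [QQ], of index [|m| - |y| - 1], is
     [th 1]. *)
  have E : a * q ^+ (wt y).+1 * (lam * q / d) / K0 m * q ^+ (wt m - wt y).-1 = 1.
    have -> : q ^+ (wt m - wt y).-1 = q ^+ wt m / q ^+ (wt y).+1.
      rewrite -(@subnKC (wt y).+1 (wt m)) // exprD mulrAC divff ?expf_neq0 // mul1r.
      by congr (_ ^+ _); move: yM; clear; lia.
    by rewrite /K0 !exprS; field; rewrite ?a0 ?lam0 ?d0 ?q0 ?qM0 ?expf_neq0.
  by rewrite /QQ (poch_eq0 lt E) !mulr0.
rewrite -(core_diag zg ga) /QQ big_split /= subnn !poch0 /term !big_cons !big_nil.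
rewrite /bpart [fpart a e m]/fpart.
have -> : \prod_(k < n) poch (K0 m * z k / (lam * q / d)) (m k) =
    \prod_(k < n) poch (a * q ^+ wt m * z k) (m k).
  by apply: eq_bigr => k _; congr poch; rewrite /K0 exprS; field; rewrite ?d0 ?lam0 ?q0.
have Ex x : \prod_(k < n) poch (a * q * z k / x) (m k) = P (a * q / x) m.
  by apply: eq_bigr => k _; rewrite mulrAC.
by rewrite !Ex -/(P _ _) -/(P (lam * q / d) _); ring.
Qed.

Definition jackson_rhs a b c m f :=
  phi (a * q) m f * phi (a * q / (b * c)) m f /
  (phi (a * q / b) m f * phi (a * q / c) m f).

(** At [f = lam q / d] the [bpart] of [d] cancels the [fpart] of [f]. What remains has two
    parameters of each kind besides the nodes, the shape of a Jackson sum. *)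
Let rhs_top m : (forall k, m k <= N)%N ->
  rhs m (lam * q / d) = C0 m * poch d (wt m) * poch (lam * q / (a * q ^+ wt m)) (wt m) *
   bsum N m (term lam [:: lam * b / a; lam * c / a] m [:: lam * e / a; a * q ^+ wt m]).
Proof.
move=> mN; have qM0 : q ^+ wt m != 0 by rewrite expf_neq0.
rewrite /rhs -2!(mulrA (C0 m)); congr (_ * _); rewrite !bsumZ; apply: eq_bsum => y ym.
have yM := leq_wt ym.
rewrite /QQ big_split /= /term !big_cons !big_nil /bpart [fpart lam (a * _) _]/fpart.
have -> : lam * q ^+ (wt y).+1 / (lam * q / d) = d * q ^+ wt y.
  by rewrite exprS; field; rewrite ?d0 ?lam0 ?q0.
have -> : lam * q ^+ (wt y).+1 * (lam * q / d) / K0 m = lam * q / (a * q ^+ wt m) *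
  q ^+ wt y.
  by rewrite /K0 !exprS; field; rewrite ?d0 ?lam0 ?q0 ?a0 ?qM0.
have -> : \prod_(k < n) poch (K0 m * z k / (lam * q / d)) (y k) =
    \prod_(k < n) poch (a * q ^+ wt m * z k) (y k).
  by apply: eq_bigr => k _; congr poch; rewrite /K0 exprS; field; rewrite ?d0 ?lam0 ?q0.
have -> : \prod_(k < n) poch (lam * q * z k / d) (y k) = P (lam * q / d) y.
  by apply: eq_bigr => k _; rewrite mulrAC.
have := pochD d (wt y) (wt m - wt y); rewrite subnKC // => ->.
have := pochD (lam * q / (a * q ^+ wt m)) (wt y) (wt m - wt y); rewrite subnKC // => ->.
have h1 : P (lam * q / d) y != 0.
  by apply: good_poch_prod => k; have := goodX 1 (gld k); rewrite expr1; congr good; ring.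
have h2 : poch (lam * q / (a * q ^+ wt m)) (wt y) != 0.
  apply: good_poch; have := goodV _ gal; rewrite invf_div =>
    /(_ (mulf_neq0 a0 (invr_neq0 lam0))).
  by move=> /(@goodX _ 1) /(@goodXV _ (wt m)); rewrite expr1; congr good; field;
    rewrite ?a0 ?qM0.
rewrite -/(P (lam * q / d) y).
move: h1 h2; move: (P _ _) (poch (lam * q / _) _) => A B h1 h2.
pose E := core lam y * (poch (lam * b / a) (wt y) / (\prod_(k < n) poch (lam * q *
  z k / (lam * b / a)) (y k)) *
   (poch (lam * c / a) (wt y) / \prod_(k < n) poch (lam * q * z k / (lam *
     c / a)) (y k))) *
   (\prod_(j < n) fpart lam (node j (m j)) y) * fpart lam (lam * e / a) y *
   (\prod_(k < n) poch (a * q ^+ wt m * z k) (y k)) * poch d (wt y) *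
   poch (d * q ^+ wt y) (wt m - wt y) * poch (lam * q / (a * q ^+ wt m) *
     q ^+ wt y) (wt m - wt y).
transitivity (E * (A / A)); first by rewrite /E; ring.
transitivity (E * (B / B)); last by rewrite /E; ring.
by rewrite !divff.
Qed.

Lemma bailey_top m : zgood m -> (forall k, m k <= N)%N ->
  bsum N m (term lam [:: lam * b / a; lam * c / a] m [:: lam * e / a; a * q ^+ wt m]) =
  jackson_rhs lam (lam * b / a) (lam * c / a) m (lam * e / a) ->
  lhs m (lam * q / d) = rhs m (lam * q / d).
Proof.
move=> zg mN J; rewrite lhs_top // rhs_top // J /jackson_rhs /phi.
rewrite -/(P _ _) -/(P (lam * q / (_ * _)) _) -/(P (lam * q / (lam *
  b / a)) _) -/(P (lam * q / (lam * c / a)) _).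
have qM0 : q ^+ wt m != 0 by rewrite expf_neq0.
have bce : b * c * e != 0 by rewrite !mulf_neq0.
have E1 : lam * q / (lam * b / a) = a * q / b by field; rewrite ?a0 ?b0 ?lam0.
have E2 : lam * q / (lam * c / a) = a * q / c by field; rewrite ?a0 ?c0 ?lam0.
have E3 : lam * q / (lam * e / a) = a * q / e by field; rewrite ?a0 ?e0 ?lam0.
have E4 : lam * q / (lam * b / a * (lam * c / a)) = e.
  by rewrite lamE; field; rewrite ?a0 ?b0 ?c0 ?e0 ?q0.
have E5 : a * q / b / (lam * e / a) = c by rewrite lamE; field;
  rewrite ?a0 ?b0 ?c0 ?e0 ?q0.
have E6 : a * q / c / (lam * e / a) = b by rewrite lamE; field;
  rewrite ?a0 ?b0 ?c0 ?e0 ?q0.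
have E7 : e / (lam * e / a) = a / lam by field; rewrite ?a0 ?e0 ?lam0.
rewrite E4 E1 E2 E3 E5 E6 E7 /C0.
rewrite (@poch_rev (lam * q / (a * q ^+ wt m)) (a / lam)); last 2 first.
- by rewrite !(mulf_neq0, invr_neq0).
- by field; rewrite ?a0 ?lam0 ?qM0.
(* With [M = |m|], the bases cancel and [M - M^2 + C(M, 2) = - C(M, 2)]: this is the sign and the
   power of [q] that [core_diag] produces on the left. *)
have Es : (a / lam) ^+ wt m * ((- (lam * q / (a * q ^+ wt m))) ^+ wt m *
  q ^+ 'C(wt m, 2)) =
    (-1) ^+ wt m / q ^+ 'C(wt m, 2).
  have qC0 : q ^+ 'C(wt m, 2) != 0 by rewrite expf_neq0.
  rewrite mulrA -exprMn; have -> : a / lam * - (lam * q / (a * q ^+ wt m)) = -1 *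
    (q / q ^+ wt m).
    by field; rewrite ?a0 ?lam0 ?qM0.
  rewrite exprMn -mulrA; congr (_ * _); rewrite expr_div_n -exprM.
  have -> : (wt m * wt m = 'C(wt m, 2) + 'C(wt m, 2) + wt m)%N.
    by have := bin2SM (wt m); rewrite binS bin1; clear; lia.
  by rewrite !exprD; field; rewrite ?qC0 ?qM0.
rewrite -Es.
have gP u : (forall k, good (u * z k)) -> P (u * q) m != 0.
  by move=> gu; apply: good_poch_prod => k; have := goodX 1 (gu k); rewrite expr1 mulrAC.
have h1 := gP _ gl; have := gP _ gab; have := gP _ gac; have := gP _ gad.
rewrite !(mulrAC _ _ q) => h2 h3 h4.
have h5 := good_poch (wt m) (goodMq gae); have h6 := good_poch (wt m) gal.
move: (P e m) (P (lam * q / d) m) (P (a * q) m) (poch b _) (poch c _) (poch d _).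
move: (P (lam * q) m) (P (a * q / b) m) (P (a * q / c) m) (P (a * q / d) m) (poch (a *
  q / e) _) (poch (a / lam) _) h1 h2 h3 h4 h5 h6.
move: ((a / lam) ^+ _) ((- _) ^+ _) (q ^+ 'C(_, _)) => x1 x2 x3 y1 y2 y3 y4 y5 y6 h1 h2
  h3 h4 h5 h6 u1 u2 u3 u4 u5 u6.
rewrite [(y2 / u5 * _)^-1]invfM !invf_div.
by field; repeat (apply/andP; split).
Qed.

Let bcspace_sides m : bcspace (K0 m) (wt m) (fun x => lhs m x - rhs m x).
Proof.
have bs u F : u != 0 -> bcspace (K0 m) (wt m) (fun x => bsum N m (fun y =>
  F y * QQ (K0 m) m u y x)).
  move=> u0; apply: bcspace_sum => y /forallP ym; apply: bcspaceZ.
  by apply: bcspace_QQ => //; exact: leq_wt.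
apply: (bcspace_add (bs a _ a0) (bcspaceZ (- C0 m) (bs lam _ lam0))) => x _.
by rewrite mulNr.
Qed.

(** Up to inversion, the quotient of two distinct nodes is [q^s z_k / z_j] with [0 < s <= m_k], or
    [z_k / z_j] with [j < k]; these are the two cases of [zgood]. *)
Let th_node_neq0 m (s t : {k : 'I_n & 'I_(m k)}) : zgood m -> s != t ->
  th (node (tag t) (tagged t) / node (tag s) (tagged s)) != 0.
Proof.
move=> [zg1 zg2]; case: s t => [j i] [k l] /= st.
have qi0 : q ^+ i != 0 by rewrite expf_neq0.
have ql0 : q ^+ l != 0 by rewrite expf_neq0.
have -> : node k l / node j i = z j / z k * q ^+ i / q ^+ l.
  by rewrite /node; field; rewrite ?z0 ?qi0 ?ql0 ?oner_neq0.
have inv x : x != 0 -> th x^-1 != 0 -> th x != 0 by move=> x0; rewrite th_eq0V.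
have zz0 (i' l' : 'I_n) : z i' / z l' != 0 by rewrite mulf_neq0 ?invr_neq0.
case: (ltngtP i l) => il.
- have -> : q ^+ l = q ^+ i * q ^+ (l - i) by rewrite -exprD subnKC // ltnW.
  apply: inv; first by rewrite !(mulf_neq0, invr_neq0, expf_neq0).
  have -> : (z j / z k * q ^+ i / (q ^+ i * q ^+ (l - i)))^-1 = q ^+ (l - i) * z k / z j.
    by field; rewrite ?z0 ?qi0 ?expf_neq0 ?oner_neq0.
  by apply: zg2; move: il (ltn_ord l); clear; lia.
- have -> : q ^+ i = q ^+ l * q ^+ (i - l) by rewrite -exprD subnKC // ltnW.
  have -> : z j / z k * (q ^+ l * q ^+ (i - l)) / q ^+ l = q ^+ (i - l) * z j / z k.
    by field; rewrite ?z0 ?ql0.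
  by apply: zg2; move: il (ltn_ord i); clear; lia.
- rewrite il mulfK //.
  case: (ltngtP j k) => jk.
  + by apply: inv => //; rewrite invf_div zg1.
  + exact: zg1.
  + case/eqP: st; move/val_inj: jk => jk; subst k; congr existT.
    exact: val_inj.
Qed.

(** Taking the Jackson sum at the extra point as a hypothesis avoids a circle: [jackson] applies
    this lemma where that hypothesis reduces to [1 = 1], and [bailey] then applies it with
    [jackson]. *)
Lemma bailey_core :
  (forall m, zgood m -> (forall k, m k <= N)%N ->
   bsum N m (term lam [:: lam * b / a; lam * c / a] m [:: lam * e / a; a * q ^+ wt m]) =
   jackson_rhs lam (lam * b / a) (lam * c / a) m (lam * e / a)) ->
  forall m f g, zgood m -> (forall k, m k <= N)%N -> f != 0 -> g != 0 ->
  f * g = lam * a * q ^+ (wt m).+1 / d ->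
  good (a / f) -> good (a / g) -> good (lam / f) -> good (lam / g) ->
  bailey_eq m f g.
Proof.
move=> J m; have [s] := ubnP (wt m); elim: s m => // s IH m ms f g zg mN f0 g0 fg g1 g2
  g3 g4.
apply/bailey_link => //; apply/eqP; rewrite -subr_eq0; apply/eqP.
pose nd (t : {k : 'I_n & 'I_(m k)}) := node (tag t) (nat_of_ord (tagged t)).
(* The nodes [q^-i / z_k] with [i < m_k] are [|m|] in number; the additional one is the [f] for
   which [g = K0 m / f] equals [a q^|m|]. *)
pose nodes := lam * q / d :: map nd (enum {: {k : 'I_n & 'I_(m k)}}).
have x00 : lam * q / d != 0 by rewrite !(mulf_neq0, invr_neq0).
apply: (@bcspace_eq0 (K0 m) (wt m) (fun x => lhs m x - rhs m x) nodes) => //.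
- by rewrite /= size_map -cardE card_tagged sumnE big_map big_enum; congr _.+1;
  apply: eq_bigr => k _; rewrite card_ord.
- by rewrite /= x00; apply/allP => _ /mapP[t _ ->]; rewrite node_neq0.
- rewrite /= all_map pairwise_map; apply/andP; split.
    apply/allP => -[k i] _ /=; rewrite /nd /bctheta /= mulf_neq0 //.
      rewrite -th_eq0V; last by rewrite mulf_neq0 ?node_neq0 ?invr_neq0.
      have -> : (node k i * (lam * q / d)^-1)^-1 = lam / d * z k * q ^+ i.+1.
        by rewrite /node exprS; field; rewrite ?z0 ?d0 ?lam0 ?q0 ?oner_neq0 ?expf_neq0.
      exact/good_th/goodX.
    have -> : K0 m * (lam * q / d)^-1 / node k i = a * z k * q ^+ (wt m + i).
      by rewrite /K0 /node exprS exprD; field; rewrite ?z0 ?d0 ?lam0 ?q0 ?oner_neq0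
        ?expf_neq0.
    exact/good_th/goodX.
  have := enum_uniq {: {k : 'I_n & 'I_(m k)}}; rewrite uniq_pairwise;
    apply: sub_pairwise => t t' /= tt'.
  rewrite /nd /bctheta mulf_neq0 //; first exact: th_node_neq0.
  have -> : K0 m * (node (tag t) (tagged t))^-1 / node (tag t') (tagged t') =
    lam * a / d * z (tag t) * z (tag t') * q ^+ ((wt m).+1 + tagged t + tagged t').
    by rewrite /K0 /node !exprD; field; rewrite ?z0 ?d0 ?q0 ?oner_neq0 ?expf_neq0.
  exact/good_th/goodX.
move=> x; rewrite inE => /orP[/eqP->|/mapP[[k i] _ ->]].
  by rewrite (bailey_top zg mN) ?subrr //; exact: J.
apply/eqP; rewrite subr_eq0; apply/eqP => /=.
have im : (i <= m k)%N by exact: ltnW.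
pose m' := upd m k i; have wm' := wt_upd m k i; rewrite -/m' in wm'.
have m'm j : (m' j <= m j)%N by rewrite /m' /upd; case: eqP => // ->.
pose g' := K0 m / node k i.
have g'0 : g' != 0 by rewrite /g' mulf_neq0 ?invr_neq0 ?node_neq0.
have gn u v : good (u * z k) -> good (u / node k v).
  have -> : u / node k v = u * z k * q ^+ v by rewrite /node; field;
    rewrite ?z0 ?oner_neq0 ?expf_neq0.
  exact: goodX.
have gg u v : u != 0 -> v != 0 -> good (u / d * z k) -> v = lam * a / u -> good (v / g').
  move=> u0 v0 gu ve; have -> : v / g' = (u / d * z k * q ^+ ((wt m).+1 + i))^-1.
    by rewrite ve /g' /K0 /node !exprD; field; rewrite ?z0 ?d0 ?u0 ?a0 ?lam0 ?oner_neq0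
      ?expf_neq0.
  by apply: goodV (goodX _ gu); rewrite !(mulf_neq0, invr_neq0) ?expf_neq0.
have ag' : good (a / g') by apply: (gg lam) => //; field; rewrite lam0.
have lg' : good (lam / g') by apply: (gg a) => //; field; rewrite a0.
apply/(bailey_link (node_neq0 k i) g'0) => //; try exact: gn.
  by rewrite /g' mulrCA divff ?mulr1 ?node_neq0.
apply/bailey_upd => //; apply: IH => //; try exact: gn; try exact: node_neq0.
- by rewrite -/m'; move: ms wm' (ltn_ord i); clear; lia.
- exact: zgood_le zg.
- by move=> j; exact: leq_trans (m'm j) (mN j).
(* Lowering [m_k] to [i] divides [K0] by [q^(m_k - i)], just as replacing [node k i] by
   [node k (m k)] does, so the same [g'] is balanced for [m']. *)
- rewrite -/m' /g' /K0; apply: (mulIf (expf_neq0 (m k) q0)).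
  have -> : lam * a * q ^+ (wt m').+1 / d * q ^+ m k = lam * a *
    q ^+ ((wt m').+1 + m k) / d.
    by rewrite exprD; ring.
  have -> : ((wt m').+1 + m k = (wt m).+1 + i)%N by move: wm'; clear; lia.
  by rewrite exprD /node; field; rewrite ?z0 ?d0 ?oner_neq0 ?expf_neq0.
Qed.

End Interpolation.

Lemma vdm_neq0 m : zgood m -> vdm z != 0.
Proof.
by move=> [zg _]; apply/prodf_neq0 => j _; apply/prodf_neq0 => k jk;
  rewrite mulf_neq0 ?zg.
Qed.

(** [(1)_|y|] contains [th 1] as soon as [y] is nonzero, and the term at [y = 0] is 1. *)
Lemma bsum_term1 N a bs m fs : zgood m -> (forall k, m k <= N)%N -> (forall k,
  good (a * z k)) ->
  bsum N m (term a (1 :: bs) m fs) = 1.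
Proof.
move=> zg mN ga; rewrite (@bsum_shrink N m (fun=> 0%N)) //; last first.
  move=> y k yk; have ey : (0 < wt y)%N by rewrite /wt (bigD1 k) //= addn_gt0 yk.
  rewrite /term big_cons {1}/bpart (@poch_eq0 _ 0) ?expr0 ?mulr1 //.
  by rewrite !(mul0r, mulr0).
have w0 : wt (fun _ : 'I_n => 0%N) = 0%N by rewrite /wt big1.
rewrite bsum_top //; last by move=> y; rewrite w0.
have p0 (F : 'I_n -> K) : \prod_(k < n) poch (F k) 0 = 1 by rewrite big1 // => k _;
  rewrite poch0.
have b1 b : bpart a b (fun=> 0%N) = 1 by rewrite /bpart w0 poch0 p0 divr1.
have f1 f : fpart a f (fun=> 0%N) = 1 by rewrite /fpart w0 poch0 p0 divr1.
rewrite /term !big1 ?mulr1 /core ?w0 ?p0; do ?by move=> *.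
rewrite big1; last first.
  by move=> k _; rewrite addn0 expr0 mulr1 divff // good_th.
rewrite [\prod_(j < n) \prod_(k < n) _]big1; last by move=> j _; rewrite p0.
rewrite expr0 invr1 !mulr1; have -> : (fun k => z k * q ^+ 0) = z.
  by apply/funext => k; rewrite expr0 mulr1.
by rewrite divff // (vdm_neq0 zg).
Qed.

Lemma goodMq' u (k : 'I_n) : good (u * z k) -> good (u * q * z k).
Proof. by move=> /(@goodX _ 1); rewrite expr1 mulrAC. Qed.

Lemma phi_neq0 u m f : (forall k, good (u * z k)) -> good (u / f) -> phi u m f != 0.
Proof.
move=> gu gf; rewrite mulf_neq0 ?invr_neq0 ?good_poch //; exact: good_poch_prod.
Qed.

(* The Bailey transformation with [c := b] and [e := a q / b]: these parameters
   cancel on the left, while [lam b / a = 1] kills all terms but [y = 0] on the right. *)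
Lemma jackson a b c N m f g : a != 0 -> b != 0 -> c != 0 -> f != 0 -> g != 0 ->
  good b -> (forall k, good (a * z k)) -> (forall k, good (a / b * z k)) ->
  (forall k, good (a / c * z k)) -> (forall k, good (a / (b * c) * z k)) ->
  (forall j k, good (a ^+ 2 / (b * c) * z j * z k)) ->
  zgood m -> (forall k, m k <= N)%N -> f * g = a ^+ 2 * q ^+ (wt m).+1 / (b * c) ->
  good (a / f) -> good (a / g) -> good (a / b / f) -> good (a / b / g) ->
  bsum N m (term a [:: b; c] m [:: f; g]) = jackson_rhs a b c m f.
Proof.
move=> a0 b0 c0 f0 g0 gb gaz gab gac gabc gzz zg mN fg gaf gag glf glg.
have e0 : a * q / b != 0 by rewrite !(mulf_neq0, invr_neq0).
have lamE : a / b = a ^+ 2 * q / (b * b * (a * q / b)) by field; rewrite ?a0 ?b0 ?q0.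
have abc : a / b / c = a / (b * c) by field; rewrite b0 c0.
have gb' : good (a / (a * q / b)).
  have -> : a / (a * q / b) = b / q ^+ 1 by field; rewrite ?a0 ?b0 ?q0.
  exact: goodXV.
have B : bailey_eq a b b c (a * q / b) (a / b) N m f g.
  apply: bailey_core => //.
  - by move=> k; rewrite abc.
  - by rewrite invf_div mulrCA divff ?mulr1.
  - by move=> j k; rewrite (_ : _ / c = a ^+ 2 / (b * c)) //; field; rewrite b0 c0.
  - move=> m' zg' mN'; rewrite (_ : a / b * b / a = 1); last by field; rewrite ?a0 ?b0.
    have lq : a / b * q / (a / b * (a * q / b) / a) = b by field; rewrite ?a0 ?b0 ?q0.
    rewrite bsum_term1 // /jackson_rhs mulr1 divr1 divff // mulf_neq0 //.
      by apply: phi_neq0 => [k|]; [exact: goodMq'|rewrite lq].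
    by apply: phi_neq0 => [k|]; [exact: goodMq'|rewrite lq].
  - by rewrite fg; field; rewrite ?b0 ?c0.
have l1 : a / b * b / a = 1 by field; rewrite ?a0 ?b0.
move: B; rewrite /bailey_eq l1 bsum_term1 // mulr1 /bailey_factor /jackson_rhs.
have Ed : a / b * q / c = a * q / (b * c) by field; rewrite ?b0 ?c0.
rewrite Ed (mulrAC a b^-1 q) => <-; apply: eq_bsum => y _.
rewrite /term !big_cons !big_nil -[LHS]mulr1.
have <- : bpart a b y * fpart a (a * q / b) y = 1.
  have h1 := good_poch (wt y) gb.
  have h2 : \prod_(k < n) poch (a * q / b * z k) (y k) != 0.
    by apply: good_poch_prod => k; rewrite (mulrAC a q); exact: goodMq'.
  have -> : bpart a b y = poch b (wt y) / \prod_(k < n) poch (a * q / b * z k) (y k).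
    by congr (_ / _); apply: eq_bigr => k _; rewrite mulrAC.
  have e1 : a * q / (a * q / b) = b by field; rewrite ?a0 ?b0 ?q0.
  by rewrite /fpart e1; field; rewrite h1 h2.
by ring.
Qed.

(** The fields [bg_e], [bg_abc], [bg_lb], [bg_b] and [bg_c] serve the Jackson sum with base [lam];
    the other ones serve the interpolation itself. *)
Record bailey_generic a b c d e lam f g : Prop := BaileyGeneric {
  bg_a : forall k, good (a * z k);
  bg_l : forall k, good (lam * z k);
  bg_ab : forall k, good (a / b * z k);
  bg_ac : forall k, good (a / c * z k);
  bg_ad : forall k, good (a / d * z k);
  bg_ld : forall k, good (lam / d * z k);
  bg_e : forall k, good (e * z k);
  bg_K : forall j k, good (lam * a / d * z j * z k);
  bg_abc : forall j k, good (a ^+ 2 / (b * c) * z j * z k);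
  bg_ae : good (a / e);
  bg_al : good (a / lam);
  bg_lb : good (lam * b / a);
  bg_b : good b;
  bg_c : good c;
  bg_af : good (a / f);
  bg_ag : good (a / g);
  bg_lf : good (lam / f);
  bg_lg : good (lam / g) }.

Lemma bailey a b c d e lam N m f g :
  a != 0 -> b != 0 -> c != 0 -> d != 0 -> e != 0 -> f != 0 -> g != 0 ->
  lam = a ^+ 2 * q / (b * c * e) -> f * g = lam * a * q ^+ (wt m).+1 / d ->
  bailey_generic a b c d e lam f g -> zgood m -> (forall k, m k <= N)%N ->
  bailey_eq a b c d e lam N m f g.
Proof.
move=> a0 b0 c0 d0 e0 f0 g0 lamE fg [ga gl gab gac gad gld ge gK gabc gae gal glb gb gc
  gaf gag glf glg] zg mN.
have lam0 : lam != 0 by rewrite lamE !(mulf_neq0, invr_neq0, expf_neq0).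
have gla : good (lam / a).
  by rewrite -invf_div; apply: goodV => //; rewrite mulf_neq0 ?invr_neq0.
apply: bailey_core => // m' zg' mN'.
have qM0 : q ^+ wt m' != 0 by rewrite expf_neq0.
apply: jackson => //.
- by rewrite !(mulf_neq0, invr_neq0).
- by rewrite !(mulf_neq0, invr_neq0).
- by rewrite !(mulf_neq0, invr_neq0).
- by rewrite mulf_neq0.
- by move=> k; rewrite (_ : lam / _ = a / b) //; field; rewrite ?a0 ?b0 ?lam0.
- by move=> k; rewrite (_ : lam / _ = a / c) //; field; rewrite ?a0 ?c0 ?lam0.
- move=> k; rewrite (_ : _ * z k = e * z k / q ^+ 1); first exact: goodXV.
  by rewrite expr1 lamE; field; rewrite ?a0 ?b0 ?c0 ?e0 ?q0.
- move=> j k; rewrite (_ : _ / _ = a ^+ 2 / (b * c)) //.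
  by field; rewrite ?a0 ?b0 ?c0 ?lam0.
- by rewrite lamE (exprS q); field; rewrite ?a0 ?b0 ?c0 ?e0 ?q0.
- by rewrite (_ : lam / _ = a / e) //; field; rewrite ?a0 ?e0 ?lam0.
- rewrite (_ : lam / _ = lam / a / q ^+ wt m'); first exact: goodXV.
  by field; rewrite ?a0 ?qM0.
- rewrite (_ : lam / _ / _ = c / q ^+ 1); first exact: goodXV.
  by rewrite expr1 lamE; field; rewrite ?a0 ?b0 ?c0 ?e0 ?q0.
- rewrite (_ : lam / _ / _ = (b * q ^+ wt m')^-1).
    by apply: goodV (goodX _ gb); rewrite mulf_neq0.
  by field; rewrite ?a0 ?b0 ?lam0 ?qM0.
Qed.

(** Arranges the factors in the order of the theorem, so that the two summands can be matched factor
    by factor. *)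
Lemma term3E a b1 b2 b3 m f1 f2 f3 y :
  term a [:: b1; b2; b3] m [:: f1; f2; f3] y =
  vdm (fun k => z k * q ^+ y k) / vdm z
  * (\prod_(k < n) (th (a * z k * q ^+ (y k + wt y)) / th (a * z k)))
  * (\prod_(j < n) (poch (a * z j) (wt y) / poch (a * q / node j (m j)) (wt y)))
  * (poch b1 (wt y) * poch b2 (wt y) * poch b3 (wt y) /
     (poch (a * q / f1) (wt y) * poch (a * q / f2) (wt y) * poch (a * q / f3) (wt y)))
  * q ^+ wt y
  * (\prod_(j < n) \prod_(k < n) (poch (node j (m j) * z k) (y k) / poch (q *
    z k / z j) (y k)))
  * (\prod_(k < n) (poch (f1 * z k) (y k) * poch (f2 * z k) (y k) * poch (f3 *
    z k) (y k) /
     (poch (a * q * z k / b1) (y k) * poch (a * q * z k / b2) (y k) * poch (a * q *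
       z k / b3) (y k)))).
Proof.
have -> : \prod_(j < n) \prod_(k < n) (poch (node j (m j) * z k) (y k) / poch (q *
  z k / z j) (y k)) =
    (\prod_(j < n) \prod_(k < n) poch (node j (m j) * z k) (y k)) /
    \prod_(j < n) \prod_(k < n) poch (q * z k / z j) (y k).
  by rewrite -prodf_div; apply: eq_bigr => j _; rewrite prodf_div.
rewrite /term !big_cons !big_nil /core /bpart /fpart !prodf_div !big_split /= !invfM.
by ring.
Qed.

(** * Two Bailey transformations in succession *)

Section Composite.

Variables (a b c d e f g : K) (N : nat) (m : 'I_n -> nat).
Hypotheses (a0 : a != 0) (b0 : b != 0) (c0 : c != 0) (d0 : d != 0).
Hypotheses (e0 : e != 0) (f0 : f != 0) (g0 : g != 0).
Hypothesis bal : a ^+ 3 * q ^+ (wt m + 2) = b * c * d * e * f * g.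
Hypotheses (zg : zgood m) (mN : forall k, (m k <= N)%N).

Let lam := a ^+ 2 * q / (b * c * e).
Let lam2 := g / (q ^+ wt m * b).

Hypothesis gen1 : bailey_generic a b c d e lam g f.
Hypothesis gen2 : bailey_generic lam (lam * b / a) d (lam * c / a) f lam2 g (lam * e / a).

Let qM0 : q ^+ wt m != 0.
Proof. by rewrite expf_neq0. Qed.

Let gE : g = a ^+ 3 * q ^+ (wt m + 2) / (b * c * d * e * f).
Proof. by rewrite bal; field; rewrite ?b0 ?c0 ?d0 ?e0 ?f0. Qed.

Let lam0 : lam != 0.
Proof. by rewrite !(mulf_neq0, invr_neq0, expf_neq0). Qed.

Let lam2E : lam2 = lam ^+ 2 * q / (lam * b / a * d * f).
Proof.
rewrite /lam2 gE addn2 !(exprS q) /lam; field.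
by rewrite ?a0 ?b0 ?c0 ?d0 ?e0 ?f0 ?q0 ?qM0.
Qed.

(** In both steps [g] is the distinguished parameter of the prefactor and is left unchanged. The
    second step builds its new base from [lam b / a], [d] and [f], leaving [lam c / a = a q / (b e)]
    and [lam e / a = a q / (b c)] in place. *)
Lemma double_bailey :
  bsum N m (term a [:: b; c; d] m [:: e; f; g]) =
  bailey_factor a d lam m g * bailey_factor lam (lam * c / a) lam2 m g *
  bsum N m (term lam2 [:: g / (q ^+ wt m * a); a * q / (b * e); a * q / (b * f)] m
     [:: a * q / (b * c); a * q / (b * d); g]).
Proof.
have b10 : lam * b / a != 0 by rewrite !(mulf_neq0, invr_neq0).
have c10 : lam * c / a != 0 by rewrite !(mulf_neq0, invr_neq0).
have e10 : lam * e / a != 0 by rewrite !(mulf_neq0, invr_neq0).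
have E1 : bailey_eq a b c d e lam N m g f.
  apply: bailey => //; rewrite gE addn2 !(exprS q) /lam; field.
  by rewrite ?a0 ?b0 ?c0 ?d0 ?e0 ?f0 ?q0 ?qM0.
have E2 : bailey_eq lam (lam * b / a) d (lam * c / a) f lam2 N m g (lam * e / a).
  apply: bailey => //; rewrite /lam2 (exprS q) /lam; field.
  by rewrite ?a0 ?b0 ?c0 ?d0 ?e0 ?f0 ?q0 ?qM0 ?lam0.
have -> : bsum N m (term a [:: b; c; d] m [:: e; f; g]) =
    bsum N m (term a [:: b; c; d] m [:: e; g; f]).
  by apply: eq_bsum => y _; rewrite /term !big_cons; ring.
rewrite E1 -(mulrA (bailey_factor _ _ _ _ _)); congr (_ * _).
have -> : bsum N m (term lam [:: lam * b / a; lam * c / a; d] m [:: lam * e / a; g; f]) =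
    bsum N m (term lam [:: lam * b / a; d; lam * c / a] m [:: f; g; lam * e / a]).
  by apply: eq_bsum => y _; rewrite /term !big_cons; ring.
rewrite E2; congr (_ * _).
have F1 : lam2 * (lam * b / a) / lam = g / (q ^+ wt m * a).
  by rewrite /lam2; field; rewrite ?a0 ?b0 ?lam0 ?qM0.
have F2 : lam * c / a = a * q / (b * e) by rewrite /lam; field; rewrite ?a0 ?b0 ?c0 ?e0.
have F3 : lam * e / a = a * q / (b * c) by rewrite /lam; field; rewrite ?a0 ?b0 ?c0 ?e0.
have F4 : lam2 * d / lam = a * q / (b * f).
  by rewrite lam2E; field; rewrite ?a0 ?b0 ?d0 ?f0 ?lam0.
have F5 : lam2 * f / lam = a * q / (b * d).
  by rewrite lam2E; field; rewrite ?a0 ?b0 ?d0 ?f0 ?lam0.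
rewrite F1 F2 F3 F4 F5.
by apply: eq_bsum => y _; rewrite /term !big_cons; ring.
Qed.

Lemma double_bailey_factor :
  bailey_factor a d lam m g * bailey_factor lam (lam * c / a) lam2 m g =
  g ^+ wt m / q ^+ (\sum_(j < n) \sum_(k < n | (j < k)%N) m j * m k)%N *
  (poch b (wt m) * poch (a * q / (c * g)) (wt m) * poch (a * q / (d * g)) (wt m) /
   (poch (a * q / e) (wt m) * poch (a * q / f) (wt m) * poch (a * q / g) (wt m))) *
  \prod_(k < n) (z k ^+ m k *
    (poch (a * q * z k) (m k) * poch (q ^+ (wt m).+1 / q ^+ m k * a / (z k * e *
      g)) (m k) *
     poch (q ^+ (wt m).+1 / q ^+ m k * a / (z k * f * g)) (m k)) /
    (poch (a * q * z k / c) (m k) * poch (a * q * z k / d) (m k) *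
     poch (q ^+ wt m / q ^+ m k * b / (g * z k)) (m k))).
Proof.
(* [x] is the base of the power of exponent [|m|] left over when the factorials of length [|m|] are
   reversed, see [e7]. The products over [k] contribute [(x / g)^(m_k)], see [z1], so that only
   [g^|m|] remains. *)
pose x := - (a ^+ 2 * q ^+ (wt m).+1 / (b * e * f)).
have x0 : x != 0 by rewrite oppr_eq0 !(mulf_neq0, invr_neq0, expf_neq0).
have n1 : (- (f / (a * q ^+ wt m))) ^+ wt m != 0.
  by rewrite expf_neq0 // oppr_eq0 !(mulf_neq0, invr_neq0, expf_neq0).
have n2 : (- (e / (a * q ^+ wt m))) ^+ wt m != 0.
  by rewrite expf_neq0 // oppr_eq0 !(mulf_neq0, invr_neq0, expf_neq0).
have qC0 : q ^+ 'C(wt m, 2) != 0 by rewrite expf_neq0.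
rewrite /bailey_factor /phi.
have e1 : lam * q / d / g = f / (a * q ^+ wt m).
  rewrite gE addn2 !(exprS q) /lam; field.
  by rewrite ?a0 ?b0 ?c0 ?d0 ?e0 ?f0 ?q0 ?qM0.
have e2 : lam2 * q / (lam * c / a) / g = e / (a * q ^+ wt m).
  by rewrite /lam2 /lam; field; rewrite ?a0 ?b0 ?c0 ?d0 ?e0 ?f0 ?g0 ?q0 ?qM0.
have e3 : lam2 * q / g = q / (q ^+ wt m * b).
  by rewrite /lam2; field; rewrite ?b0 ?g0 ?qM0.
have e4 : lam * q / (lam * c / a) = a * q / c by field; rewrite ?a0 ?c0 ?lam0.
have e5 : a * q / c / g = a * q / (c * g) by field; rewrite ?c0 ?g0.
have e6 : a * q / d / g = a * q / (d * g) by field; rewrite ?d0 ?g0.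
rewrite e1 e2 e3 e4 e5 e6.
rewrite (@poch_rev (f / (a * q ^+ wt m)) (a * q / f)); last 2 first.
- by rewrite !(mulf_neq0, invr_neq0).
- by field; rewrite ?a0 ?f0 ?qM0.
rewrite (@poch_rev (e / (a * q ^+ wt m)) (a * q / e)); last 2 first.
- by rewrite !(mulf_neq0, invr_neq0).
- by field; rewrite ?a0 ?e0 ?qM0.
rewrite (@poch_rev (q / (q ^+ wt m * b)) b); last 2 first.
- by rewrite !(mulf_neq0, invr_neq0).
- by field; rewrite ?b0 ?qM0.
have e7 : (- (q / (q ^+ wt m * b))) ^+ wt m =
    (- (f / (a * q ^+ wt m))) ^+ wt m * (- (e / (a * q ^+ wt m))) ^+ wt m * x ^+ wt m.
  rewrite -!exprMn; congr (_ ^+ _); rewrite /x (exprS q); field.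
  by rewrite ?a0 ?b0 ?e0 ?f0 ?qM0.
have gP u : (forall k, good (u * z k)) -> \prod_(k < n) poch (u * q * z k) (m k) != 0.
  by move=> gu; apply: good_poch_prod => k; exact: goodMq'.
have h1 := gP _ (bg_l gen1); have h2 := gP _ (bg_l gen2).
have := gP _ (bg_ac gen1); have := gP _ (bg_ad gen1); rewrite !(mulrAC a _ q) => h3 h4.
have zE : \prod_(k < n) (z k ^+ m k *
    (poch (a * q * z k) (m k) * poch (q ^+ (wt m).+1 / q ^+ m k * a / (z k * e *
      g)) (m k) *
     poch (q ^+ (wt m).+1 / q ^+ m k * a / (z k * f * g)) (m k)) /
    (poch (a * q * z k / c) (m k) * poch (a * q * z k / d) (m k) *
     poch (q ^+ wt m / q ^+ m k * b / (g * z k)) (m k))) =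
    (x / g) ^+ wt m / q ^+ (\sum_(k < n) 'C(m k, 2)) *
    ((\prod_(k < n) poch (a * q * z k) (m k)) * (\prod_(k < n) poch (lam * q / d *
      z k) (m k)) *
     (\prod_(k < n) poch (lam2 * q / (lam * c / a) * z k) (m k)) /
     ((\prod_(k < n) poch (a * q / d * z k) (m k)) * (\prod_(k < n) poch (a * q / c *
       z k) (m k)) *
      (\prod_(k < n) poch (lam2 * q * z k) (m k)))).
  have -> : (x / g) ^+ wt m = \prod_(k < n) (x / g) ^+ m k by rewrite prodrXr.
  have -> : q ^+ (\sum_(k < n) 'C(m k, 2)) = \prod_(k < n) q ^+ 'C(m k,
    2) by rewrite prodrXr.
  rewrite -!big_split -!prodf_div -!big_split /=; apply: eq_bigr => k _.
  have qk0 : q ^+ m k != 0 by rewrite expf_neq0.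
  have qCk0 : q ^+ 'C(m k, 2) != 0 by rewrite expf_neq0.
  rewrite (@poch_rev (lam * q / d * z k) (q ^+ (wt m).+1 / q ^+ m k * a / (z k * f *
    g))); last 2 first.
  - by rewrite !(mulf_neq0, invr_neq0).
  - rewrite gE addn2 !(exprS q) /lam; field.
    by rewrite ?z0 ?a0 ?b0 ?c0 ?d0 ?e0 ?f0 ?q0 ?qM0 ?qk0.
  rewrite (@poch_rev (lam2 * q / (lam * c / a) * z k) (q ^+ (wt m).+1 / q ^+ m k *
    a / (z k * e * g))); last 2 first.
  - by rewrite !(mulf_neq0, invr_neq0).
  - rewrite /lam2 !(exprS q) /lam; field.
    by rewrite ?z0 ?a0 ?b0 ?c0 ?e0 ?g0 ?q0 ?qM0 ?qk0.
  have rv : poch (lam2 * q * z k) (m k) = (- (lam2 * q * z k)) ^+ m k * q ^+ 'C(m k, 2) *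
      poch (q ^+ wt m / q ^+ m k * b / (g * z k)) (m k).
    apply: poch_rev; first by rewrite !(mulf_neq0, invr_neq0, expf_neq0).
    by rewrite /lam2; field; rewrite ?z0 ?b0 ?g0 ?qM0 ?qk0.
  have : poch (lam2 * q * z k) (m k) != 0 by exact/good_poch/goodMq'/(bg_l gen2).
  rewrite rv mulf_eq0 negb_or => /andP[_ k3].
  have w0 : (- (lam2 * q * z k)) ^+ m k != 0 by rewrite expf_neq0 // oppr_eq0
    !(mulf_neq0, invr_neq0, expf_neq0).
  have z1 : z k ^+ m k * (- (lam2 * q * z k)) ^+ m k = (x / g) ^+ m k *
     (- (lam * q / d * z k)) ^+ m k * (- (lam2 * q / (lam * c / a) * z k)) ^+ m k.
    rewrite -!exprMn; congr (_ ^+ _); rewrite /x /lam2 gE addn2 !(exprS q) /lam; field.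
    by rewrite ?z0 ?a0 ?b0 ?c0 ?d0 ?e0 ?f0 ?g0 ?q0 ?qM0 ?qk0.
  have k1 : poch (a * q / d * z k) (m k) != 0.
    by rewrite (mulrAC a); exact/good_poch/goodMq'/(bg_ad gen1).
  have k2 : poch (a * q / c * z k) (m k) != 0.
    by rewrite (mulrAC a); exact/good_poch/goodMq'/(bg_ac gen1).
  have -> : z k ^+ m k = (x / g) ^+ m k * (- (lam * q / d * z k)) ^+ m k *
     (- (lam2 * q / (lam * c / a) * z k)) ^+ m k / (- (lam2 * q * z k)) ^+ m k.
    by rewrite -z1 mulfK.
  rewrite !(mulrAC (a * q) (z k)).
  move: (poch (a * q / d * z k) _) (poch (a * q / c * z k) _) (poch (q ^+ wt m / _ *
    b / _) _) ((- (lam2 * q * z k)) ^+ m k) (q ^+ 'C(m k, 2)) k1 k2 k3 w0 qCk0.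
  move=> y1 y2 y3 y4 y5 k1 k2 k3 w0 qCk0; clear rv z1.
  move: (_ ^+ m k) (_ ^+ m k) (_ ^+ m k) => u1 u2 u3.
  by field; repeat (apply/andP; split).
rewrite zE.
(* The reversals of length [|m|] and those of lengths [m_k] differ by exactly this amount, which is
   the exponent of [q] in the prefactor. *)
have SE : ('C(wt m, 2) = \sum_(k < n) 'C(m k, 2) + (\sum_(j < n) \sum_(k < n | (j <
  k)%N) m j * m k))%N.
  have := bin2_sum_pairs m; rewrite binS bin1.
  have -> : (\sum_(j < n) 'C((m j).+1, 2) = \sum_(k < n) 'C(m k, 2) + wt m)%N.
    by rewrite /wt -big_split; apply: eq_bigr => k _; rewrite binS bin1.
  by move=> H; apply/eqP; rewrite -(eqn_add2r (wt m)) -H addnAC.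
have h5 := good_poch (wt m) (goodMq (bg_ag gen1)).
have h6 := good_poch (wt m) (goodMq (bg_ae gen1)).
have h7 := good_poch (wt m) (goodMq (bg_af gen1)).
have h8 := good_poch (wt m) (goodMq (bg_lf gen1)).
have h9 : (x / g) ^+ wt m = x ^+ wt m / g ^+ wt m by rewrite expr_div_n.
have h10 : g ^+ wt m != 0 by rewrite expf_neq0.
have h11 : q ^+ (\sum_(k < n) 'C(m k, 2)) != 0 by rewrite expf_neq0.
have h12 : q ^+ (\sum_(j < n) \sum_(k < n | (j < k)%N) m j *
  m k)%N != 0 by rewrite expf_neq0.
have h13 : x ^+ wt m != 0 by rewrite expf_neq0.
rewrite h9 e7; move: qC0; rewrite SE exprD => _.
move: (\prod_(k < n) poch (a * q * z k) _) (\prod_(k < n) poch (lam * q / d * z k) _)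
  (\prod_(k < n) poch (lam2 * q / (lam * c / a) * z k) _) => A1 A2 A3.
move: (\prod_(k < n) poch (lam * q * z k) _) (\prod_(k < n) poch (lam2 * q * z k) _)
  (\prod_(k < n) poch (a * q / c * z k) _) (\prod_(k < n) poch (a * q / d * z k) _)
  h1 h2 h3 h4 => A4 A5 A6 A7 h1 h2 h3 h4.
move: (poch (a * q / g) _) (poch (a * q / e) _) (poch (a * q / f) _) (poch (lam *
  q / g) _)
  h5 h6 h7 h8 => B1 B2 B3 B4 h5 h6 h7 h8.
move: (poch b _) (poch (a * q / (c * g)) _) (poch (a * q / (d * g)) _) => B5 B6 B7.
move: (g ^+ _) (q ^+ (\sum_(k < n) 'C(m k, 2))) (q ^+ (\sum_(j < n) _)) (x ^+ _) h10
  h11 h12 h13.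
clear h9 e7; move: n1 n2.
move: ((- (f / (a * q ^+ wt m))) ^+ wt m) ((- (e / (a * q ^+ wt m))) ^+ wt m).
move=> D1 D2 n1 n2 D3 D4 D5 D6 h10 h11 h12 h13.
rewrite !invfM !invrK.
by field; repeat (apply/andP; split).
Qed.

End Composite.

End Box.

End EllipticSeries.

(** * Convergence and infinite products *)

Section NormedField.

Set Implicit Arguments.
Unset Strict Implicit.
Import Order.TTheory GRing.Theory Num.Theory numFieldNormedType.Exports.
Local Open Scope classical_set_scope.

(* A norm with values in [R], since the norm of [R[i]] in the library takes its
   values in [R[i]]. *)
Variables (R : realType) (C : fieldType) (nm : C -> R).
Hypothesis nmM : forall x y, nm (x * y) = nm x * nm y.
Hypothesis nmD : forall x y, nm (x + y) <= nm x + nm y.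
Hypothesis nmN : forall x, nm (- x) = nm x.
Hypothesis nm1 : nm 1 = 1.
Hypothesis nm0 : nm 0 = 0.
Hypothesis nm_eq0 : forall x, nm x = 0 -> x = 0.

Definition cv (u : nat -> C) (l : C) := (fun n => nm (u n - l)) @ \oo --> (0 : R).

Hypothesis nm_complete : forall (u : nat -> C) (A r : R), 0 <= r < 1 ->
  (forall n, nm (u n.+1 - u n) <= A * r ^+ n) -> exists l, cv u l.

Lemma nm_ge0 x : 0 <= nm x.
Proof. by have := nmD x (- x); rewrite subrr nm0 nmN; lra. Qed.

Lemma nm_gt0 x : x != 0 -> 0 < nm x.
Proof.
by move=> x0; rewrite lt_neqAle nm_ge0 andbT eq_sym; apply: contra x0 => /eqP/nm_eq0->.
Qed.

Lemma nmX x n : nm (x ^+ n) = nm x ^+ n.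
Proof. by elim: n => [|n IH]; rewrite ?expr0 // !exprS nmM IH. Qed.

Lemma nmV x : nm x^-1 = (nm x)^-1.
Proof.
have [->|x0] := eqVneq x 0; first by rewrite invr0 nm0 invr0.
have n0 : nm x != 0 by rewrite gt_eqF ?nm_gt0.
by apply: (mulfI n0); rewrite -nmM !divff.
Qed.

Lemma nm_sum (I : Type) (r : seq I) (P : pred I) F :
  nm (\sum_(i <- r | P i) F i) <= \sum_(i <- r | P i) nm (F i).
Proof.
elim/big_ind2: _ => [|x1 y1 x2 y2 h1 h2|//]; first by rewrite nm0.
exact: le_trans (nmD _ _) (lerD h1 h2).
Qed.

Lemma cv_le u l (e : nat -> R) : (\forall n \near \oo, nm (u n - l) <= e n) ->
  e @ \oo --> (0 : R) -> cv u l.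
Proof.
move=> ue e0; rewrite /cv; apply: squeeze_cvgr e0; last exact: cvg_cst.
by near=> n; rewrite nm_ge0 /=; near: n.
Unshelve. all: by end_near. Qed.

Lemma cv_cst l : cv (fun=> l) l.
Proof.
by rewrite /cv; under eq_fun => n do rewrite subrr nm0; exact: cvg_cst.
Qed.

Lemma cvN u l : cv u l -> cv (fun n => - u n) (- l).
Proof.
by rewrite /cv => h; under eq_fun => n do rewrite -opprD nmN.
Qed.

Lemma cvD u v l k : cv u l -> cv v k -> cv (fun n => u n + v n) (l + k).
Proof.
move=> h1 h2; apply: (@cv_le _ _ (fun n => nm (u n - l) + nm (v n - k))).
  by near=> n; have -> : u n + v n - (l + k) = (u n - l) + (v n - k) by ring.
by rewrite -[0](addr0 (0 : R)); apply: cvgD.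
Unshelve. all: by end_near. Qed.

Lemma cvB u v l k : cv u l -> cv v k -> cv (fun n => u n - v n) (l - k).
Proof. by move=> h1 h2; exact: cvD h1 (cvN h2). Qed.

Lemma cvM u v l k : cv u l -> cv v k -> cv (fun n => u n * v n) (l * k).
Proof.
move=> h1 h2; apply: (@cv_le _ _ (fun n => nm (u n - l) * nm (v n - k) + nm (u n - l) *
  nm k + nm l * nm (v n - k))).
  near=> n; have -> : u n * v n - l * k = (u n - l) * (v n - k) + (u n - l) * k + l *
    (v n - k) by ring.
  by rewrite -!nmM; apply: (le_trans (nmD _ _)); rewrite lerD2r; exact: nmD.
have -> : (0 : R) = 0 * 0 + 0 * nm k + nm l * 0 by rewrite !mulr0 !mul0r !addr0.
apply: cvgD; first apply: cvgD.
- exact: cvgM.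
- by apply: cvgM => //; exact: cvg_cst.
- by apply: cvgM => //; exact: cvg_cst.
Unshelve. all: by end_near. Qed.

Lemma nmB x y : nm (x - y) = nm (y - x).
Proof. by rewrite -nmN opprB. Qed.

Lemma nm_lip x y : nm x - nm y <= nm (x - y).
Proof. by have := nmD (x - y) y; rewrite subrK; lra. Qed.

Lemma cv_nm u l : cv u l -> (fun n => nm (u n)) @ \oo --> nm l.
Proof.
move=> h; apply: (@squeeze_cvgr _ _ _ _ (fun n => nm l - nm (u n - l)) (fun n =>
  nm l + nm (u n - l))).
- near=> n; have := nm_lip (u n) l; have := nm_lip l (u n); rewrite [nm (l - _)]nmB.
  by move=> h1 h2; apply/andP; split; lra.
- rewrite -[X in _ --> X]subr0; apply: cvgB h; exact: cvg_cst.
- rewrite -[X in _ --> X]addr0; apply: cvgD h; exact: cvg_cst.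
Unshelve. all: by end_near. Qed.

Lemma cv_le_nm u l B : cv u l -> (\forall n \near \oo, nm (u n) <= B) -> nm l <= B.
Proof. by move=> /cv_nm h; exact: cvgr_to_le. Qed.

Lemma cv_ge_nm u l B : cv u l -> (\forall n \near \oo, B <= nm (u n)) -> B <= nm l.
Proof. by move=> /cv_nm h; exact: cvgr_to_ge. Qed.

Lemma eq_cv u v l : (\forall n \near \oo, u n = v n) -> cv u l -> cv v l.
Proof.
move=> uv; apply: cv_le; near=> n.
by rewrite (_ : v n = u n) //; apply/esym; near: n.
Unshelve. all: by end_near. Qed.

Lemma cv_unique u l k : cv u l -> cv u k -> l = k.
Proof.
move=> h1 h2; apply/eqP; rewrite -subr_eq0; apply/eqP/nm_eq0/le_anti;
  rewrite nm_ge0 andbT.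
by apply: (cv_le_nm (cvB h1 h2)); near=> n; rewrite subrr nm0.
Unshelve. all: by end_near. Qed.

Lemma cvV u l : l != 0 -> cv u l -> cv (fun n => (u n)^-1) l^-1.
Proof.
move=> l0 h; have nl := nm_gt0 l0.
apply: (@cv_le _ _ (fun n => nm (u n - l) * (2 / nm l ^+ 2))).
  near=> n.
  have hn : nm l / 2 < nm (u n).
    by near: n; have := cv_nm h => /cvgr_gt; apply; lra.
  have un0 : u n != 0 by apply/eqP => un0; move: hn; rewrite un0 nm0; lra.
  have -> : (u n)^-1 - l^-1 = - ((u n - l) * ((u n)^-1 * l^-1)) by field; rewrite un0 l0.
  rewrite nmN !nmM !nmV ler_wpM2l ?nm_ge0 //.
  rewrite [leRHS](_ : _ = (nm l / 2)^-1 * (nm l)^-1); last by field; rewrite gt_eqF.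
  by rewrite ler_wpM2r ?invr_ge0 ?nm_ge0 // lef_pV2 ?posrE ?ltW //; lra.
have -> : (0 : R) = 0 * (2 / nm l ^+ 2) by rewrite mul0r.
by apply: cvgM => //; exact: cvg_cst.
Unshelve. all: by end_near. Qed.

Lemma cv_div u v l k : k != 0 -> cv u l -> cv v k -> cv (fun n => u n / v n) (l / k).
Proof. by move=> k0 h1 h2; apply: cvM h1 (cvV k0 h2). Qed.

Lemma cvX u l n : cv u l -> cv (fun i => u i ^+ n) (l ^+ n).
Proof.
move=> h; elim: n => [|n IH]; first exact: cv_cst.
by rewrite exprS; under eq_fun => i do rewrite exprS; exact: cvM.
Qed.

Lemma cv_prod (I : Type) (r : seq I) (P : pred I) (F : I -> nat -> C) (l : I -> C) :
  (forall i, P i -> cv (F i) (l i)) ->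
  cv (fun n => \prod_(i <- r | P i) F i n) (\prod_(i <- r | P i) l i).
Proof.
move=> h; elim: r => [|i r IH].
  by rewrite big_nil; under eq_fun => n do rewrite big_nil; exact: cv_cst.
rewrite big_cons; under eq_fun => n do rewrite big_cons.
by case Pi: (P i) => //; apply: cvM IH; exact: h.
Qed.

Lemma cv_sum (I : Type) (r : seq I) (P : pred I) (F : I -> nat -> C) (l : I -> C) :
  (forall i, P i -> cv (F i) (l i)) ->
  cv (fun n => \sum_(i <- r | P i) F i n) (\sum_(i <- r | P i) l i).
Proof.
move=> h; elim: r => [|i r IH].
  by rewrite big_nil; under eq_fun => n do rewrite big_nil; exact: cv_cst.
rewrite big_cons; under eq_fun => n do rewrite big_cons.
by case Pi: (P i) => //; apply: cvD IH; exact: h.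
Qed.

Lemma cv_geo p : nm p < 1 -> cv (fun n => p ^+ n) 0.
Proof.
move=> p1; rewrite /cv; under eq_fun => n do rewrite subr0 nmX.
by apply: cvg_expr; rewrite ger0_norm ?nm_ge0.
Qed.

Lemma cv_geo_tail u l A r n : 0 <= A -> 0 <= r < 1 -> cv u l ->
  (forall k, nm (u k.+1 - u k) <= A * r ^+ k) -> nm (l - u n) <= A * r ^+ n / (1 - r).
Proof.
move=> A0 /andP[r0 r1] h hu.
have key k : nm (u (n + k)%N - u n) <= A * r ^+ n * (1 - r ^+ k) / (1 - r).
  elim: k => [|k IH]; first by rewrite addn0 subrr nm0 expr0 subrr mulr0 mul0r.
  rewrite addnS (_ : u _ - _ = (u (n + k).+1 - u (n + k)%N) + (u (n + k)%N - u n));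
    last by ring.
  apply: (le_trans (nmD _ _)); apply: (le_trans (lerD (hu _) IH)).
  rewrite [leRHS](_ : _ = A * r ^+ (n + k) + A * r ^+ n * (1 - r ^+ k) / (1 - r)) //.
  by rewrite exprD exprS; field; rewrite subr_eq0 gt_eqF.
apply: (cv_le_nm (cvB h (cv_cst (u n)))); near=> k.
have kn : (n <= k)%N by near: k; exact: nbhs_infty_ge.
rewrite -(subnKC kn); apply: (le_trans (key _)).
rewrite ler_wpM2r ?invr_ge0 ?subr_ge0 ?(ltW r1) // ler_piMr ?mulr_ge0 ?exprn_ge0 //.
by rewrite gerBl exprn_ge0.
Unshelve. all: by end_near. Qed.

(** * Infinite products of factors [1 + e j] with geometrically small [e j] *)

Section InfiniteProduct.

Variables (A r : R).
Hypotheses (A0 : 0 <= A) (r01 : 0 <= r < 1).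

Let r0 : 0 <= r. Proof. by case/andP: r01. Qed.
Let r1 : 0 < 1 - r. Proof. by case/andP: r01 => _; rewrite subr_gt0. Qed.

Lemma geo_sum_le n : \sum_(j < n) r ^+ j <= (1 - r)^-1.
Proof.
have H : (1 - r) * \sum_(j < n) r ^+ j = 1 - r ^+ n.
  by rewrite -{2}(expr1n R n) subrXX; congr (_ * _); apply: eq_bigr => j _;
    rewrite expr1n mul1r.
by rewrite -(ler_pM2l r1) H mulfV ?gt_eqF // gerBl exprn_ge0.
Qed.

Definition prod_bound := expR (A / (1 - r)).

Lemma prod_bound_gt0 : 0 < prod_bound. Proof. exact: expR_gt0. Qed.

Variable e : nat -> C.
Hypothesis eA : forall j, nm (e j) <= A * r ^+ j.

Definition pprod n := \prod_(j < n) (1 + e j).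

Lemma pprod_le n : nm (pprod n) <= prod_bound.
Proof.
apply: (@le_trans _ _ (expR (\sum_(j < n) A * r ^+ j))); last first.
  by rewrite ler_expR -mulr_sumr ler_wpM2l // geo_sum_le.
rewrite /pprod; elim: n => [|n IH]; first by rewrite !big_ord0 nm1 expR0.
rewrite !big_ord_recr /= nmM expRD; apply: ler_pM; rewrite ?nm_ge0 //.
apply: le_trans (nmD _ _) _; rewrite nm1; apply: le_trans (expR_ge1Dx _).
by rewrite lerD2l.
Qed.

Lemma pprod_step n : nm (pprod n.+1 - pprod n) <= prod_bound * A * r ^+ n.
Proof.
rewrite /pprod big_ord_recr /= (_ : _ - _ = pprod n * e n); last by rewrite /pprod; ring.
by rewrite nmM -mulrA ler_pM ?nm_ge0 // pprod_le.
Qed.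

Lemma pprod_cv : exists l, cv pprod l.
Proof. exact: nm_complete r01 pprod_step. Qed.

Lemma pprod_tail l n : cv pprod l -> nm (l - pprod n) <= prod_bound * A / (1 - r) *
  r ^+ n.
Proof.
move=> h; have := cv_geo_tail n _ r01 h pprod_step;
  rewrite mulr_ge0 ?(ltW prod_bound_gt0) //.
by move=> /(_ isT); rewrite mulrAC.
Qed.

(** Beyond some [J] the bounds on [nm (e j)] add up to at most 1/2, and the inequality
    [prod (1 - t_i) >= 1 - sum t_i] keeps the later partial products above half of
    [nm (pprod J)]. *)
Lemma pprod_neq0 l : cv pprod l -> (forall j, 1 + e j != 0) -> l != 0.
Proof.
move=> h ne.
have [J hJ] : exists J, A * r ^+ J / (1 - r) <= 2^-1.
  have : (fun n => A * r ^+ n / (1 - r)) @ \oo --> (0 : R).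
    have -> : (0 : R) = A * 0 / (1 - r) by rewrite mulr0 mul0r.
    apply: cvgM; last exact: cvg_cst.
    apply: cvgM; first exact: cvg_cst.
    by apply: cvg_expr; rewrite ger0_norm; [case/andP: r01|].
  move=> /cvgr_le /(_ 2^-1); rewrite invr_gt0 ltr0n => /(_ isT) [J _ HJ].
  by exists J; apply: HJ => /=.
have PJ : 0 < nm (pprod J) by apply: nm_gt0; apply/prodf_neq0 => j _; exact: ne.
have key k : nm (pprod J) * (1 - A * r ^+ J * \sum_(i < k) r ^+ i) <= nm (pprod (J + k)).
  elim: k => [|k IH]; first by rewrite big_ord0 mulr0 subr0 mulr1 addn0.
  have -> : nm (pprod (J + k.+1)) = nm (pprod (J + k)) * nm (1 + e (J + k)%N).
    by rewrite addnS -nmM /pprod big_ord_recr.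
  rewrite big_ord_recr /= [A * r ^+ J * (_ + _)]mulrDr opprD addrA.
  have S0 : 0 <= A * r ^+ J * \sum_(i < k) r ^+ i.
    by rewrite !mulr_ge0 ?exprn_ge0 // sumr_ge0 // => i _; rewrite exprn_ge0.
  have T0 : 0 <= A * r ^+ J * r ^+ k by rewrite !mulr_ge0 ?exprn_ge0.
  have ek : 1 - A * r ^+ J * r ^+ k <= nm (1 + e (J + k)%N).
    have := nm_lip 1 (- e (J + k)%N); rewrite nm1 nmN opprK => h1.
    have := eA (J + k); rewrite exprD mulrA => h2; lra.
  have X0 := nm_ge0 (1 + e (J + k)%N).
  move: IH S0 T0 ek X0; move: (A * r ^+ J * _) (A * r ^+ J * _) (nm (1 + _)) =>
    T S x IH S0 T0 ek X0.
  (* If [1 - T <= 0] the lower bound is nonpositive; otherwise the induction hypothesis may be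
     multiplied by [1 - T]. *)
  have [neg|pos] := leP (1 - T) 0.
    apply: (@le_trans _ _ 0); last by rewrite mulr_ge0 ?nm_ge0.
    by rewrite pmulr_rle0 //; lra.
  apply: (@le_trans _ _ (nm (pprod (J + k)) * (1 - T)));
    last by rewrite ler_wpM2l ?nm_ge0.
  apply: le_trans (ler_wpM2r (ltW pos) IH).
  rewrite -mulrA ler_wpM2l ?nm_ge0 //; nra.
have : 0 < nm l.
  apply: lt_le_trans (_ : nm (pprod J) / 2 <= _); first by lra.
  apply: (cv_ge_nm h); near=> n.
  have kn : (J <= n)%N by near: n; exact: nbhs_infty_ge.
  rewrite -(subnKC kn); apply: le_trans (key _); rewrite ler_pM2l //.
  have : A * r ^+ J * \sum_(i < n - J) r ^+ i <= A * r ^+ J / (1 - r).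
    by rewrite ler_wpM2l ?mulr_ge0 ?exprn_ge0 // geo_sum_le.
  lra.
by case: eqP => // ->; rewrite nm0 ltxx.
Unshelve. all: by end_near. Qed.

End InfiniteProduct.

(** * Dominated convergence for sums over finite lists *)

Section Tannery.

Variables (I : eqType) (b : I -> R) (B : R).
Hypothesis bB : forall L : seq I, uniq L -> \sum_(i <- L) b i <= B.

Lemma summable_tail (eps : R) : 0 < eps -> exists Q : seq I, uniq Q /\
  forall L, uniq L -> \sum_(i <- L | i \notin Q) b i <= eps.
Proof.
move=> eps0; pose A := [set s | exists2 L : seq I, uniq L & s = \sum_(i <- L) b i].
have sA : has_sup A.
  split; first by exists 0, [::] => //; rewrite big_nil.
  by exists B => _ [L uL ->]; exact: bB.
have [_ [Q uQ ->] hQ] := sup_adherent eps0 sA.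
exists Q; split=> // L uL.
have : \sum_(i <- Q ++ [seq i <- L | i \notin Q]) b i <= sup A.
  apply: ub_le_sup; first by case: sA.
  exists (Q ++ [seq i <- L | i \notin Q]) => //.
  rewrite cat_uniq uQ filter_uniq // andbT; apply/hasPn => i.
  by rewrite mem_filter => /andP[].
by rewrite big_cat /= big_filter; lra.
Qed.

(** Outside a finite [Q] the majorant contributes at most [eps / 2], uniformly in [N]; inside [Q]
    finitely many terms tend to 0. *)
Lemma tannery (L : nat -> seq I) (H : nat -> I -> C) :
  (forall N, uniq (L N)) -> (forall N i, nm (H N i) <= b i) ->
  (forall i, cv (H^~ i) 0) -> cv (fun N => \sum_(i <- L N) H N i) 0.
Proof.
move=> uL Hb H0; rewrite /cv; apply/cvgrPdist_lt => eps eps0.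
have e2 : 0 < eps / 2 by lra.
have [Q [uQ hQ]] := summable_tail e2.
have h1 (s : seq I) : (fun N => \sum_(i <- s) nm (H N i)) @ \oo --> (0 : R).
  elim: s => [|i s IH]; first by under eq_fun => N do rewrite big_nil; exact: cvg_cst.
  under eq_fun => N do rewrite big_cons.
  have Hi : (fun N => nm (H N i)) @ \oo --> (0 : R).
    by have := H0 i; rewrite /cv; under eq_fun => N do rewrite subr0.
  by have := cvgD Hi IH; rewrite addr0; exact.
near=> N; rewrite sub0r normrN ger0_norm ?nm_ge0 // subr0.
have h2 : \sum_(i <- Q) nm (H N i) < eps / 2.
  by near: N; move/cvgr_lt: (h1 Q); apply.
apply: le_lt_trans (nm_sum _ _ _) _.
rewrite (bigID (fun i => i \in Q)) /=.
have h3 : \sum_(i <- L N | i \in Q) nm (H N i) <= \sum_(i <- Q) nm (H N i).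
  rewrite -big_filter [leRHS](bigID (fun i => i \in L N)) /= -[X in _ <= X + _]big_filter.
  rewrite (perm_big [seq i <- Q | i \in L N]) /=; last first.
    apply: uniq_perm; rewrite ?filter_uniq // => i.
    by rewrite !mem_filter andbC.
  by rewrite lerDl sumr_ge0 // => i _; exact: nm_ge0.
have h4 : \sum_(i <- L N | i \notin Q) nm (H N i) <= eps / 2.
  by apply: le_trans (hQ _ (uL N)); exact: ler_sum.
lra.
Unshelve. all: by end_near. Qed.

(** Two exhaustions of one index set have the same limit: the difference lives on the symmetric
    difference of the lists, which eventually avoids any given index. No limit has to be known
    beforehand. *)
Lemma sum_nets (L L' : nat -> seq I) (w : I -> C) :
  (forall N, uniq (L N)) -> (forall N, uniq (L' N)) -> (forall i, nm (w i) <= b i) ->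
  (forall i, \forall N \near \oo, i \in L N) ->
  (forall i, \forall N \near \oo, i \in L' N) ->
  cv (fun N => \sum_(i <- L N) w i - \sum_(i <- L' N) w i) 0.
Proof.
move=> uL uL' wb hL hL'.
pose H N i := if (i \in L N) == (i \in L' N) then 0 else if i \in L N then w i else - w i.
have -> : (fun N => \sum_(i <- L N) w i - \sum_(i <- L' N) w i) =
    (fun N => \sum_(i <- undup (L N ++ L' N)) H N i).
  apply/funext => N; pose U := undup (L N ++ L' N).
  have sub (s : seq I) : uniq s -> {subset s <= U} ->
      \sum_(i <- s) w i = \sum_(i <- U) (if i \in s then w i else 0).
    move=> us sU; rewrite -big_mkcond -big_filter; apply/perm_big/uniq_perm => //.
      by rewrite filter_uniq ?undup_uniq.
    by move=> i; rewrite mem_filter; case: (boolP (i \in s)) => //= /sU ->.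
  rewrite (sub (L N)) ?(sub (L' N)) //; last 2 first.
  - by move=> i il; rewrite mem_undup mem_cat il orbT.
  - by move=> i il; rewrite mem_undup mem_cat il.
  rewrite -sumrB; apply: eq_bigr => i _; rewrite /H.
  by case: (i \in L N); case: (i \in L' N) => /=; rewrite ?subrr ?subr0 ?sub0r.
apply: tannery => [N|N i|i]; first exact: undup_uniq.
  rewrite /H; case: ifP => _; last by case: ifP => _; rewrite ?nmN.
  by rewrite nm0; apply: le_trans (wb i); exact: nm_ge0.
apply: (@eq_cv (fun=> 0)); last exact: cv_cst.
near=> N.
have l1 : i \in L N by near: N; exact: hL.
have l2 : i \in L' N by near: N; exact: hL'.
by rewrite /H l1 l2 eqxx.
Unshelve. all: by end_near. Qed.

End Tannery.

(** * Convergence, zeros, inversion and continuity of theta *)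

Section Theta.

Variables (p : C) (th : C -> C).
Hypothesis p1 : nm p < 1.

Definition theta_prod x N := \prod_(j < N) ((1 - p ^+ j * x) * (1 - p ^+ j.+1 / x)).

Let p01 : 0 <= nm p < 1. Proof. by rewrite nm_ge0. Qed.

Let tfac x j := - (p ^+ j * x) - p ^+ j.+1 / x + p ^+ j * p ^+ j.+1.

Let theta_prodE x : x != 0 -> theta_prod x = pprod (tfac x).
Proof.
move=> x0; apply/funext => N; apply: eq_bigr => j _.
by rewrite /tfac; field.
Qed.

Let nmpX_le1 j : nm p ^+ j <= 1.
Proof. by rewrite exprn_ile1 ?nm_ge0 // ltW. Qed.

(** The bound depends on [x] only through the annulus [1 / rho <= nm x <= rho], which gives the
    uniform tails behind [theta_cts]. *)
Let tfac_le (rho : R) x j : nm x <= rho -> nm x^-1 <= rho ->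
  nm (tfac x j) <= (rho + rho + 1) * nm p ^+ j.
Proof.
move=> h1 h2; have pj : 0 <= nm p ^+ j by rewrite exprn_ge0 ?nm_ge0.
have pj1 : nm p ^+ j.+1 <= nm p ^+ j by rewrite exprS ler_piMl // ltW.
apply: le_trans (nmD _ _) _; rewrite !mulrDl; apply: lerD; last first.
  by rewrite mul1r nmM !nmX ler_piMr.
apply: le_trans (nmD _ _) _; rewrite !nmN !nmM !nmX; apply: lerD.
  by rewrite mulrC ler_wpM2r.
by rewrite mulrC; apply: ler_pM; rewrite ?nm_ge0 // exprn_ge0 ?nm_ge0.
Qed.

Lemma theta_prod_cv x : x != 0 -> exists l, cv (theta_prod x) l.
Proof.
move=> x0; rewrite theta_prodE //; pose rho := Num.max (nm x) (nm x^-1).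
apply: (@pprod_cv (rho + rho + 1) (nm p)) => // [|j].
  by rewrite !addr_ge0 // le_max nm_ge0.
by apply: tfac_le; rewrite le_max lexx ?orbT.
Qed.

Hypothesis thE : forall x, x != 0 -> cv (theta_prod x) (th x).

Lemma theta_eq0 x : x != 0 -> th x = 0 ->
  exists j : nat, p ^+ j * x = 1 \/ p ^+ j.+1 = x.
Proof.
move=> x0 tx0; apply: contrapT => H.
suff : th x != 0 by rewrite tx0 eqxx.
have := thE x0; rewrite theta_prodE // => h.
pose rho := Num.max (nm x) (nm x^-1).
apply: (@pprod_neq0 (rho + rho + 1) (nm p) _ _ _ _ _ h) => // [|j|j].
- by rewrite !addr_ge0 // le_max nm_ge0.
- by apply: tfac_le; rewrite le_max lexx ?orbT.
have -> : 1 + tfac x j = (1 - p ^+ j * x) * (1 - p ^+ j.+1 / x) by rewrite /tfac; field.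
rewrite mulf_neq0 // subr_eq0; apply/eqP => E; apply: H; exists j; first by left.
by right; rewrite -[LHS](divfK x0) -E mul1r.
Qed.

Lemma theta1 : th 1 = 0.
Proof.
apply: cv_unique (thE (oner_neq0 C)) _; apply: (@eq_cv (fun=> 0)); last exact: cv_cst.
near=> N; have N0 : (0 < N)%N by near: N; exact: nbhs_infty_gt.
rewrite /theta_prod -(prednK N0) big_ord_recl /= expr0 mulr1 subrr !mul0r //.
Unshelve. all: by end_near. Qed.

(** The partial products satisfy the relation exactly up to the boundary factors [1 - p^N x] and
    [1 - p^N / x], which tend to 1. The case [x = 1] is separate because [1 - x] is cancelled. *)
Lemma thetaV x : x != 0 -> th x^-1 = - (th x / x).
Proof.
move=> x0; have x'0 : x^-1 != 0 by rewrite invr_eq0.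
have [->|x1] := eqVneq x 1; first by rewrite invr1 theta1 mul0r oppr0.
have E N : theta_prod x^-1 N * (1 - p ^+ N * x^-1) * (1 - x) =
           (1 - x^-1) * theta_prod x N * (1 - p ^+ N * x).
  elim: N => [|N IH]; first by rewrite /theta_prod !big_ord0 !expr0; ring.
  have -> : theta_prod x N.+1 = theta_prod x N * ((1 - p ^+ N * x) * (1 - p ^+ N.+1 / x)).
    by rewrite /theta_prod big_ord_recr.
  have -> : theta_prod x^-1 N.+1 = theta_prod x^-1 N * ((1 - p ^+ N * x^-1) *
    (1 - p ^+ N.+1 / x^-1)).
    by rewrite /theta_prod big_ord_recr.
  rewrite invrK; transitivity (theta_prod x^-1 N * (1 - p ^+ N * x^-1) * (1 - x) *
    ((1 - p ^+ N.+1 * x) * (1 - p ^+ N.+1 / x))); first by ring.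
  by rewrite IH; ring.
have h1 : cv (fun N => theta_prod x^-1 N * (1 - p ^+ N * x^-1) * (1 - x))
     (th x^-1 * (1 - 0 * x^-1) * (1 - x)).
  apply: cvM (cv_cst _); apply: cvM; first exact: thE.
  by apply: cvB (cv_cst _) _; apply: cvM (cv_cst _); exact: cv_geo.
have h2 : cv (fun N => theta_prod x^-1 N * (1 - p ^+ N * x^-1) * (1 - x))
     ((1 - x^-1) * th x * (1 - 0 * x)).
  rewrite (_ : (fun N => _) = (fun N => (1 - x^-1) * theta_prod x N * (1 - p ^+ N *
    x))); last exact/funext.
  apply: cvM; first by apply: cvM (cv_cst _) _; exact: thE.
  by apply: cvB (cv_cst _) _; apply: cvM (cv_cst _); exact: cv_geo.
have x10 : 1 - x != 0 by rewrite subr_eq0 eq_sym.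
apply: (mulIf x10); have := cv_unique h1 h2; rewrite !mul0r subr0 !mulr1 => ->.
by field.
Qed.

(** An [eps / 3] argument: eventually [u n] and its inverse have norm at most [rho], so the tails
    are uniform and the continuity of finite products suffices. *)
Lemma theta_cts u x : x != 0 -> cv u x -> cv (fun n => th (u n)) (th x).
Proof.
move=> x0 ux; have x'0 := invr_neq0 x0; have uV := cvV x0 ux.
pose rho := Num.max (nm x + 1) (nm x^-1 + 1).
pose A := rho + rho + 1.
have rho0 : 0 <= rho by rewrite le_max addr_ge0 ?nm_ge0.
have A0 : 0 <= A by rewrite !addr_ge0.
pose B := prod_bound A (nm p) * A / (1 - nm p).
have tail y k : y != 0 -> nm y <= rho -> nm y^-1 <= rho ->
    nm (th y - theta_prod y k) <= B * nm p ^+ k.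
  move=> y0 h1 h2; have := thE y0; rewrite theta_prodE // => h.
  by apply: (@pprod_tail A (nm p) A0 p01) => // j; exact: tfac_le.
have Bp : (fun k => B * nm p ^+ k) @ \oo --> (0 : R).
  have -> : (0 : R) = B * 0 by rewrite mulr0.
  by apply: cvgM; [exact: cvg_cst|apply: cvg_expr; rewrite ger0_norm ?nm_ge0].
have pc k : cv (fun n => theta_prod (u n) k) (theta_prod x k).
  apply: cv_prod => j _; apply: cvM; apply: cvB (cv_cst _) _;
    first by apply: cvM (cv_cst _) ux.
  by apply: cvM (cv_cst _) uV.
rewrite /cv; apply/cvgrPdist_lt => eps eps0.
have [k hk] : exists k, B * nm p ^+ k < eps / 3.
  have e3 : 0 < eps / 3 by lra.
  by move: Bp => /cvgr_lt /(_ _ e3) [k _ Hk]; exists k; apply: Hk => /=.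
near=> n.
have hx : nm x <= rho by rewrite le_max lerDl ler01.
have hx' : nm x^-1 <= rho by rewrite le_max [X in _ || X]lerDl ler01 orbT.
have hu : nm (u n) <= rho.
  by apply/ltW; rewrite lt_max; apply/orP; left; near: n; move/cv_nm: ux => /cvgr_lt;
    apply; lra.
have hu' : nm (u n)^-1 <= rho.
  by apply/ltW; rewrite lt_max; apply/orP; right; near: n; move/cv_nm: uV => /cvgr_lt;
    apply; lra.
have un0 : u n != 0.
  apply/eqP => un0; have : 0 < nm (u n).
    by near: n; move/cv_nm: ux => /cvgr_gt; apply; exact: nm_gt0.
  by rewrite un0 nm0 ltxx.
have t1 := tail _ k un0 hu hu'; have t2 := tail _ k x0 hx hx'.
have t3 : nm (theta_prod (u n) k - theta_prod x k) < eps / 3.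
  by near: n; have e3 : 0 < eps / 3 by [lra]; move: (pc k) => /cvgr_lt; apply.
rewrite sub0r normrN ger0_norm ?nm_ge0 //.
have -> : th (u n) - th x = (th (u n) - theta_prod (u n) k) +
  ((theta_prod (u n) k - theta_prod x k) - (th x - theta_prod x k)) by ring.
have := nmD (th (u n) - theta_prod (u n) k) ((theta_prod (u n) k - theta_prod x k) -
  (th x - theta_prod x k)).
have := nmD (theta_prod (u n) k - theta_prod x k) (- (th x - theta_prod x k));
  rewrite nmN.
lra.
Unshelve. all: by end_near. Qed.

(** * The Jacobi triple product as the limit of a finite identity *)

Definition box N : seq int := [seq k%:Z - N%:Z | k <- iota 0 (N.*2.+1)].

Lemma mem_box N (i : int) : (i \in box N) = (absz i <= N)%N.
Proof.
apply/mapP/idP => [[k]|iN]; first by rewrite mem_iota => /= kN ->; lia.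
exists (absz (i + N%:Z)); last by lia.
by rewrite mem_iota /=; lia.
Qed.

Lemma box_uniq N : uniq (box N).
Proof. by rewrite map_inj_uniq ?iota_uniq // => i j; lia. Qed.

(* [i (i - 1) / 2] *)
Definition tri (i : int) : nat :=
  match i with Posz k => 'C(k, 2) | Negz k => 'C(k.+2, 2) end.

Lemma bin2DZ k : ('C(k, 2) * 2 + k = k * k)%N.
Proof. by case: k => // k; have := bin2 k.+1; have := odd_double_half (k.+1 * k);
  rewrite oddM /= andNb; lia. Qed.

Lemma triE i : ((tri i)%:Z * 2 = i * (i - 1))%R.
Proof.
case: i => k /=; first by have := bin2DZ k; lia.
by rewrite NegzE; have := bin2DZ k.+2; lia.
Qed.

(** Summable majorant for the theta series; the nonnegative and the negative indices contribute at
    most 2 each. *)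
Definition half (k : nat) : R := (2^-1) ^+ k.

Lemma half_sum_le (L : seq int) : uniq L -> \sum_(i <- L) half (absz i) <= 4.
Proof.
move=> uL.
have nat_le (s : seq nat) : uniq s -> \sum_(k <- s) half k <= 2.
  move=> us; pose m := (\max_(k <- s) k).+1.
  have -> : \sum_(k <- s) half k = \sum_(k <- iota 0 m | k \in s) half k.
    rewrite -[RHS]big_filter; apply/perm_big/uniq_perm;
      rewrite ?filter_uniq ?iota_uniq // => k.
    rewrite mem_filter mem_iota add0n /=; case: (boolP (k \in s)) => //= ks.
    apply/esym; rewrite ltnS; exact: (@leq_bigmax_seq _ s xpredT id k ks isT).
  apply: le_trans (_ : \sum_(k <- iota 0 m) half k <= _).
    rewrite big_mkcond; apply: ler_sum => k _; case: ifP => // _.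
    by rewrite /half exprn_ge0 // invr_ge0.
  rewrite -[iota 0 m]/(index_iota 0 m) big_mkord; have h12 : 0 <= (2^-1 : R) < 1 by lra.
  by have := geo_sum_le h12 m; have -> : (1 - 2^-1 : R)^-1 = 2 by field.
pose Lp := [seq absz i | i <- L & (0 <= i)%R]; pose Ln := [seq absz i | i <- L & ~~ (0
  <= i)%R].
have -> : \sum_(i <- L) half (absz i) = \sum_(k <- Lp) half k + \sum_(k <- Ln) half k.
  by rewrite !big_map !big_filter [LHS](bigID (fun i : int => (0 <= i)%R)).
have u1 : uniq Lp.
  rewrite map_inj_in_uniq ?filter_uniq // => i j; rewrite !mem_filter =>
    /andP[i0 _] /andP[j0 _].
  by lia.
have u2 : uniq Ln.
  rewrite map_inj_in_uniq ?filter_uniq // => i j; rewrite !mem_filter =>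
    /andP[i0 _] /andP[j0 _].
  by lia.
have := nat_le _ u1; have := nat_le _ u2; lra.
Qed.

Definition tcoef (i : int) : C := (-1) ^ i * p ^+ tri i.

Definition tterm (x : C) (i : int) : C := tcoef i * x ^ i.

Lemma nm_sign (i : int) : nm ((-1) ^ i) = 1.
Proof. by case: i => k; rewrite ?NegzE -?exprnP -?exprnN ?nmV nmX nmN nm1 expr1n
  ?invr1. Qed.

(** The sequence [v k], which carries an extra [2^k], has ratios [2 rho (nm p)^k]. These are
    eventually at most 1, so [v] is bounded. *)
Lemma theta_bound (rho : R) : 0 <= rho -> exists2 M, 0 <= M &
  forall k, nm p ^+ 'C(k, 2) * rho ^+ k <= M * half k.
Proof.
move=> rho0; have P0 := nm_ge0 p.
pose v k := nm p ^+ 'C(k, 2) * (2 * rho) ^+ k.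
have v0 k : 0 <= v k by rewrite mulr_ge0 ?exprn_ge0 ?mulr_ge0.
have vS k : v k.+1 = v k * (2 * rho * nm p ^+ k).
  by rewrite /v binS bin1 exprD exprS; ring.
have [n0 hn0] : exists n0, forall k, (n0 <= k)%N -> 2 * rho * nm p ^+ k <= 1.
  have : (fun k => 2 * rho * nm p ^+ k) @ \oo --> (0 : R).
    have -> : (0 : R) = 2 * rho * 0 by rewrite mulr0.
    by apply: cvgM; [exact: cvg_cst|apply: cvg_expr; rewrite ger0_norm].
  by move/cvgr_le => /(_ 1 ltr01) [n0 _ H]; exists n0 => k hk; exact: H.
pose M := \sum_(k < n0.+1) v k.
have vM k : v k <= M.
  have [kn|nk] := leqP k n0.
    by rewrite /M (bigD1 (Ordinal (_ : (k < n0.+1)%N))) //= lerDl sumr_ge0.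
  rewrite -(subnKC (ltnW nk)); elim: (k - n0)%N => [|j IH].
    by rewrite addn0 /M big_ord_recr /= lerDr sumr_ge0.
  by rewrite addnS vS; apply: le_trans IH; rewrite ler_piMr // hn0 // leq_addr.
exists M; first by rewrite sumr_ge0.
move=> k; have := vM k; rewrite /v exprMn /half exprVn => H.
have p2 : 0 < (2 : R) ^+ k by rewrite exprn_gt0.
by rewrite -(ler_pM2r p2) mulrVK ?unitfE ?gt_eqF // -mulrA [rho ^+ k * _]mulrC.
Qed.

Lemma tterm_le x : x != 0 -> exists2 M, 0 <= M & forall i, nm (tterm x i) <= M *
  half (absz i).
Proof.
move=> x0; have P0 := nm_ge0 p.
pose rho := Num.max (nm x) (nm x^-1).
have rho0 : 0 <= rho by rewrite le_max nm_ge0.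
have [M M0 hM] := theta_bound rho0; exists M => // i.
rewrite /tterm /tcoef !nmM nm_sign mul1r nmX; apply: le_trans (hM _).
apply: ler_pM; rewrite ?nm_ge0 ?exprn_ge0 //.
  case: i => k //=; rewrite [X in _ ^+ X]binS bin1 exprD ler_piMr ?exprn_ge0 //.
case: i => k /=; first by rewrite -exprnP nmX lerXn2r ?nnegrE ?nm_ge0 // le_max lexx.
rewrite NegzE -exprnN nmV nmX -exprVn -nmV lerXn2r ?nnegrE ?nm_ge0 //.
by rewrite le_max lexx orbT.
Qed.
Definition qfac k := \prod_(i < k) (1 - p ^+ i.+1).

Let pX_neq1 i : 1 - p ^+ i.+1 != 0.
Proof.
rewrite subr_eq0; apply/eqP => E; have : nm (p ^+ i.+1) < 1.
  by rewrite nmX exprn_ilt1 ?nm_ge0.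
by rewrite -E nm1 ltxx.
Qed.

Lemma qfac_neq0 k : qfac k != 0.
Proof. by apply/prodf_neq0 => i _; exact: pX_neq1. Qed.

Lemma qfacS k : qfac k.+1 = qfac k * (1 - p ^+ k.+1).
Proof. by rewrite /qfac big_ord_recr. Qed.

Lemma qfac_cv : exists2 l, l != 0 & cv qfac l.
Proof.
have le1 j : nm (- p ^+ j.+1) <= 1 * nm p ^+ j.
  by rewrite nmN nmX mul1r exprS ler_piMl ?exprn_ge0 ?nm_ge0 // ltW.
have [l hl] := pprod_cv ler01 p01 le1.
by exists l => //; apply: (pprod_neq0 ler01 p01 le1 hl).
Qed.

(* The Gaussian binomial coefficient of [2 N] and [k] in base [p]. *)
Definition cbin N k : C :=
  if (k <= N.*2)%N then qfac N.*2 / (qfac k * qfac (N.*2 - k)) else 0.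

Lemma cbinE N u v : (u + v = N.*2)%N -> cbin N u = qfac (u + v) / (qfac u * qfac v).
Proof. by move=> uv; rewrite /cbin -uv leq_addr addKn. Qed.

Lemma cbin0 N : cbin N 0 = 1.
Proof. by rewrite (@cbinE _ 0 N.*2) // /qfac big_ord0 mul1r divff // qfac_neq0. Qed.

Lemma cbin_top N : cbin N N.*2 = 1.
Proof. by rewrite (@cbinE _ N.*2 0) ?addn0 // {3}/qfac big_ord0 mulr1 divff //
  qfac_neq0. Qed.

Lemma cbin_gt N k : (N.*2 < k)%N -> cbin N k = 0.
Proof. by rewrite /cbin ltnNge => /negbTE ->. Qed.

(** The two forms of the Pascal rule for Gaussian binomials, used in succession because the upper
    index [2 N] grows by 2. *)
Lemma cbin_rec N u v : (u + v = N.*2)%N ->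
  cbin N.+1 u.+1 = (1 + p ^+ (u + v).+1) * cbin N u
    + p ^+ v.+1 * (if u is u'.+1 then cbin N u' else 0) + p ^+ u.+1 * cbin N u.+1.
Proof.
move=> uv.
have [hu hv huv] := And3 (qfac_neq0 u) (qfac_neq0 v) (qfac_neq0 (u + v)).
have [pu pv] : 1 - p ^+ u.+1 != 0 /\ 1 - p ^+ v.+1 != 0 by [].
have -> : cbin N.+1 u.+1 = cbin N u * ((1 - p ^+ (u + v).+1) * (1 - p ^+ (u + v).+2)) /
    ((1 - p ^+ u.+1) * (1 - p ^+ v.+1)).
  rewrite (@cbinE _ u.+1 v.+1) ?(cbinE uv); last by rewrite doubleS -uv addSn addnS.
  by rewrite addSn addnS !qfacS; field; rewrite pu pv hu hv.
have -> : (if u is u'.+1 then cbin N u' else 0) = cbin N u *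
  (1 - p ^+ u) / (1 - p ^+ v.+1).
  case: u uv hu huv pu => [|u] uv hu huv pu; first by rewrite expr0 subrr mulr0 mul0r.
  rewrite (cbinE uv) (@cbinE _ u v.+1) ?addnS -?addSn // !qfacS; field.
  by rewrite ?qfac_neq0 ?pX_neq1.
have -> : cbin N u.+1 = cbin N u * (1 - p ^+ v) / (1 - p ^+ u.+1).
  case: v uv hv huv pv => [|v] uv hv huv pv.
    by rewrite expr0 subrr mulr0 mul0r /cbin -uv addn0 ltnn.
  rewrite (cbinE uv) (@cbinE _ u.+1 v) ?addSn -?addnS // !qfacS; field.
  by rewrite ?qfac_neq0 ?pX_neq1.
move: pu pv; rewrite !exprS !exprD => pu pv.
by field; rewrite pu pv.
Qed.

(** The finite triple product, multiplied by [x^N] to clear negative powers; an instance of the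
    q-binomial theorem in base [p]. *)
Definition triple_poly N : {poly C} :=
  \poly_(k < N.*2.+1) (cbin N k * tcoef (k%:Z - N%:Z)).

Lemma coef_triple_poly N k : (triple_poly N)`_k = cbin N k * tcoef (k%:Z - N%:Z).
Proof. by rewrite coef_poly ltnS /cbin; case: (k <= _)%N; rewrite ?mul0r. Qed.

Lemma tcoefS i a b : (a + tri (i + 1) = b + tri i)%N ->
  p ^+ a * tcoef (i + 1) = - (p ^+ b * tcoef i).
Proof.
move=> E; rewrite /tcoef expfzDr ?oppr_eq0 ?oner_neq0 // expr1z.
transitivity (- ((-1) ^ i * (p ^+ a * p ^+ tri (i + 1)))); first by ring.
by rewrite -exprD E exprD; ring.
Qed.

(** The multiplier is [(1 - p^N X) (X - p^(N+1))], that is [X] times the new pair of factors in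
    [theta_prod]. *)
Lemma triple_polyS N : triple_poly N.+1 =
  (1 + p ^+ N.*2.+1) *: (triple_poly N * 'X) - p ^+ N *: (triple_poly N * 'X^2)
  - p ^+ N.+1 *: triple_poly N.
Proof.
apply/polyP => k; rewrite !coefB !coefZ coefMX coefMXn !coef_triple_poly.
pose i : int := k%:Z - N.+1%:Z.
have e3 : p ^+ N.+1 * (cbin N k * tcoef (k%:Z - N%:Z)) = - (p ^+ k * cbin N k * tcoef i).
  have -> : k%:Z - N%:Z = i + 1 :> int by rewrite /i; lia.
  have hi : (N.+1 + tri (i + 1) = k + tri i)%N.
    by have := triE (i + 1); have := triE i; rewrite /i; clear; lia.
  by rewrite mulrCA (tcoefS hi); ring.
rewrite e3 -/i opprK.
case: k @i e3 => [|u] i e3 /=.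
  by rewrite !cbin0 expr0; ring.
have e1 : u%:Z - N%:Z = i :> int by rewrite /i; lia.
have e2 u' v : u = u'.+1 -> (v + tri i = N + tri (u'%:Z - N%:Z))%N ->
    p ^+ N * (cbin N u' * tcoef (u'%:Z - N%:Z)) = - (p ^+ v * cbin N u' * tcoef i).
  move=> uu' hv; have ei : i = (u'%:Z - N%:Z) + 1 :> int by rewrite /i; lia.
  rewrite ei in hv *; have H := tcoefS hv.
  by rewrite mulrCA -[p ^+ N * _]opprK -H; ring.
rewrite e1; have [uN|Nu] := leqP u N.*2; last first.
  case: u Nu @i e1 e2 e3 => [//|u] Nu i e1 e2 e3 /=.
  rewrite !subSS subn0 (cbin_gt Nu) (cbin_gt (leqW Nu)).
  have [uN|uN] := eqVneq u N.*2; last first.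
    by rewrite !cbin_gt ?doubleS; [ring|lia|lia].
  rewrite (e2 u 0%N) //; last first.
    by have := triE i; have := triE (u%:Z - N%:Z); rewrite /i uN; lia.
  by rewrite uN cbin_top -[N.*2.+2]doubleS cbin_top expr0; ring.
pose v := (N.*2 - u)%N; have uv : (u + v = N.*2)%N by rewrite subnKC.
rewrite (cbin_rec uv) uv.
case: u uN @i e1 e2 e3 @v uv => [|u] uN i e1 e2 e3 v uv /=; first by ring.
rewrite !subSS subn0 (e2 u v.+1) //; first by ring.
by have := triE i; have := triE (u%:Z - N%:Z); move: uv; rewrite /i /v; lia.
Qed.
Lemma theta_prod_poly N x : x != 0 -> x ^+ N * theta_prod x N = (triple_poly N).[x].
Proof.
move=> x0; elim: N => [|N IH].
  rewrite /theta_prod big_ord0 expr0 mul1r horner_poly big_ord1 (cbin0 0) expr0 subrr.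
  by rewrite /tcoef /= expr0z expr0 !mulr1.
have -> : theta_prod x N.+1 = theta_prod x N * ((1 - p ^+ N * x) * (1 - p ^+ N.+1 / x)).
  by rewrite /theta_prod big_ord_recr.
rewrite triple_polyS !(hornerD, hornerN, hornerZ, hornerM, hornerX, hornerXn) -IH.
by rewrite !exprS -addnn exprD; field; rewrite x0.
Qed.

Lemma theta_prod_sum N x : x != 0 ->
  theta_prod x N = \sum_(i <- box N) cbin N (absz (i + N%:Z)%R) * tterm x i.
Proof.
move=> x0; apply: (mulfI (expf_neq0 N x0)); rewrite theta_prod_poly // horner_poly.
rewrite mulr_sumr /box big_map -[X in \sum_(_ <- iota 0 X) _]subn0 -/(index_iota 0 _)
  big_mkord.
apply: eq_bigr => k _.
rewrite subrK absz_nat /tterm expfzDr // -exprnN -exprnP.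
by field; rewrite expf_neq0.
Qed.

Lemma cv_sub u l (phi : nat -> nat) : (forall n, \forall N \near \oo, (n <= phi N)%N) ->
  cv u l -> cv (u \o phi) l.
Proof.
move=> hphi h; apply: (cvg_comp phi (fun n => nm (u n - l)) _ h).
exact/cvgnyPge.
Qed.

Lemma cv_bounded u l : cv u l -> exists B, forall n, nm (u n) <= B.
Proof.
move=> h; have [N _ hN] : \forall n \near \oo, nm (u n) < nm l + 1.
  by move/cv_nm/cvgr_lt: h; apply; lra.
exists (nm l + 1 + \sum_(i < N) nm (u i)) => n.
have [Nn|nN] := leqP N n.
  have : nm (u n) < nm l + 1 by exact: hN.
  have : 0 <= \sum_(i < N) nm (u i) by rewrite sumr_ge0 // => i _; exact: nm_ge0.
  lra.
rewrite (bigD1 (Ordinal nN)) //=; have := nm_ge0 l.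
have : 0 <= \sum_(i < N | i != Ordinal nN) nm (u i) by rewrite sumr_ge0 // => i _;
  exact: nm_ge0.
lra.
Qed.

Lemma cbin_bounded : exists2 B, 0 <= B & forall N k, nm (cbin N k) <= B.
Proof.
have [l l0 hl] := qfac_cv.
have [B1 h1] := cv_bounded hl; have [B2 h2] := cv_bounded (cvV l0 hl).
have B10 : 0 <= B1 by apply: le_trans (h1 0%N); exact: nm_ge0.
have B20 : 0 <= B2 by apply: le_trans (h2 0%N); exact: nm_ge0.
exists (B1 * (B2 * B2)); first by rewrite !mulr_ge0.
move=> N k; rewrite /cbin; case: ifP => _; last by rewrite nm0 !mulr_ge0.
by rewrite invfM !nmM !ler_pM ?mulr_ge0 ?nm_ge0.
Qed.

Lemma cbin_cv l (i : int) : l != 0 -> cv qfac l -> cv (fun N =>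
  cbin N (absz (i + N%:Z)%R)) l^-1.
Proof.
move=> l0 hl.
have h1 : cv (fun N => qfac N.*2 / (qfac (absz (i + N%:Z)%R) *
  qfac (N.*2 - absz (i + N%:Z)%R))) (l / (l * l)).
  apply: cv_div; first by rewrite mulf_neq0.
    apply: (cv_sub (phi := double)) hl => n; near=> N.
    have : (n <= N)%N by near: N; exact: nbhs_infty_ge.
    by lia.
  apply: cvM.
    apply: (cv_sub (phi := fun N => absz (i + N%:Z)%R)) hl => n; near=> N.
    have : (n + absz i <= N)%N by near: N; exact: nbhs_infty_ge.
    by lia.
  apply: (cv_sub (phi := fun N => (N.*2 - absz (i + N%:Z)%R)%N)) hl => n; near=> N.
  have : (n + absz i <= N)%N by near: N; exact: nbhs_infty_ge.
  by lia.
have -> : l^-1 = l / (l * l) by field.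
apply: eq_cv h1; near=> N; rewrite /cbin ifT //.
have : (absz i <= N)%N by near: N; exact: nbhs_infty_ge.
by lia.
Unshelve. all: by end_near. Qed.

(** The Gaussian binomials are bounded and tend to [1 / l], so [tannery] allows the limit to be
    taken termwise. Here [l] is the product of all [1 - p^i], a constant that cancels from the
    addition formula. *)
Lemma theta_series l x : l != 0 -> cv qfac l -> x != 0 ->
  cv (fun N => \sum_(i <- box N) tterm x i) (l * th x).
Proof.
move=> l0 hl x0; have [M M0 hM] := tterm_le x0; have [B B0 hB] := cbin_bounded.
pose H N (i : int) := (if (absz i <= N)%N then cbin N (absz (i +
  N%:Z)%R) - l^-1 else 0) * tterm x i.
have BM0 : 0 <= (B + nm l^-1) * M by rewrite mulr_ge0 ?addr_ge0 ?nm_ge0.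
have H0 : cv (fun N => \sum_(i <- box N) H N i) 0.
  apply: (@tannery _ (fun i : int => (B + nm l^-1) * M * half (absz i)) ((B +
    nm l^-1) * M * 4)).
  - by move=> L uL; rewrite -mulr_sumr ler_wpM2l // half_sum_le.
  - exact: box_uniq.
  - move=> N i; rewrite /H nmM -mulrA ler_pM ?nm_ge0 //.
    case: ifP => _; last by rewrite nm0 addr_ge0 ?nm_ge0.
    by apply: le_trans (nmD _ _) _; rewrite nmN lerD2r.
  - move=> i; have -> : (0 : C) = (l^-1 - l^-1) * tterm x i by rewrite subrr mul0r.
    apply: cvM (cv_cst _); apply: (@eq_cv (fun N => cbin N (absz (i + N%:Z)%R) - l^-1)).
      near=> N; rewrite ifT //; near: N; exact: nbhs_infty_ge.
    by apply: cvB (cv_cst _); exact: cbin_cv.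
have -> : l * th x = l * (th x - 0) by rewrite subr0.
have := cvM (cv_cst l) (cvB (thE x0) H0).
apply: eq_cv; near=> N; rewrite theta_prod_sum // -sumrB mulr_sumr.
apply: eq_big_seq => i; rewrite mem_box => iN; rewrite /H iN.
by field.
Unshelve. all: by end_near. Qed.

(** * The addition formula *)

Definition eser N x := \sum_(i <- box N) p ^+ absz (i * i) * x ^ (2 * i).
Definition oser N x := \sum_(i <- box N) p ^+ absz (i * i + i) * x ^ (2 * i + 1).

Let tterm_pair x y (i j : int) : x != 0 -> y != 0 ->
  tterm (x * y) i * tterm (x / y) j =
  (-1) ^ (i + j) * p ^+ (tri i + tri j) * (x ^ (i + j) * y ^ (i - j)).
Proof.
move=> x0 y0; rewrite /tterm /tcoef !expfzMl ?invr_neq0 // exprz_inv exprD.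
by rewrite !expfzDr ?oppr_eq0 ?oner_neq0 //; ring.
Qed.

Let sign_even (i : int) : (-1 : C) ^ (2 * i) = 1.
Proof. by rewrite -exprz_exp (_ : (2 : int) = 2%N%:Z) // -exprnP sqrrN expr1n exp1rz. Qed.

Let tterm_even x y (a b : int) : x != 0 -> y != 0 ->
  tterm (x * y) (a + 1 + b) * tterm (x / y) (a + 1 - b) =
  x * (p ^+ absz (a * a + a) * x ^ (2 * a + 1) * (p ^+ absz (b * b) * y ^ (2 * b))).
Proof.
move=> x0 y0; rewrite tterm_pair //.
have -> : a + 1 + b + (a + 1 - b) = 2 * (a + 1) :> int by ring.
have -> : a + 1 + b - (a + 1 - b) = 2 * b :> int by ring.
have -> : (tri (a + 1 + b)%R + tri (a + 1 - b)%R = absz (a * a + a)%R + absz (b * b)%R)%N.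
  by have := triE (a + 1 + b); have := triE (a + 1 - b); clear; nia.
rewrite sign_even exprD; have -> : 2 * (a + 1) = 1 + (2 * a + 1) :> int by ring.
by rewrite expfzDr // expr1z; ring.
Qed.

Let tterm_odd x y (a b : int) : x != 0 -> y != 0 ->
  tterm (x * y) (a + b + 1) * tterm (x / y) (a - b) =
  - (x * (p ^+ absz (a * a) * x ^ (2 * a) * (p ^+ absz (b * b + b) * y ^ (2 * b + 1)))).
Proof.
move=> x0 y0; rewrite tterm_pair //.
have -> : a + b + 1 + (a - b) = 1 + 2 * a :> int by ring.
have -> : a + b + 1 - (a - b) = 2 * b + 1 :> int by ring.
have -> : (tri (a + b + 1)%R + tri (a - b)%R = absz (a * a)%R + absz (b * b + b)%R)%N.
  by have := triE (a + b + 1); have := triE (a - b); clear; nia.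
rewrite !(@expfzDr _ _ 1) ?oppr_eq0 ?oner_neq0 // sign_even exprD !expr1z.
by ring.
Qed.

Let near_box (i : int) : \forall N \near \oo, i \in box N.
Proof. by near=> N; rewrite mem_box; near: N; exact: nbhs_infty_ge. Unshelve. all: by
  end_near. Qed.

(* Split the pairs [(i, j)] according to the parity of [i + j]; the two classes
   are parametrised by [f0] and [f1]. *)
Lemma ser_prod x y : x != 0 -> y != 0 ->
  cv (fun N => (\sum_(i <- box N) tterm (x * y) i) * (\sum_(i <- box N) tterm (x / y) i)
      - x * (oser N x * eser N y - eser N x * oser N y)) 0.
Proof.
move=> x0 y0.
have [M1 M10 h1] := tterm_le (mulf_neq0 x0 y0).
have [M2 M20 h2] := tterm_le (mulf_neq0 x0 (invr_neq0 y0)).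
pose L N := [seq (i, j) | i <- box N, j <- box N].
pose f0 (a : int * int) : int * int := (a.1 + 1 + a.2, a.1 + 1 - a.2).
pose f1 (a : int * int) : int * int := (a.1 + a.2 + 1, a.1 - a.2).
pose L' N := [seq f0 a | a <- L N] ++ [seq f1 a | a <- L N].
pose w (a : int * int) := tterm (x * y) a.1 * tterm (x / y) a.2.
have uL N : uniq (L N) by apply: allpairs_uniq; rewrite ?box_uniq // => -[? ?] [? ?].
have -> : (fun N => (\sum_(i <- box N) tterm (x * y) i) *
  (\sum_(i <- box N) tterm (x / y) i)
      - x * (oser N x * eser N y - eser N x * oser N y)) =
   (fun N => \sum_(a <- L N) w a - \sum_(a <- L' N) w a).
  apply/funext => N.
  have Ls (F : int * int -> C) :
      \sum_(a <- L N) F a = \sum_(i <- box N) \sum_(j <- box N) F (i,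
        j) by exact: big_allpairs.
  have L's : \sum_(a <- L' N) w a = \sum_(a <- L N) w (f0 a) + \sum_(a <- L N) w (f1 a).
    transitivity (\sum_(a <- [seq f0 a | a <- L N]) w a +
      \sum_(a <- [seq f1 a | a <- L N]) w a).
      exact: big_cat.
    by congr (_ + _); exact: big_map.
  rewrite L's !Ls /oser /eser !big_distrlr /=; congr (_ - _).
  rewrite mulrBr !mulr_sumr -sumrN -!big_split /=.
  apply: eq_bigr => a _; rewrite !mulr_sumr -sumrN -!big_split /=; apply: eq_bigr => b _.
  by rewrite /w /= tterm_even // tterm_odd.
pose b (a : int * int) := M1 * half (absz a.1) * (M2 * half (absz a.2)).
have half0 k : 0 <= half k by rewrite /half exprn_ge0 // invr_ge0.
have b0 a : 0 <= b a by rewrite !mulr_ge0.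
(* [L N] is a square of pairs [(i, j)], while [L' N] consists of the images of that square under
   [f0] and [f1]: two exhaustions of all pairs of integers. *)
apply: (@sum_nets _ b (M1 * 4 * (M2 * 4))).
- move=> s us; pose u1 := undup (unzip1 s); pose u2 := undup (unzip2 s).
  apply: (@le_trans _ _ (\sum_(a <- [seq (i, j) | i <- u1, j <- u2]) b a)).
    rewrite [leRHS](bigID (fun a => a \in s)) /= -[X in _ <= X + _]big_filter.
    rewrite [X in _ <= X + _](_ : _ = \sum_(a <- s) b a) ?lerDl ?sumr_ge0 //.
    apply/perm_big/uniq_perm => //.
      by rewrite filter_uniq // allpairs_uniq ?undup_uniq // => -[? ?] [? ?].
    move=> [i j]; rewrite mem_filter; case: (boolP ((i, j) \in s)) => //= ijs.
    apply/allpairsP; exists (i, j); split=> //; rewrite mem_undup.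
      by apply/mapP; exists (i, j).
    by apply/mapP; exists (i, j).
  rewrite big_allpairs /b /= -big_distrlr /= -!mulr_sumr.
  by rewrite ler_pM ?mulr_ge0 ?sumr_ge0 // ler_wpM2l // half_sum_le // undup_uniq.
- exact: uL.
- move=> N; rewrite cat_uniq; apply/and3P; split.
  + rewrite map_inj_uniq ?uL // => -[i j] [k l]; rewrite /f0 /= => -[] e1 e2.
    by congr (_, _); move: e1 e2; clear; lia.
  + apply/hasPn => a /mapP[[i j] _ ->]; apply/mapP => -[[k l] _];
    rewrite /f0 /f1 /= => -[].
    by clear; lia.
  + rewrite map_inj_uniq ?uL // => -[i j] [k l]; rewrite /f1 /= => -[] e1 e2.
    by congr (_, _); move: e1 e2; clear; lia.
- by move=> a; rewrite /w nmM ler_pM ?nm_ge0.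
- move=> [i j]; near=> N; apply/allpairsP; exists (i, j); split => //=; near: N;
  exact: near_box.
- move=> [i j].
  have [s hs] : exists s : int, i + j = 2 * s \/ i + j = 2 * s + 1.
    by exists ((i + j) %/ 2)%Z; clear; lia.
  near=> N; have [b1 b2 b3 b4] : [/\ s - 1 \in box N, i - s \in box N,
    s \in box N & i - s - 1 \in box N].
    by split; near: N; exact: near_box.
  rewrite mem_cat; case: hs => hs; apply/orP; [left|right]; apply/mapP.
    exists (s - 1, i - s); first by apply/allpairsP; exists (s - 1, i - s).
    by rewrite /f0 /=; congr (_, _); move: hs; clear; lia.
  exists (s, i - s - 1); first by apply/allpairsP; exists (s, i - s - 1).
  by rewrite /f1 /=; congr (_, _); move: hs; clear; lia.
Unshelve. all: by end_near. Qed.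

Lemma theta_addition x y u v : x != 0 -> y != 0 -> u != 0 -> v != 0 ->
  th (x * y) * th (x / y) * (th (u * v) * th (u / v))
  - th (x * v) * th (x / v) * (th (u * y) * th (u / y))
  = u / y * (th (x * u) * th (x / u)) * (th (y * v) * th (y / v)).
Proof.
move=> x0 y0 u0 v0; have [l l0 hl] := qfac_cv.
(* [G N s t] tends to [l^2 th (s t) th (s / t)]. Being [s] times a two by two determinant, it
   satisfies the Pluecker relation exactly for each [N]. *)
pose G N s t := s * (oser N s * eser N t - eser N s * oser N t).
have hG s t : s != 0 -> t != 0 -> cv (fun N => G N s t) (l ^+ 2 * (th (s * t) *
  th (s / t))).
  move=> s0 t0.
  have := cvM (theta_series l0 hl (mulf_neq0 s0 t0)) (theta_series l0 hl (mulf_neq0 s0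
    (invr_neq0 t0))).
  move=> /cvB /(_ (ser_prod s0 t0)); rewrite subr0.
  have -> : l * th (s * t) * (l * th (s / t)) = l ^+ 2 * (th (s * t) *
    th (s / t)) by ring.
  by apply: eq_cv; near=> N; rewrite /G; ring.
have h1 := cvB (cvM (hG _ _ x0 y0) (hG _ _ u0 v0)) (cvM (hG _ _ x0 v0) (hG _ _ u0 y0)).
have h2 := cvM (cvM (cv_cst (u / y)) (hG _ _ x0 u0)) (hG _ _ y0 v0).
have E := cv_unique h1 (eq_cv _ h2).
have l40 : l ^+ 2 * l ^+ 2 != 0 by rewrite mulf_neq0 // expf_neq0.
apply: (mulfI l40); transitivity (u / y * (l ^+ 2 * (th (x * u) * th (x / u))) *
   (l ^+ 2 * (th (y * v) * th (y / v)))); last by ring.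
rewrite -E; first by ring.
near=> N; rewrite /G; field.
by rewrite y0.
Unshelve. all: by end_near. Qed.

Hypothesis sqrt_ex : forall x : C, exists y, y ^+ 2 = x.

(** With [s^2 = k] the substitution of [x / s] for [x] and [al s] for [al] turns [bctheta] into the
    symmetric form [th (X Y) th (X / Y)] of [theta_addition]. *)
Lemma theta_bc_addition k al be x h :
  k != 0 -> al != 0 -> be != 0 -> x != 0 -> h != 0 ->
  th (x * al) * th (k * al / x) * (th (h * be) * th (k * be / h))
  - th (h * al) * th (k * al / h) * (th (x * be) * th (k * be / x)) =
  - (be * h * (th (al * be * k) * th (al / be))) * (th (x * h^-1) * th (k * h^-1 / x)).
Proof.
move=> k0 al0 be0 x0 h0; have [s s2] := sqrt_ex k.
have s0 : s != 0 by apply: contra_neq k0 => s0; rewrite -s2 s0 expr0n.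
have E1 c t : c != 0 -> t != 0 -> th (t * c) * th (k * c / t) = th (c * s * (t / s)) *
  th (c * s / (t / s)).
  by move=> c0 t0; congr (th _ * th _); rewrite -?s2; field; rewrite ?s0 ?t0.
rewrite !E1 ?invr_neq0 // theta_addition ?mulf_neq0 ?invr_neq0 //.
have -> : al * s * (be * s) = al * be * k by rewrite -s2; ring.
have -> : al * s / (be * s) = al / be by field; rewrite be0 s0.
have -> : h^-1 * s * (x / s) = x / s / (h / s) by field; rewrite h0 s0.
have -> : h^-1 * s / (x / s) = (x / s * (h / s))^-1 by field; rewrite h0 s0 x0.
rewrite thetaV; last by rewrite !mulf_neq0 ?invr_neq0.
by field; rewrite h0 s0 x0.
Qed.

End Theta.
End NormedField.

(** * The complex numbers as an instance *)

Section ComplexInstance.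

Set Implicit Arguments.
Unset Strict Implicit.
Import Order.TTheory GRing.Theory Num.Theory numFieldNormedType.Exports.
Local Open Scope classical_set_scope.
Local Open Scope complex_scope.

Lemma lim_numField (C : numFieldType) (u : nat -> C) (l : C) :
  (forall e : C, 0 < e -> exists N, forall n, (N <= n)%N -> `|l - u n| < e) ->
  lim (u @ \oo) = l.
Proof.
move=> H; suff h : u @ \oo --> l by exact: (cvg_lim (@norm_hausdorff C C) h).
apply/cvgrPdist_lt => e e0.
by have [N hN] := H e e0; exists N => // n; exact: hN.
Qed.

Lemma geo_cauchy_cvg (R : realType) (u : nat -> R) (A r : R) : 0 <= r < 1 ->
  (forall n, `|u n.+1 - u n| <= A * r ^+ n) -> cvgn u.
Proof.
move=> /andP[r0 r1] hu.
have A0 : 0 <= A by have := hu 0%N; rewrite expr0 mulr1; apply: le_trans;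
  exact: normr_ge0.
have : cvgn (series (telescope u)).
  apply: normed_cvg; apply: (series_le_cvg (v_ := geometric A r)) => [n|n|n|] /=.
  - exact: normr_ge0.
  - by rewrite /geometric /= mulr_ge0 ?exprn_ge0.
  - exact: hu.
  - by apply: is_cvg_geometric_series; rewrite ger0_norm.
move=> /cvg_ex[l hl]; apply/cvg_ex; exists (u 0%N + l).
have : (fun n => u 0%N + series (telescope u) n) @ \oo --> u 0%N + l.
  by apply: cvgD => //; exact: cvg_cst.
by under eq_fun => n do rewrite -eq_sum_telescope.
Qed.

Variable R : realType.
Local Notation nm := (@ComplexField.Normc.normc R).

Lemma normc_Re_Im (x : R[i]) : [/\ `|complex.Re x| <= nm x, `|complex.Im x| <= nm x &
  nm x <= `|complex.Re x| + `|complex.Im x|].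
Proof.
case: x => a b /=; split.
- by rewrite -sqrtr_sqr ler_wsqrtr // lerDl sqr_ge0.
- by rewrite -sqrtr_sqr ler_wsqrtr // lerDr sqr_ge0.
- rewrite -[leRHS]ger0_norm ?addr_ge0 // -sqrtr_sqr ler_wsqrtr //.
  by rewrite sqrrD !real_normK ?num_real // -addrA [_ *+ 2 +
    _]addrC addrA lerDl mulrn_wge0 // mulr_ge0.
Qed.

Lemma normc_complete (u : nat -> R[i]) (A r : R) : 0 <= r < 1 ->
  (forall n, nm (u n.+1 - u n) <= A * r ^+ n) -> exists l, cv nm u l.
Proof.
move=> r01 hu.
have hRe n : `|complex.Re (u n.+1) - complex.Re (u n)| <= A * r ^+ n.
  apply: le_trans (hu n); have [+ _ _] := normc_Re_Im (u n.+1 - u n).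
  by case: (u n.+1) => ? ?; case: (u n).
have hIm n : `|complex.Im (u n.+1) - complex.Im (u n)| <= A * r ^+ n.
  apply: le_trans (hu n); have [_ + _] := normc_Re_Im (u n.+1 - u n).
  by case: (u n.+1) => ? ?; case: (u n).
have /cvg_ex[a ha] := geo_cauchy_cvg r01 hRe; have /cvg_ex[b hb] := geo_cauchy_cvg r01
  hIm.
exists (a +i* b); rewrite /cv.
apply: (@squeeze_cvgr _ _ _ _ (fun=> 0)
  (fun n => `|complex.Re (u n) - a| + `|complex.Im (u n) - b|)).
- near=> n; apply/andP; split; first by case: (_ - _) => ? ? /=; exact: sqrtr_ge0.
  have [_ _] := normc_Re_Im (u n - (a +i* b)).
  by case: (u n).
- exact: cvg_cst.
- have h1 : (fun n => `|complex.Re (u n) - a|) @ \oo --> `|a - a|.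
    by apply: cvg_norm; apply: cvgB ha _; exact: cvg_cst.
  have h2 : (fun n => `|complex.Im (u n) - b|) @ \oo --> `|b - b|.
    by apply: cvg_norm; apply: cvgB hb _; exact: cvg_cst.
  by have := cvgD h1 h2; rewrite !subrr normr0 addr0; exact.
Unshelve. all: by end_near. Qed.

Lemma cv_lim (u : nat -> R[i]) (l : R[i]) : cv nm u l ->
  lim ((u : nat -> (R[i] : numFieldType)) @ \oo) = l.
Proof.
(* In the order of [R[i]], [0 < e] forces the imaginary part of [e] to vanish, so [e] is a positive
   real. *)
move=> h; apply: lim_numField => e; rewrite ltcE => /andP[/eqP /= e1 e0].
have [N _ hN] : \forall n \near \oo, nm (u n - l) < complex.Re e.
  by move: h => /cvgr_lt; apply.
exists N => n Nn; have := hN n Nn => /= hn.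
rewrite normc_def ltcE /= -e1 eqxx /= -(sqrrN (complex.Re _)) -(sqrrN (complex.Im _)).
by move: hn; case: (u n) => x y; case: l {h hN} => x' y' /=; rewrite !opprB.
Qed.

Lemma normc_lt1 (p : R[i]) : `|p| < 1 -> nm p < 1.
Proof. by rewrite normc_def ltcE /= => /andP[_]; case: p. Qed.

End ComplexInstance.

(** * Sequences tending to 1 that avoid a countable group *)

Section GenericSequence.

Set Implicit Arguments.
Unset Strict Implicit.
Import Order.TTheory GRing.Theory Num.Theory numFieldNormedType.Exports.
Local Open Scope classical_set_scope.
Local Open Scope complex_scope.

(** Words in the generators and their inverses form a countable type; their values are the
    multiplicative group generated by [gen]. *)
Definition word_val (C : fieldType) (gen : nat -> C) (w : seq (nat * bool)) : C :=
  \prod_(a <- w) (if a.2 then (gen a.1)^-1 else gen a.1).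

Variable R : realType.

Lemma not_countable_itv (e : R) (B : set R) : 0 < e -> countable B ->
  exists2 x, 1 < x < 1 + e & ~ B x.
Proof.
move=> e0 cB; apply: contrapT => H.
have sub : [set` `]1, 1 + e[%R] `<=` B.
  move=> x /=; rewrite in_itv /= => x1; apply: contrapT => Bx; apply: H; by exists x.
have cI : countable [set` `]1, 1 + e[%R] by apply: sub_countable cB;
  exact: subset_card_le.
have := countable_lebesgue_measure0 cI; rewrite lebesgue_measure_itv /= lte_fin ltrDl e0.
by rewrite -EFinB [in X in X%:E]addrC addKr => -[] e00; rewrite e00 ltxx in e0.
Qed.

(** The [t N] are chosen real and above 1: for each word and each exponent at most one positive real
    has that power, so the values to avoid are countable. *)
Lemma generic_seq (gen : nat -> R[i]) : exists t : nat -> R[i],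
  cv (@ComplexField.Normc.normc R) t 1 /\
  forall N, t N != 0 /\ forall k w, t N ^+ k.+1 != word_val gen w.
Proof.
pose B := \bigcup_(a in [set: seq (nat * bool) * nat])
  [set x : R | 0 < x /\ x%:C ^+ a.2.+1 = word_val gen a.1].
have cB : countable B.
  apply: bigcup_countable; first exact: countableP.
  move=> [w k] _ /=; set S := (X in countable X).
  have [[x Sx]|S0] := pselect (exists x, S x).
    apply: (@sub_countable _ _ _ [set x]); last exact: countable1.
    apply: subset_card_le => y [y0 hy] /=; case: Sx => x0 hx.
    move: hy; rewrite -hx -!rmorphXn => /complexI /eqP.
    by rewrite eqrXn2 ?ltW // => /eqP.
  rewrite (_ : S = set0); first exact: countable0.
  by apply/seteqP; split => // x Sx; apply: S0; exists x.
have ex N : exists x, 1 < x < 1 + (N.+1%:R)^-1 /\ ~ B x.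
  have [|x x1 Bx] := @not_countable_itv (N.+1%:R)^-1 B _ cB; last by exists x.
  by rewrite invr_gt0 ltr0n.
have [x hx] := choice ex; exists (fun N => (x N)%:C).
have x1 N : 1 < x N by case: (hx N) => /andP[].
split.
  rewrite /cv; apply: (@squeeze_cvgr _ _ _ _ (fun=> 0) (fun N => (N.+1%:R)^-1)).
  - near=> N; apply/andP; split; first by case: (_ - _) => ? ? /=; exact: sqrtr_ge0.
    rewrite -[1]/(1%:C) -rmorphB /= expr0n addr0 sqrtr_sqr ger0_norm ?subr_ge0 ?ltW //.
    by case: (hx N) => /andP[_]; rewrite ltrBlDl.
  - exact: cvg_cst.
  - exact: cvg_harmonic.
move=> N; split; first by rewrite eq_complex /= gt_eqF // (lt_trans ltr01).
move=> k w; apply/eqP => E; case: (hx N) => _; apply; exists (w, k) => //.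
by split => //; exact: lt_trans (x1 N).
Unshelve. all: by end_near. Qed.

End GenericSequence.

(** * Analytic continuation in the parameters *)

Section Continuation.

Set Implicit Arguments.
Unset Strict Implicit.

Import Order.TTheory GRing.Theory Num.Theory numFieldNormedType.Exports.
Local Open Scope classical_set_scope.

Variables (R : realType) (C : numFieldType) (nm : C -> R).
Hypothesis nmM : forall x y, nm (x * y) = nm x * nm y.
Hypothesis nmD : forall x y, nm (x + y) <= nm x + nm y.
Hypothesis nmN : forall x, nm (- x) = nm x.
Hypothesis nm1 : nm 1 = 1.
Hypothesis nm0 : nm 0 = 0.
Hypothesis nm_eq0 : forall x, nm x = 0 -> x = 0.

Variables (p q : C) (n : nat) (m : 'I_n -> nat) (z : 'I_n -> C).

Definition left_side (a b c d e f g : C) : C :=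
  boxsum m (fun y =>
    Delta p (qshift q z y) / Delta p z
    * (\prod_(k < n) (theta p (a * z k * q ^+ (y k + wt y))
                      / theta p (a * z k)))
    * (\prod_(j < n) (epoch p q [:: a * z j] (wt y)
                      / epoch p q [:: q ^+ (1 + m j) * a * z j] (wt y)))
    * (epoch p q [:: b; c; d] (wt y)
       / epoch p q [:: a * q / e; a * q / f; a * q / g] (wt y))
    * q ^+ wt y
    * (\prod_(j < n) \prod_(k < n)
         (epoch p q [:: q ^ (- (m j)%:Z) * z k / z j] (y k)
          / epoch p q [:: q * z k / z j] (y k)))
    * (\prod_(k < n)
         (epoch p q [:: e * z k; f * z k; g * z k] (y k)
          / epoch p q [:: a * q * z k / b; a * q * z k / c;
                          a * q * z k / d] (y k)))).

Definition right_side (a b c d e f g : C) : C :=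
  g ^+ wt m
  * q ^ (- ((\sum_(j < n) \sum_(k < n | (j < k)%N) m j * m k)%N)%:Z)
  * (epoch p q [:: b; a * q / (c * g); a * q / (d * g)] (wt m)
     / epoch p q [:: a * q / e; a * q / f; a * q / g] (wt m))
  * (\prod_(k < n)
       (z k ^+ m k
        * epoch p q [:: a * q * z k;
            q ^ (1 + (wt m)%:Z - (m k)%:Z) * a / (z k * e * g);
            q ^ (1 + (wt m)%:Z - (m k)%:Z) * a / (z k * f * g)] (m k)
        / epoch p q [:: a * q * z k / c; a * q * z k / d;
            q ^ ((wt m)%:Z - (m k)%:Z) * b / (g * z k)] (m k)))
  * boxsum m (fun y =>
      Delta p (qshift q z y) / Delta p z
      * (\prod_(k < n)
           (theta p (g * z k * q ^ ((y k)%:Z + (wt y)%:Z - (wt m)%:Z) / b)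
            / theta p (g * z k * q ^ (- (wt m)%:Z) / b)))
      * (\prod_(j < n)
           (epoch p q [:: g * z j * q ^ (- (wt m)%:Z) / b] (wt y)
            / epoch p q [:: g * z j * q ^ ((m j)%:Z + 1 - (wt m)%:Z) / b]
                (wt y)))
      * (epoch p q [:: q ^ (- (wt m)%:Z) * g / a; a * q / (b * e);
                       a * q / (b * f)] (wt y)
         / epoch p q [:: q ^ (- (wt m)%:Z) * c * g / a;
                         q ^ (- (wt m)%:Z) * d * g / a;
                         q ^ (1 - (wt m)%:Z) / b] (wt y))
      * q ^+ wt y
      * (\prod_(j < n) \prod_(k < n)
           (epoch p q [:: q ^ (- (m j)%:Z) * z k / z j] (y k)
            / epoch p q [:: q * z k / z j] (y k)))
      * (\prod_(k < n)
           (epoch p q [:: a * q * z k / (b * c); a * q * z k / (b * d);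
                          g * z k] (y k)
            / epoch p q [:: a * q * z k / b;
                            q ^ (- (wt m)%:Z) * e * g * z k / a;
                            q ^ (- (wt m)%:Z) * f * g * z k / a] (y k)))).

Hypothesis q0 : q != 0.
Hypothesis thV : forall x, x != 0 -> theta p x^-1 = - (theta p x / x).
Hypothesis th_add : forall k al be x h,
  k != 0 -> al != 0 -> be != 0 -> x != 0 -> h != 0 ->
  bctheta (theta p) k al x * bctheta (theta p) k be h
  - bctheta (theta p) k al h * bctheta (theta p) k be x =
  - (be * h * (theta p (al * be * k) * theta p (al / be))) * bctheta (theta p) k h^-1 x.
Hypothesis th1 : theta p 1 = 0.

Hypothesis z0 : forall k, z k != 0.

Let epoch1 u k : epoch p q [:: u] k = poch (theta p) q u k.
Proof. by rewrite /epoch big_seq1. Qed.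

Let epoch3 u v w k : epoch p q [:: u; v; w] k =
  poch (theta p) q u k * poch (theta p) q v k * poch (theta p) q w k.
Proof. by rewrite /epoch !big_cons big_nil mulr1 mulrA. Qed.

Let qN k : q ^ (- k%:Z) = (q ^+ k)^-1.
Proof. by rewrite -exprnN. Qed.

Let mul_congr (x x' y y' : C) : x = x' -> y = y' -> x * y = x' * y'.
Proof. by move=> -> ->. Qed.

(** * The identity for generic parameters *)

Section Generic.

Variables (a b c d e f g : C).
Hypotheses (a0 : a != 0) (b0 : b != 0) (c0 : c != 0) (d0 : d != 0).
Hypotheses (e0 : e != 0) (f0 : f != 0) (g0 : g != 0).

Let qk0 k : q ^+ k != 0. Proof. by rewrite expf_neq0. Qed.

Lemma left_sideE : left_side a b c d e f g =
  bsum (wt m) m (term (theta p) q z a [:: b; c; d] m [:: e; f; g]).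
Proof.
apply: eq_bigr => y0 _; set y := fun k => _; rewrite term3E !epoch3.
refine (mul_congr (mul_congr (mul_congr (mul_congr (mul_congr erefl _) erefl) erefl) _)
  _).
- by apply: eq_bigr => j _; rewrite !epoch1; congr (_ / poch _ _ _ _);
     rewrite /node add1n exprS; field; rewrite ?z0 ?qk0 ?oner_neq0.
- apply: eq_bigr => j _; apply: eq_bigr => k _; rewrite !epoch1 qN /node.
  by congr (poch _ _ _ _ / _); ring.
- by apply: eq_bigr => k _; rewrite !epoch3.
Qed.

Lemma right_sideE : right_side a b c d e f g =
  g ^+ wt m / q ^+ (\sum_(j < n) \sum_(k < n | (j < k)%N) m j * m k)%N *
  (poch (theta p) q b (wt m) * poch (theta p) q (a * q / (c * g)) (wt m) *
    poch (theta p) q (a * q / (d * g)) (wt m) /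
   (poch (theta p) q (a * q / e) (wt m) * poch (theta p) q (a * q / f) (wt m) *
     poch (theta p) q (a * q / g) (wt m))) *
  \prod_(k < n) (z k ^+ m k *
    (poch (theta p) q (a * q * z k) (m k) * poch (theta p) q (q ^+ (wt m).+1 / q ^+ m k
      * a / (z k * e * g)) (m k) *
     poch (theta p) q (q ^+ (wt m).+1 / q ^+ m k * a / (z k * f * g)) (m k)) /
    (poch (theta p) q (a * q * z k / c) (m k) * poch (theta p) q (a * q * z k / d) (m k) *
     poch (theta p) q (q ^+ wt m / q ^+ m k * b / (g * z k)) (m k))) *
  bsum (wt m) m (term (theta p) q z (g / (q ^+ wt m * b))
    [:: g / (q ^+ wt m * a); a * q / (b * e); a * q / (b * f)] m
    [:: a * q / (b * c); a * q / (b * d); g]).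
Proof.
have qM := qk0 (wt m).
have q1M k : q ^ (1 + (wt m)%:Z - (m k)%:Z) = q ^+ (wt m).+1 / q ^+ m k.
  by rewrite expfzDr // qN -intS.
have q2M k : q ^ ((wt m)%:Z - (m k)%:Z) = q ^+ wt m / q ^+ m k.
  by rewrite expfzDr // qN.
rewrite /right_side !epoch3 qN; congr (_ * _ * _ * _).
  by apply: eq_bigr => k _; rewrite !epoch3 q1M q2M.
apply: eq_bigr => y0 _; set y := fun k => _; rewrite term3E !epoch3 qN.
have q3 : q ^ (1 - (wt m)%:Z) = q / q ^+ wt m by rewrite expfzDr // qN.
refine (mul_congr (mul_congr (mul_congr (mul_congr (mul_congr (mul_congr erefl _) _) _)
  erefl) _) _).
- apply: eq_bigr => k _; congr (theta p _ / theta p _).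
    rewrite !expfzDr // qN -!exprnP exprD; field.
    by rewrite ?b0 ?qM.
  by field; rewrite ?b0 ?qM.
- apply: eq_bigr => j _; rewrite !epoch1; congr (poch _ _ _ _ / poch _ _ _ _).
    by field; rewrite ?b0 ?qM.
  rewrite !expfzDr // qN -exprnP expr1z /node; field.
  by rewrite ?z0 ?b0 ?qM ?qk0 ?oner_neq0.
- rewrite q3; congr (poch _ _ _ _ * _ * _ / (poch _ _ _ _ * poch _ _ _ _ * poch _ _ _ _)).
  + by field; rewrite ?a0 ?qM.
  + by field; rewrite ?a0 ?b0 ?c0 ?q0 ?qM.
  + by field; rewrite ?a0 ?b0 ?d0 ?q0 ?qM.
  + by field; rewrite ?b0 ?g0 ?qM.
- apply: eq_bigr => j _; apply: eq_bigr => k _; rewrite !epoch1 qN /node.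
  by congr (poch _ _ _ _ / _); ring.
- apply: eq_bigr => k _; rewrite !epoch3.
  congr (poch _ _ _ _ * poch _ _ _ _ * _ / (poch _ _ _ _ * poch _ _ _ _ * poch _ _ _ _)).
  + by ring.
  + by ring.
  + by field; rewrite ?a0 ?b0 ?g0 ?qM.
  + by field; rewrite ?a0 ?b0 ?e0 ?q0 ?qM.
  + by field; rewrite ?a0 ?b0 ?f0 ?q0 ?qM.
Qed.

Let lam := a ^+ 2 * q / (b * c * e).

Lemma generic_identity :
  a ^+ 3 * q ^+ (wt m + 2) = b * c * d * e * f * g ->
  zgood (theta p) q z m ->
  bailey_generic (theta p) q z a b c d e lam g f ->
  bailey_generic (theta p) q z lam (lam * b / a) d (lam * c / a) f
    (g / (q ^+ wt m * b)) g (lam * e / a) ->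
  left_side a b c d e f g = right_side a b c d e f g.
Proof.
move=> bal zg gen1 gen2; rewrite left_sideE right_sideE.
have mN k : (m k <= wt m)%N by rewrite /wt (bigD1 k) //= leq_addr.
rewrite (double_bailey q0 thV th_add th1 z0 a0 b0 c0 d0 e0 f0 g0 bal zg mN gen1 gen2).
congr (_ * _); exact: (double_bailey_factor q0 thV z0 a0 b0 c0 d0 e0 f0 g0 bal gen1 gen2).
Qed.

End Generic.

(** * Denominators as theta functions of monomials in [t] *)

Section Perturbation.

Variables (gen : nat -> C) (t : C).
Hypothesis t0 : t != 0.
Hypothesis t_gen : forall k w, t ^+ k.+1 != word_val gen w.
Hypothesis th_zero : forall x, x != 0 -> theta p x = 0 ->
  exists j : nat, p ^+ j * x = 1 \/ p ^+ j.+1 = x.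

Definition spanned x := exists w, word_val gen w = x.

Lemma spanned_gen i : spanned (gen i).
Proof. by exists [:: (i, false)]; rewrite /word_val big_seq1. Qed.

Lemma spannedM x y : spanned x -> spanned y -> spanned (x * y).
Proof. by move=> [w <-] [w' <-]; exists (w ++ w'); rewrite /word_val big_cat. Qed.

Lemma spannedV x : spanned x -> spanned x^-1.
Proof.
move=> [w <-]; exists [seq (a.1, ~~ a.2) | a <- w].
rewrite /word_val big_map -prodfV; apply: eq_bigr => -[i []] _ //=.
by rewrite invrK.
Qed.

Lemma spanned1 : spanned 1.
Proof. by exists [::]; rewrite /word_val big_nil. Qed.

Lemma spannedX x k : spanned x -> spanned (x ^+ k).
Proof. by move=> sx; elim: k => [|k IH]; [exact: spanned1|rewrite exprS;
  exact: spannedM]. Qed.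

Hypotheses (sp : spanned p) (sq : spanned q).

Let sqz (s : int) : spanned (q ^ s).
Proof.
by case: s => k; rewrite ?NegzE -?exprnP -?exprnN; [|apply: spannedV]; exact: spannedX.
Qed.

(** The zeros of theta are powers of [p], so a zero on the orbit would make [t^(k+1)] the value of a
    word. *)
Lemma good_spanned mu k : mu != 0 -> spanned mu -> good (theta p) q (mu * t ^+ k.+1).
Proof.
move=> mu0 smu s; apply/eqP => E.
have x0 : mu * t ^+ k.+1 * q ^ s != 0 by rewrite !mulf_neq0 ?expf_neq0 ?expfz_neq0.
have qs0 : q ^ s != 0 by rewrite expfz_neq0.
have [j [Ej|Ej]] := th_zero x0 E.
  have pj0 : p ^+ j != 0 by apply: contra_eq_neq Ej => ->; rewrite mul0r eq_sym oner_neq0.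
  have [w Ew] : spanned (p ^+ j * mu * q ^ s)^-1.
    by apply/spannedV/spannedM; [apply: spannedM => //; exact: spannedX|exact: sqz].
  have /eqP := t_gen k w; apply; rewrite Ew.
  have X0 : p ^+ j * mu * q ^ s != 0 by rewrite !mulf_neq0.
  by apply: (mulfI X0); rewrite mulfV // -Ej; ring.
have [w Ew] : spanned (p ^+ j.+1 / (mu * q ^ s)).
  by apply: spannedM; [exact: spannedX|apply/spannedV/spannedM].
have /eqP := t_gen k w; apply; rewrite Ew Ej.
by field; rewrite qs0 mu0.
Qed.

Definition homog (i : int) x := exists mu, [/\ mu != 0, spanned mu & x = mu * t ^ i].

Lemma homogM i j x y : homog i x -> homog j y -> homog (i + j) (x * y).
Proof.
move=> [mu [m0 sm ->]] [nu [n0 sn ->]]; exists (mu * nu); split;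
  [exact: mulf_neq0|exact: spannedM|].
by rewrite expfzDr //; ring.
Qed.

Lemma homogV i x : homog i x -> homog (- i) x^-1.
Proof.
move=> [mu [m0 sm ->]]; exists mu^-1; split; [by rewrite invr_eq0|exact: spannedV|].
by rewrite invfM invr_expz.
Qed.

Lemma homogX i x k : homog i x -> homog (i *+ k) (x ^+ k).
Proof.
move=> h; elim: k => [|k IH]; last by rewrite exprS mulrS; exact: homogM.
by exists 1; split; [exact: oner_neq0|exact: spanned1|rewrite expr0z mulr1].
Qed.

Lemma homog0 x : x != 0 -> spanned x -> homog 0 x.
Proof. by move=> x0 sx; exists x; rewrite expr0z mulr1. Qed.

Lemma homogT x k : x != 0 -> spanned x -> homog k%:Z (x * t ^+ k).
Proof. by move=> x0 sx; exists x. Qed.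

Lemma homog_good i x : homog i x -> i != 0 -> good (theta p) q x.
Proof.
move=> [mu [m0 sm ->]]; case: i => [[//|k]|k] _; first exact: good_spanned.
rewrite NegzE -exprnN -[mu]invrK -invfM; apply: (goodV q0 thV).
  by rewrite mulf_neq0 ?invr_eq0 ?expf_neq0.
by apply: good_spanned; [rewrite invr_eq0|exact: spannedV].
Qed.

Hypothesis sz : forall k, spanned (z k).

(* With the degrees 4, 1, 1, 1, 1, 1, 7 the balancing condition is homogeneous and
   no denominator of the two Bailey transformations has degree 0. *)
Lemma homog_identity a b c d e f g :
  a != 0 -> b != 0 -> c != 0 -> d != 0 -> e != 0 -> f != 0 -> g != 0 ->
  homog 4 a -> homog 1 b -> homog 1 c -> homog 1 d -> homog 1 e -> homog 1 f -> homog 7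
    g ->
  a ^+ 3 * q ^+ (wt m + 2) = b * c * d * e * f * g -> zgood (theta p) q z m ->
  left_side a b c d e f g = right_side a b c d e f g.
Proof.
move=> a0 b0 c0 d0 e0 f0 g0 ha hb hc hd he hf hg bal zg.
have hq := homog0 q0 sq.
have hqM : homog 0 (q ^+ wt m) by apply: homog0; [rewrite expf_neq0|exact: spannedX].
have hz k := homog0 (z0 k) (sz k).
(* The lemmas on [homog] compute the degree of each monomial, and the last [by []] checks that it is
   nonzero. [hqM] gives [q^|m|] the literal degree 0 in place of [0 *+ wt m]. *)
apply: generic_identity => //; split; intros; (apply: homog_good;
  [repeat first [exact: ha|exact: hb|exact: hc|exact: hd|exact: he|exact: hf|exact: hg
     |exact: hqM|exact: hq|exact: hz|apply: homogM|apply: homogV|apply: homogX]|by []]).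
Qed.

End Perturbation.

(** * Continuity of both sides in the parameters *)

Section Limit.

Hypothesis theta_cv : forall u x, x != 0 -> cv nm u x -> cv nm (fun N =>
  theta p (u N)) (theta p x).

Let cC x : cv nm (fun=> x) x. Proof. exact: cv_cst. Qed.
Let cM u v x y : cv nm u x -> cv nm v y -> cv nm (fun N => u N * v N) (x * y).
Proof. exact: cvM. Qed.
Let cdiv u v x y : y != 0 -> cv nm u x -> cv nm v y -> cv nm (fun N => u N / v N) (x / y).
Proof. exact: cv_div. Qed.
Let cX u x k : cv nm u x -> cv nm (fun N => u N ^+ k) (x ^+ k).
Proof. exact: cvX. Qed.
Let cprod (I : Type) (r : seq I) (P : pred I) (F : I -> nat -> C) (l : I -> C) :
  (forall i, P i -> cv nm (F i) (l i)) ->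
  cv nm (fun N => \prod_(i <- r | P i) F i N) (\prod_(i <- r | P i) l i).
Proof. exact: cv_prod. Qed.
Let csum (I : Type) (r : seq I) (P : pred I) (F : I -> nat -> C) (l : I -> C) :
  (forall i, P i -> cv nm (F i) (l i)) ->
  cv nm (fun N => \sum_(i <- r | P i) F i N) (\sum_(i <- r | P i) l i).
Proof. exact: cv_sum. Qed.

Let cpoch u x k : x != 0 -> cv nm u x ->
  cv nm (fun N => poch (theta p) q (u N) k) (poch (theta p) q x k).
Proof.
move=> x0 ux; apply: cprod => i _; apply: theta_cv; first by rewrite mulf_neq0 ?expf_neq0.
exact: cM.
Qed.

Let cepoch1 u x k : x != 0 -> cv nm u x ->
  cv nm (fun N => epoch p q [:: u N] k) (epoch p q [:: x] k).
Proof. by move=> x0 ux; under eq_fun => N do rewrite epoch1; rewrite epoch1;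
  exact: cpoch. Qed.

Let cepoch3 u v w x y s k : x != 0 -> y != 0 -> s != 0 ->
  cv nm u x -> cv nm v y -> cv nm w s ->
  cv nm (fun N => epoch p q [:: u N; v N; w N] k) (epoch p q [:: x; y; s] k).
Proof.
move=> x0 y0 s0 ux vy ws; under eq_fun => N do rewrite epoch3; rewrite epoch3.
by apply: cM; [apply: cM|]; exact: cpoch.
Qed.

Variables (a b c d e f g : C).
Hypotheses (a0 : a != 0) (b0 : b != 0) (c0 : c != 0) (d0 : d != 0).
Hypotheses (e0 : e != 0) (f0 : f != 0) (g0 : g != 0).
Variables (a_ b_ c_ d_ e_ f_ g_ : nat -> C).
Hypotheses (ca : cv nm a_ a) (cb : cv nm b_ b) (cc : cv nm c_ c) (cd : cv nm d_ d).
Hypotheses (ce : cv nm e_ e) (cf : cv nm f_ f) (cg : cv nm g_ g).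

Ltac nonzero :=
  lazymatch goal with
  | |- is_true (_ * _ != 0) => apply: mulf_neq0; nonzero
  | |- is_true (_^-1 != 0) => apply: invr_neq0; nonzero
  | |- is_true (_ ^+ _ != 0) => apply: expf_neq0; nonzero
  | |- is_true (_ ^ _ != 0) => apply: expfz_neq0; nonzero
  | _ => done
  end.

Ltac limit :=
  lazymatch goal with
  | |- cv _ _ (_ / _) => refine (cdiv _ _ _); [nonzero|limit|limit]
  | |- cv _ _ (_ * _) => refine (cM _ _); limit
  | |- cv _ _ (_ ^+ _) => refine (cX _ _); limit
  | |- cv _ _ (theta _ _) => refine (theta_cv _ _); [nonzero|limit]
  | |- cv _ _ (epoch _ _ [:: _] _) => refine (cepoch1 _ _ _); [nonzero|limit]
  | |- cv _ _ (epoch _ _ [:: _; _; _] _) =>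
      refine (cepoch3 _ _ _ _ _ _ _); [nonzero|nonzero|nonzero|limit|limit|limit]
  | _ => first [exact: ca|exact: cb|exact: cc|exact: cd|exact: ce|exact: cf|exact:
    cg|exact: cC]
  end.

Lemma left_side_cv
    (den_l1 : forall k, theta p (a * z k) != 0)
    (den_l2 : forall y : 'I_n -> nat, (forall k, (y k <= m k)%N) ->
       forall j, epoch p q [:: q ^+ (1 + m j) * a * z j] (wt y) != 0)
    (den_l3 : forall y : 'I_n -> nat, (forall k, (y k <= m k)%N) ->
       epoch p q [:: a * q / e; a * q / f; a * q / g] (wt y) != 0)
    (den_l4 : forall y : 'I_n -> nat, (forall k, (y k <= m k)%N) ->
       forall k, epoch p q [:: a * q * z k / b; a * q * z k / c;
                               a * q * z k / d] (y k) != 0) :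
  cv nm (fun N => left_side (a_ N) (b_ N) (c_ N) (d_ N) (e_ N) (f_ N) (g_ N))
    (left_side a b c d e f g).
Proof.
apply: csum => y0 /forallP; set y := fun k => _ => ym.
refine (cM _ _); last first.
  by apply: cprod => k _; refine (cdiv _ _ _); [exact: (den_l4 _ ym k)| |]; limit.
(* Factors in [q] and [z] alone are constant sequences. *)
refine (cM _ _); last exact: cC.
refine (cM _ _); last exact: cC.
refine (cM _ _); last by refine (cdiv _ _ _); [exact: (den_l3 _ ym)| |]; limit.
refine (cM _ _); last by apply: cprod => j _; refine (cdiv _ _ _);
  [exact: (den_l2 _ ym j)| |]; limit.
refine (cM _ _); first exact: cC.
by apply: cprod => k _; refine (cdiv _ _ _); [exact: den_l1| |]; limit.
Qed.

Lemma right_side_cv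
    (den_p1 : epoch p q [:: a * q / e; a * q / f; a * q / g] (wt m) != 0)
    (den_p2 : forall k,
       epoch p q [:: a * q * z k / c; a * q * z k / d;
                     q ^ ((wt m)%:Z - (m k)%:Z) * b / (g * z k)] (m k) != 0)
    (den_r1 : forall k, theta p (g * z k * q ^ (- (wt m)%:Z) / b) != 0)
    (den_r2 : forall y : 'I_n -> nat, (forall k, (y k <= m k)%N) ->
       forall j, epoch p q
         [:: g * z j * q ^ ((m j)%:Z + 1 - (wt m)%:Z) / b] (wt y) != 0)
    (den_r3 : forall y : 'I_n -> nat, (forall k, (y k <= m k)%N) ->
       epoch p q [:: q ^ (- (wt m)%:Z) * c * g / a;
                     q ^ (- (wt m)%:Z) * d * g / a;
                     q ^ (1 - (wt m)%:Z) / b] (wt y) != 0)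
    (den_r4 : forall y : 'I_n -> nat, (forall k, (y k <= m k)%N) ->
       forall k, epoch p q [:: a * q * z k / b;
                               q ^ (- (wt m)%:Z) * e * g * z k / a;
                               q ^ (- (wt m)%:Z) * f * g * z k / a] (y k)
                 != 0) :
  cv nm (fun N => right_side (a_ N) (b_ N) (c_ N) (d_ N) (e_ N) (f_ N) (g_ N))
    (right_side a b c d e f g).
Proof.
refine (cM _ _).
  refine (cM _ _).
    refine (cM _ _); first by refine (cM _ _); [refine (cX _ _)|]; limit.
    by refine (cdiv _ _ _); [exact: den_p1| |]; limit.
  by apply: cprod => k _; refine (cdiv _ _ _); [exact: den_p2| |]; limit.
apply: csum => y0 /forallP; set y := fun k => _ => ym.
refine (cM _ _); last first.
  by apply: cprod => k _; refine (cdiv _ _ _); [exact: (den_r4 _ ym k)| |]; limit.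
refine (cM _ _); last exact: cC.
refine (cM _ _); last exact: cC.
refine (cM _ _); last by refine (cdiv _ _ _); [exact: (den_r3 _ ym)| |]; limit.
refine (cM _ _); last by apply: cprod => j _; refine (cdiv _ _ _);
  [exact: (den_r2 _ ym j)| |]; limit.
refine (cM _ _); first exact: cC.
by apply: cprod => k _; refine (cdiv _ _ _); [exact: den_r1| |]; limit.
Qed.

End Limit.

Lemma continued_identity
    (theta_cv : forall u x, x != 0 -> cv nm u x -> cv nm (fun N =>
      theta p (u N)) (theta p x))
    (th_zero : forall x, x != 0 -> theta p x = 0 ->
       exists j : nat, p ^+ j * x = 1 \/ p ^+ j.+1 = x)
    (generic_sequence : forall gen : nat -> C, exists t : nat -> C,
       cv nm t 1 /\ forall N, t N != 0 /\ forall k w, t N ^+ k.+1 != word_val gen w)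
    (a b c d e f g : C)
    (ha : a != 0) (hb : b != 0) (hc : c != 0) (hd : d != 0) (he : e != 0)
    (hf : f != 0) (hg : g != 0)
    (hbal : a ^+ 3 * q ^+ (wt m + 2) = b * c * d * e * f * g)
    (* denominators occurring in both sums *)
    (den_Delta : Delta p z != 0)
    (den_qzz : forall y : 'I_n -> nat, (forall k, (y k <= m k)%N) ->
       forall j k, epoch p q [:: q * z k / z j] (y k) != 0)
    (* denominators of the sum on the left *)
    (den_l1 : forall k, theta p (a * z k) != 0)
    (den_l2 : forall y : 'I_n -> nat, (forall k, (y k <= m k)%N) ->
       forall j, epoch p q [:: q ^+ (1 + m j) * a * z j] (wt y) != 0)
    (den_l3 : forall y : 'I_n -> nat, (forall k, (y k <= m k)%N) ->
       epoch p q [:: a * q / e; a * q / f; a * q / g] (wt y) != 0)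
    (den_l4 : forall y : 'I_n -> nat, (forall k, (y k <= m k)%N) ->
       forall k, epoch p q [:: a * q * z k / b; a * q * z k / c;
                               a * q * z k / d] (y k) != 0)
    (* denominators of the prefactor on the right *)
    (den_p1 : epoch p q [:: a * q / e; a * q / f; a * q / g] (wt m) != 0)
    (den_p2 : forall k,
       epoch p q [:: a * q * z k / c; a * q * z k / d;
                     q ^ ((wt m)%:Z - (m k)%:Z) * b / (g * z k)] (m k) != 0)
    (* denominators of the sum on the right *)
    (den_r1 : forall k, theta p (g * z k * q ^ (- (wt m)%:Z) / b) != 0)
    (den_r2 : forall y : 'I_n -> nat, (forall k, (y k <= m k)%N) ->
       forall j, epoch p q
         [:: g * z j * q ^ ((m j)%:Z + 1 - (wt m)%:Z) / b] (wt y) != 0)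
    (den_r3 : forall y : 'I_n -> nat, (forall k, (y k <= m k)%N) ->
       epoch p q [:: q ^ (- (wt m)%:Z) * c * g / a;
                     q ^ (- (wt m)%:Z) * d * g / a;
                     q ^ (1 - (wt m)%:Z) / b] (wt y) != 0)
    (den_r4 : forall y : 'I_n -> nat, (forall k, (y k <= m k)%N) ->
       forall k, epoch p q [:: a * q * z k / b;
                               q ^ (- (wt m)%:Z) * e * g * z k / a;
                               q ^ (- (wt m)%:Z) * f * g * z k / a] (y k)
                 != 0) :
  left_side a b c d e f g = right_side a b c d e f g.
Proof.
(* At [y = m] the product in [den_qzz] exhibits every [th (q^s z_k / z_j)] with [0 < s <= m_k], as
   its factor of index [s - 1]. *)
have zg : zgood (theta p) q z m.
  split=> [j k jk|j k s /andP[s0 sm]].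
    have /prodf_neq0 /(_ j isT) /prodf_neq0 /(_ k jk) := den_Delta.
    by rewrite mulf_eq0 negb_or => /andP[].
  have := den_qzz m (fun k => leqnn _) j k; rewrite epoch1 => /prodf_neq0.
  have lt : (s.-1 < m k)%N by rewrite prednK.
  move=> /(_ (Ordinal lt) isT) /=; apply: contra_neq => <-; congr (theta p _).
  by rewrite -[in RHS](prednK s0) exprS; ring.
(* The group to avoid is generated by all fixed data, including [p] because of the zeros of theta
   and [q] because of its orbits. *)
pose gens := [:: a; b; c; d; e; f; g; p; q] ++ [seq z k | k <- enum 'I_n].
have [t [t1 ht]] := generic_sequence (nth 0 gens).
have sp x : x \in gens -> spanned (nth 0 gens) x.
  by move=> xg; rewrite -(nth_index 0 xg); exact: spanned_gen.
have spz k : spanned (nth 0 gens) (z k).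
  by apply: sp; rewrite mem_cat map_f ?orbT // mem_enum.
have ct x k : cv nm (fun N => x * t N ^+ k) x.
  have := cvM nmM nmD nmN nm0 (cv_cst nm0 x) (cvX nmM nmD nmN nm0 k t1).
  by rewrite expr1n mulr1.
have EN N : left_side (a * t N ^+ 4) (b * t N ^+ 1) (c * t N ^+ 1) (d * t N ^+ 1)
      (e * t N ^+ 1) (f * t N ^+ 1) (g * t N ^+ 7) =
    right_side (a * t N ^+ 4) (b * t N ^+ 1) (c * t N ^+ 1) (d * t N ^+ 1)
      (e * t N ^+ 1) (f * t N ^+ 1) (g * t N ^+ 7).
  have [tN0 tg] := ht N.
  apply: (homog_identity tN0 tg th_zero) => //; rewrite ?mulf_neq0 ?expf_neq0 //;
    try by apply: homogT => //; apply: sp; rewrite !inE eqxx ?orbT.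
  - by apply: sp; rewrite !inE eqxx ?orbT.
  - by apply: sp; rewrite !inE eqxx ?orbT.
  - transitivity (a ^+ 3 * q ^+ (wt m + 2) * t N ^+ 12); first by ring.
    by rewrite hbal; ring.
have L := left_side_cv theta_cv ha hb hc hd he hf hg (ct a 4) (ct b 1) (ct c 1) (ct d 1)
  (ct e 1) (ct f 1) (ct g 7) den_l1 den_l2 den_l3 den_l4.
have Rt := right_side_cv theta_cv ha hb hc hd he hf hg (ct a 4) (ct b 1) (ct c 1) (ct d 1)
  (ct e 1) (ct f 1) (ct g 7) den_p1 den_p2 den_r1 den_r2 den_r3 den_r4.
apply: (cv_unique nmD nmN nm0 nm_eq0 L).
by have -> := funext EN.
Qed.

End Continuation.

Import Order.TTheory GRing.Theory Num.Theory.

Theorem corollary4p3 (R : realType) (p q : R[i]) (n : nat) (m : 'I_n -> nat)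
    (z : 'I_n -> R[i]) (a b c d e f g : R[i])
    (hp : `|p| < 1) (hq : q != 0) (hn : (1 <= n)%N)
    (hz : forall k, z k != 0)
    (ha : a != 0) (hb : b != 0) (hc : c != 0) (hd : d != 0) (he : e != 0)
    (hf : f != 0) (hg : g != 0)
    (hbal : a ^+ 3 * q ^+ (wt m + 2) = b * c * d * e * f * g)
    (* denominators occurring in both sums *)
    (den_Delta : Delta p z != 0)
    (den_qzz : forall y : 'I_n -> nat, (forall k, (y k <= m k)%N) ->
       forall j k, epoch p q [:: q * z k / z j] (y k) != 0)
    (* denominators of the sum on the left *)
    (den_l1 : forall k, theta p (a * z k) != 0)
    (den_l2 : forall y : 'I_n -> nat, (forall k, (y k <= m k)%N) ->
       forall j, epoch p q [:: q ^+ (1 + m j) * a * z j] (wt y) != 0)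
    (den_l3 : forall y : 'I_n -> nat, (forall k, (y k <= m k)%N) ->
       epoch p q [:: a * q / e; a * q / f; a * q / g] (wt y) != 0)
    (den_l4 : forall y : 'I_n -> nat, (forall k, (y k <= m k)%N) ->
       forall k, epoch p q [:: a * q * z k / b; a * q * z k / c;
                               a * q * z k / d] (y k) != 0)
    (* denominators of the prefactor on the right *)
    (den_p1 : epoch p q [:: a * q / e; a * q / f; a * q / g] (wt m) != 0)
    (den_p2 : forall k,
       epoch p q [:: a * q * z k / c; a * q * z k / d;
                     q ^ ((wt m)%:Z - (m k)%:Z) * b / (g * z k)] (m k) != 0)
    (* denominators of the sum on the right *)
    (den_r1 : forall k, theta p (g * z k * q ^ (- (wt m)%:Z) / b) != 0)
    (den_r2 : forall y : 'I_n -> nat, (forall k, (y k <= m k)%N) ->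
       forall j, epoch p q
         [:: g * z j * q ^ ((m j)%:Z + 1 - (wt m)%:Z) / b] (wt y) != 0)
    (den_r3 : forall y : 'I_n -> nat, (forall k, (y k <= m k)%N) ->
       epoch p q [:: q ^ (- (wt m)%:Z) * c * g / a;
                     q ^ (- (wt m)%:Z) * d * g / a;
                     q ^ (1 - (wt m)%:Z) / b] (wt y) != 0)
    (den_r4 : forall y : 'I_n -> nat, (forall k, (y k <= m k)%N) ->
       forall k, epoch p q [:: a * q * z k / b;
                               q ^ (- (wt m)%:Z) * e * g * z k / a;
                               q ^ (- (wt m)%:Z) * f * g * z k / a] (y k)
                 != 0) :
  boxsum m (fun y =>
    Delta p (qshift q z y) / Delta p z
    * (\prod_(k < n) (theta p (a * z k * q ^+ (y k + wt y))
                      / theta p (a * z k)))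
    * (\prod_(j < n) (epoch p q [:: a * z j] (wt y)
                      / epoch p q [:: q ^+ (1 + m j) * a * z j] (wt y)))
    * (epoch p q [:: b; c; d] (wt y)
       / epoch p q [:: a * q / e; a * q / f; a * q / g] (wt y))
    * q ^+ wt y
    * (\prod_(j < n) \prod_(k < n)
         (epoch p q [:: q ^ (- (m j)%:Z) * z k / z j] (y k)
          / epoch p q [:: q * z k / z j] (y k)))
    * (\prod_(k < n)
         (epoch p q [:: e * z k; f * z k; g * z k] (y k)
          / epoch p q [:: a * q * z k / b; a * q * z k / c;
                          a * q * z k / d] (y k))))
  =
  g ^+ wt m
  * q ^ (- ((\sum_(j < n) \sum_(k < n | (j < k)%N) m j * m k)%N)%:Z)
  * (epoch p q [:: b; a * q / (c * g); a * q / (d * g)] (wt m)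
     / epoch p q [:: a * q / e; a * q / f; a * q / g] (wt m))
  * (\prod_(k < n)
       (z k ^+ m k
        * epoch p q [:: a * q * z k;
            q ^ (1 + (wt m)%:Z - (m k)%:Z) * a / (z k * e * g);
            q ^ (1 + (wt m)%:Z - (m k)%:Z) * a / (z k * f * g)] (m k)
        / epoch p q [:: a * q * z k / c; a * q * z k / d;
            q ^ ((wt m)%:Z - (m k)%:Z) * b / (g * z k)] (m k)))
  * boxsum m (fun y =>
      Delta p (qshift q z y) / Delta p z
      * (\prod_(k < n)
           (theta p (g * z k * q ^ ((y k)%:Z + (wt y)%:Z - (wt m)%:Z) / b)
            / theta p (g * z k * q ^ (- (wt m)%:Z) / b)))
      * (\prod_(j < n)
           (epoch p q [:: g * z j * q ^ (- (wt m)%:Z) / b] (wt y)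
            / epoch p q [:: g * z j * q ^ ((m j)%:Z + 1 - (wt m)%:Z) / b]
                (wt y)))
      * (epoch p q [:: q ^ (- (wt m)%:Z) * g / a; a * q / (b * e);
                       a * q / (b * f)] (wt y)
         / epoch p q [:: q ^ (- (wt m)%:Z) * c * g / a;
                         q ^ (- (wt m)%:Z) * d * g / a;
                         q ^ (1 - (wt m)%:Z) / b] (wt y))
      * q ^+ wt y
      * (\prod_(j < n) \prod_(k < n)
           (epoch p q [:: q ^ (- (m j)%:Z) * z k / z j] (y k)
            / epoch p q [:: q * z k / z j] (y k)))
      * (\prod_(k < n)
           (epoch p q [:: a * q * z k / (b * c); a * q * z k / (b * d);
                          g * z k] (y k)
            / epoch p q [:: a * q * z k / b;
                            q ^ (- (wt m)%:Z) * e * g * z k / a;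
                            q ^ (- (wt m)%:Z) * f * g * z k / a] (y k)))).
Proof.
pose nm := @ComplexField.Normc.normc R.
have nmM x y : nm (x * y) = nm x * nm y by exact: ComplexField.Normc.normcM.
have nmD x y : nm (x + y) <= nm x + nm y by exact: le_normcD.
have nmN x : nm (- x) = nm x by exact: normcN.
have nm1 : nm 1 = 1 by exact: ComplexField.Normc.normc1.
have nm0 : nm 0 = 0 by exact: ComplexField.Normc.normc0.
have nm_eq0 x : nm x = 0 -> x = 0 by exact: ComplexField.Normc.eq0_normc.
have p1 : nm p < 1 by exact: normc_lt1.
(* The real-valued norm gives the convergence of the partial products, and [cv_lim] identifies the
   limit with the [lim] that defines [theta]. *)
have thE x : x != 0 -> cv nm (theta_prod p x) (theta p x).
  move=> x0; have [l hl] := theta_prod_cv nmM nmD nmN nm1 nm0 (@normc_complete R) p1 x0.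
  by have -> : theta p x = l by exact: (cv_lim hl).
have sqrt_ex x : exists y : R[i], y ^+ 2 = x by exists (sqrtc x); exact: sqr_sqrtc.
apply: (continued_identity nmM nmD nmN nm1 nm0 nm_eq0 hq) => //.
- exact: (thetaV nmM nmD nmN nm1 nm0 nm_eq0 p1 thE).
- exact: (theta_bc_addition nmM nmD nmN nm1 nm0 nm_eq0 (@normc_complete R) p1 thE sqrt_ex).
- exact: (theta1 nmD nmN nm0 nm_eq0 thE).
- exact: (theta_cts nmM nmD nmN nm1 nm0 nm_eq0 p1 thE).
- exact: (theta_eq0 nmM nmD nmN nm1 nm0 nm_eq0 p1 thE).
- exact: generic_seq.
Qed.
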